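(* Let $K$ be an infinite field of characteristic $p>0$. Let $h=(a,1^b)$ and $h(k)=(a+k,1^{b-k})$, where $a\ge 1$ and $1\le k\le b$, and suppose $n\ge b+1$. Then $\mathrm{Ext}^1(\Delta_K(h),\Delta_K(h(k)))$ (extensions of modules over the Schur algebra $S_K(n,a+b)$) is $1$-dimensional over $K$ in each of the following cases: - $k=1$ and $p$ divides $a+b$; - $k=2$ and $p$ divides $2(a+b)/\gcd(2,a+b)^2$; - $k=3$ and $p$ divides $6/\big(\gcd(2,a+b+1)\gcd(3,a+b)\big)$; - $k=4$ and $p$ divides $2\gcd(3,a+b)/\gcd(2,a+b)$; - $k\ge 5$, $p=2$ and $a+b+k$ is odd. In all other cases, $\mathrm{Ext}^1(\Delta_K(h),\Delta_K(h(k)))=0$.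
   Context: $S_K(n,r)$ is the Schur algebra over $K$ corresponding to homogeneous polynomial representations of $GL_n(K)$ of degree $r$; here $r=a+b$. For a partition $\lambda$ of $r$ with at most $n$ parts, $\Delta_K(\lambda)$ is the Weyl module of highest weight $\lambda$ for $S_K(n,r)$. *)

(* Defs.v *)
From HB Require Import structures.
From mathcomp Require Import all_boot all_order all_fingroup all_algebra.
From mathcomp Require Import finmap monalg.

Set Implicit Arguments.
Unset Strict Implicit.
Unset Printing Implicit Defensive.

Import GRing.Theory.
Local Open Scope ring_scope.

Section Resolution.
Variable A : pzRingType.

Definition surjective (X Y : Type) (f : X -> Y) := forall y, exists x, f x = y.

Definition projective (P : lmodType A) :=
  forall (X Y : lmodType A) (g : {linear X -> Y}) (f : {linear P -> Y}),
    surjective g -> exists h : {linear P -> X}, forall x, g (h x) = f x.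

(*  ... -> P 2 -> P 1 -> P 0 -> M -> 0  *)
Record proj_resolution (M : lmodType A) := ProjResolution {
  res_obj :> nat -> lmodType A;
  res_diff : forall i, {linear res_obj i.+1 -> res_obj i};
  res_aug : {linear res_obj 0 -> M};
  _ : forall i, projective (res_obj i);
  _ : surjective res_aug;
  _ : forall x, res_aug x = 0 <-> exists y, res_diff 0 y = x;
  _ : forall i x,
        res_diff i x = 0 <-> exists y, res_diff i.+1 y = x
}.

End Resolution.

(* The free A-module on X, as finitely supported functions. monalg only       *)
(* provides the module structure for nonzero A.                               *)
Section FreeModule.
Variables (A : pzRingType) (X : choiceType).

Definition free_mod := {malg A[X]}.
HB.instance Definition _ := GRing.Zmodule.on free_mod.
Implicit Types (a b : A) (u v : free_mod).

Definition free_scale a u : free_mod :=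
  \sum_(k <- msupp u) << a * u@_k *g k >>.

Fact free_scaleE a u k : (free_scale a u)@_k = a * u@_k.
Proof.
rewrite [in RHS](monalgE u) !raddf_sum mulr_sumr /=.
by apply/eq_bigr=> i _; rewrite !mcoeffU mulrnAr.
Qed.

Fact free_scaleA a b u : free_scale a (free_scale b u) = free_scale (a * b) u.
Proof. by apply/malgP=> k; rewrite !free_scaleE mulrA. Qed.
Fact free_scale1 : left_id 1 free_scale.
Proof. by move=> u; apply/malgP=> k; rewrite free_scaleE mul1r. Qed.
Fact free_scaleDr : right_distributive free_scale +%R.
Proof.
by move=> a u v; apply/malgP=> k; rewrite mcoeffD !free_scaleE mcoeffD mulrDr.
Qed.
Fact free_scaleDl u : {morph free_scale^~ u : a b / a + b}.
Proof. by move=> a b; apply/malgP=> k; rewrite mcoeffD !free_scaleE mulrDl. Qed.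
HB.instance Definition _ := GRing.Zmodule_isLmodule.Build A free_mod
  free_scaleA free_scale1 free_scaleDr free_scaleDl.

Section Lift.
Variables (Y : lmodType A) (h : X -> Y).

Definition free_lift u : Y := \sum_(k <- msupp u) u@_k *: h k.

Lemma free_liftEw (d : {fset X}) u : (msupp u `<=` d)%fset ->
  free_lift u = \sum_(k <- d) u@_k *: h k.
Proof.
move=> le; rewrite [LHS](big_fset_incl _ le) //= => x xd /mcoeff_outdom ->.
by rewrite scale0r.
Qed.

Fact free_lift_linear : linear free_lift.
Proof.
move=> a u v; pose d := (msupp (a *: u + v) `|` msupp u `|` msupp v)%fset.
have [le1 le2 le3] : [/\ msupp (a *: u + v) `<=` d, msupp u `<=` d
    & msupp v `<=` d]%fset.
  by split; apply/fsubsetP=> k kd; rewrite !in_fsetU kd ?orbT.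
rewrite (free_liftEw le1) (free_liftEw le2) (free_liftEw le3).
rewrite scaler_sumr -big_split /=; apply: eq_bigr => k _.
by rewrite mcoeffD free_scaleE scalerDl scalerA.
Qed.
HB.instance Definition _ :=
  GRing.isLinear.Build A free_mod Y _ free_lift free_lift_linear.

Lemma free_liftU k : free_lift << 1 *g k >> = h k.
Proof.
by rewrite (free_liftEw msuppU_le) big_seq_fset1 mcoeffUU scale1r.
Qed.
End Lift.

Lemma free_projective : projective free_mod.
Proof.
move=> Y Z g f g_surj.
have ex k : exists y, g y == f << 1 *g k >>.
  by have [y <-] := g_surj (f << 1 *g k >>); exists y.
exists (free_lift (fun k => xchoose (ex k))) => u.
rewrite [in RHS](monalgE u) /= /free_lift !linear_sum /=; apply: eq_bigr => k _.
rewrite linearZ /= (eqP (xchooseP (ex k))) -linearZ; congr (f _).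
by apply/malgP=> j; rewrite free_scaleE !mcoeffU mulrnAr mulr1.
Qed.
End FreeModule.

Section Kernel.
Variables (A : pzRingType) (Y Z : lmodType A) (g : {linear Y -> Z}).

Definition ker_pred : {pred Y} := fun y => g y == 0.
Record kernel := Kernel { kernel_val :> Y; _ : kernel_val \in ker_pred }.
HB.instance Definition _ := [isSub for kernel_val].
HB.instance Definition _ := [Choice of kernel by <:].
Fact ker_submod : submod_closed ker_pred.
Proof.
split=> [|a x y]; rewrite -!topredE /= /ker_pred ?linear0 //.
by move=> /eqP gx /eqP gy; rewrite linearP gx gy scaler0 addr0.
Qed.
HB.instance Definition _ := GRing.isSubmodClosed.Build A Y ker_pred ker_submod.
HB.instance Definition _ := [SubChoice_isSubLmodule of kernel by <:].
End Kernel.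

Section Existence.
Variables (A : pzRingType) (M : lmodType A).

Definition free_cover (Y : lmodType A) : {linear free_mod A Y -> Y} :=
  free_lift (@id Y).

Lemma free_cover_surj Y : surjective (free_cover Y).
Proof. by move=> y; exists << 1 *g y >>; rewrite /free_cover /= free_liftU. Qed.

Fixpoint syzygy (i : nat) : lmodType A :=
  if i is j.+1 then kernel (free_cover (syzygy j)) else M.

Definition free_diff i :
    {linear free_mod A (syzygy i.+1) -> free_mod A (syzygy i)} :=
  (val : {linear kernel (free_cover (syzygy i)) -> free_mod A (syzygy i)})
    \o free_cover (syzygy i.+1).

Lemma free_diff_exact i x :
  free_cover (syzygy i) x = 0 <-> exists y, free_diff i y = x.
Proof.
split=> [/eqP x0 | [y <-]].
  have [y yx] := free_cover_surj (Kernel x0 : syzygy i.+1).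
  by exists y; rewrite /= [X in val X]yx.
by rewrite /=; case: (free_cover _ y) => z /= /eqP.
Qed.

Lemma exists_proj_resolution : inhabited (proj_resolution M).
Proof.
split; apply: (@ProjResolution A M (fun i => free_mod A (syzygy i)) free_diff
  (free_cover M)) => [i||x|i x].
- exact: free_projective.
- exact: free_cover_surj.
- exact: (@free_diff_exact 0 x).
- rewrite -(@free_diff_exact i.+1 x); split=> [x0 | x0]; last first.
    by rewrite /free_diff /= [X in val X]x0 raddf0.
  exact: val_inj.
Qed.
End Existence.

(* Ext over a K-algebra A. The K-algebra structure is a (central) ring        *)
(* morphism iota rather than an algType, because algType excludes the zero    *)
(* ring, which is the Schur algebra S_K(0, r) for r > 0.                      *)
Section Ext.
Variables (K : fieldType) (A : pzRingType) (iota : {rmorphism K -> A}).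

Section Cohomology.
Variables (M N : lmodType A) (P : proj_resolution M).

Definition cocycle (i : nat) (f : P i -> N) :=
  forall x, f (res_diff P i x) = 0.

Definition coboundary (i : nat) : (P i -> N) -> Prop :=
  match i with
  | 0 => fun f => forall x, f x = 0
  | j.+1 => fun f =>
      exists g : {linear P j -> N}, forall x, f x = g (res_diff P j x)
  end.

(* The classes of e_0, ..., e_(d-1) form a K-basis of H^i(Hom_A(P, N)), where *)
(* K acts on Hom_A(P_i, N) through its action on N.                           *)
Definition cohomology_basis (i d : nat) (e : 'I_d -> {linear P i -> N}) :=
  (forall j, cocycle (e j)) /\
  (forall f : {linear P i -> N}, cocycle f ->
     exists! c : 'rV[K]_d,
       coboundary (fun x => f x - \sum_j iota (c 0 j) *: e j x)).

End Cohomology.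

(* dim_K Ext^i_A(M, N) = d. Ext does not depend on the projective resolution, *)
(* and resolutions exist by exists_proj_resolution.                           *)
Definition Ext_dim (i : nat) (M N : lmodType A) (d : nat) :=
  forall P : proj_resolution M,
    exists e : 'I_d -> {linear P i -> N}, cohomology_basis e.

End Ext.

Section Schur.
Variables (K : fieldType) (n r : nat).

(* Multi-indices i : 'I_r -> 'I_n index the basis e_i of E^{(x) r}, E = K^n.  *)
Local Notation N := #|{ffun 'I_r -> 'I_n}|.

(* Place permutation: (place_mx s *m v)_i = v_(i \o s). *)
Definition place_mx (s : 'S_r) : 'M[K]_N :=
  \matrix_(i, j)
    (enum_val j == [ffun k => (enum_val i : {ffun 'I_r -> 'I_n}) (s k)])%:R.

(* S_K(n, r) = End_{K S_r}(E^{(x) r}). *)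
Definition place_commutant : {pred 'M[K]_N} :=
  fun B => [forall s : 'S_r, B *m place_mx s == place_mx s *m B].

Record schur := Schur { schur_mx :> 'M[K]_N; _ : schur_mx \in place_commutant }.

HB.instance Definition _ := [isSub for schur_mx].
HB.instance Definition _ := [Choice of schur by <:].

Fact place_commutant_subring : subring_closed place_commutant.
Proof.
split=> [|B C /forallP hB /forallP hC|B C /forallP hB /forallP hC].
- by apply/forallP=> s; rewrite mulmx1 mul1mx.
- by apply/forallP=> s; rewrite mulmxBl mulmxBr (eqP (hB s)) (eqP (hC s)).
- apply/forallP=> s.
  by rewrite -mulmxA (eqP (hC s)) !mulmxA (eqP (hB s)).
Qed.

HB.instance Definition _ :=
  GRing.isSubringClosed.Build 'M[K]_N place_commutant
  place_commutant_subring.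
HB.instance Definition _ := GRing.SubChoice_isSubPzRing.Build _ _ schur
  (GRing.subringClosedP _).

Fact scalar_place_commutant (c : K) : c%:M \in place_commutant.
Proof. by apply/forallP=> s; rewrite scalar_mxC. Qed.

Definition schur_scalar (c : K) : schur := Schur (scalar_place_commutant c).

Fact schur_scalar_is_zmod_morphism : zmod_morphism schur_scalar.
Proof. by move=> c d; apply: val_inj; rewrite /= raddfB. Qed.
Fact schur_scalar_is_monoid_morphism : monoid_morphism schur_scalar.
Proof. by split=> [|c d]; apply: val_inj; rewrite /= ?scalar_mxM. Qed.
HB.instance Definition _ := GRing.isZmodMorphism.Build K schur schur_scalar
  schur_scalar_is_zmod_morphism.
HB.instance Definition _ := GRing.isMonoidMorphism.Build K schur schur_scalar
  schur_scalar_is_monoid_morphism.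

(* E^{(x) r} as a left S_K(n, r)-module *)
Definition tensor_space := 'cV[K]_N.
HB.instance Definition _ := GRing.Zmodule.on tensor_space.

Definition schur_act (B : schur) (v : tensor_space) : tensor_space :=
  schur_mx B *m v.

Fact schur_actA B C v : schur_act B (schur_act C v) = schur_act (B * C) v.
Proof. exact: mulmxA. Qed.
Fact schur_act1 : left_id 1 schur_act. Proof. exact: mul1mx. Qed.
Fact schur_actDr : right_distributive schur_act +%R.
Proof. by move=> B u v; exact: mulmxDr. Qed.
Fact schur_actDl v : {morph schur_act^~ v : B C / B + C}.
Proof. by move=> B C; exact: mulmxDl. Qed.
HB.instance Definition _ := GRing.Zmodule_isLmodule.Build schur tensor_space
  schur_actA schur_act1 schur_actDr schur_actDl.

Section Weyl.
Variable la : seq nat.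

(* The Young diagram of la is filled row by row with the places 0, ..., r-1;  *)
(* place k lies in row (reshape_index la k), column (reshape_offset la k).    *)
(* Meaningful when la is a partition of r.                                    *)
Definition row_stab : {set 'S_r} :=
  [set s : 'S_r |
     [forall k : 'I_r, reshape_index la (s k) == reshape_index la k]].
Definition col_stab : {set 'S_r} :=
  [set s : 'S_r |
     [forall k : 'I_r, reshape_offset la (s k) == reshape_offset la k]].

(* D_(la_1) E (x) D_(la_2) E (x) ..., as row-symmetric tensors *)
Definition divided_power : {vspace 'cV[K]_N} :=
  (\bigcap_(s in row_stab) lker (linfun (mulmx (place_mx s - 1%:M))))%VS.

Definition col_antisym : 'M[K]_N :=
  \sum_(s in col_stab) (-1) ^+ s *: place_mx s.

(* Delta(la) is the image of the composite of the comultiplication            *)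
(* D_(la_1) (x) D_(la_2) (x) ... -> E^{(x) r} with the multiplication         *)
(* E^{(x) r} -> L^(la'_1) (x) L^(la'_2) (x) ... along the columns, where the  *)
(* exterior power L^m E is embedded in E^{(x) m} by antisymmetrization.       *)
Definition weyl_space : {vspace 'cV[K]_N} :=
  (linfun (mulmx col_antisym) @: divided_power)%VS.

Definition weyl_pred : {pred tensor_space} := fun v => v \in weyl_space.

Record weyl := Weyl { weyl_val :> tensor_space; _ : weyl_val \in weyl_pred }.

HB.instance Definition _ := [isSub for weyl_val].
HB.instance Definition _ := [Choice of weyl by <:].

Fact weyl_submod : submod_closed weyl_pred.
Proof.
split=> [|B u v]; first exact: mem0v.
move=> /memv_imgP[x xD ->] /memv_imgP[y yD ->].
apply/memv_imgP; exists (schur_mx B *m x + y); last first.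
  rewrite !lfunE /= mulmxDr; congr (_ + _).
  rewrite [LHS]mulmxA [RHS]mulmxA; congr (_ *m _).
  rewrite mulmx_sumr mulmx_suml; apply: eq_bigr => s _.
  by rewrite -scalemxAl -scalemxAr; case: B => B /= /forallP/(_ s)/eqP->.
rewrite memvD //; move: xD; rewrite !memvE => /subv_bigcapP xD.
apply/subv_bigcapP=> s sR; move: (xD s sR).
rewrite -!memvE !memv_ker !lfunE /= => /eqP xs0.
case: B => B /= /forallP/(_ s)/eqP Bs.
by rewrite mulmxA mulmxBl mul1mx -Bs -{2}[B]mulmx1 -mulmxBr -mulmxA xs0 mulmx0.
Qed.

HB.instance Definition _ :=
  GRing.isSubmodClosed.Build schur tensor_space weyl_pred weyl_submod.
HB.instance Definition _ := [SubChoice_isSubLmodule of weyl by <:].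

End Weyl.
End Schur.

(* Main.v *)
(* Write S for the Schur algebra and let xi_u be the idempotent of the weight of
   the word u. The hook Weyl module of (a, 1^b) is the quotient of S xi_w, where
   w reads the rows, by the images of S xi_(w_j) with w_j obtained by fusing the
   rows j and j+1; the relations between these submodules come from fusing two
   pairs of rows. Hence Ext^1 into N is given by vectors x_j of weight w_j in N,
   one for each j < b, subject to one equation for each pair i < j, modulo the
   images of a vector of weight w. When N is the Weyl module of (a+k, 1^(b-k)),
   its standard tableaux are the sets S of b-k marks in {1, ..., b}, and fusing
   either doubles a coordinate or takes its difference along the move of a mark
   from j to j+1. The differences are consistent around squares, so they have a
   potential; after subtracting its coboundary a cocycle only depends on k
   scalars z_0, ..., z_(k-1) with, for 1 <= i, j, the relations 2 z_i = 2 z_j if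
   |i-j| > 1, 3 z_i = 3 z_(i+1), 2 z_0 = (a+b-k+1) z_j if j > 1, and
   (a+b-k+2) z_0 = binomial(a+b-k+2, 2) z_1. The remaining coboundaries are the
   multiples of (a+b-k+1, 2, ..., 2), and it remains to compare the two spaces in
   each characteristic. *)

From HB Require Import structures.
Require Import Defs.
From mathcomp Require Import all_boot all_order all_fingroup all_algebra.
From mathcomp Require Import finmap.
From mathcomp Require Import zify ring.

Set Implicit Arguments.
Unset Strict Implicit.
Unset Printing Implicit Defensive.

(** That pairs of fusions account for all relations is a distributivity statement: the invariants of
    the various fused Young subgroups must be spanned by subsets of one basis. The orbit sums
    [run_sum u] are such a basis over any field, [u] belonging to the invariants whose colour
    classes lie inside its weakly decreasing runs. The same basis gives the presentation, because a
    row-fixed word not fixed by any fusion is standard. The integers in the relations are binomial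
    coefficients counting the places to relabel when one letter is fused into another. The signs
    come from straightening a column; twisting by (-1)^(sum of the marks) leaves only counts of
    unmarked letters. The relations on z are necessary conditions, obtained at leftmost marks. That
    they come from a cocycle has to be checked at every set of marks, but only for one
    representative in each exceptional case. Characteristic 3 is special for k = 3 and k = 4 because
    the graph on 1, ..., k-1 joining indices at distance at least 2 is then disconnected; it is
    connected for k >= 5. *)

Module HookWeyl.
Import GRing.Theory.
Local Open Scope ring_scope.

(** * Words and Young invariants *)

Section Words.
Variables (K : fieldType) (n r : nat).

Local Notation word := {ffun 'I_r -> 'I_n}.
Local Notation tens := 'cV[K]_#|{ffun 'I_r -> 'I_n}|.

Definition permute (u : word) (s : 'S_r) : word := [ffun k => u (s k)].

Definition entry (v : tens) (u : word) : K := v (enum_rank u) 0.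
Definition vec (f : word -> K) : tens := \col_i f (enum_val i).
Definition bas (u : word) : tens := vec (fun t => (t == u)%:R).

Lemma entry_vec f u : entry (vec f) u = f u.
Proof. by rewrite /entry mxE enum_rankK. Qed.

Lemma entryP v v' : (forall u, entry v u = entry v' u) -> v = v'.
Proof.
move=> vv'; apply/matrixP=> i j; rewrite ord1.
by have:= vv' (enum_val i); rewrite /entry enum_valK.
Qed.

Lemma entry0 u : entry 0 u = 0. Proof. by rewrite /entry mxE. Qed.
Lemma entryD v v' u : entry (v + v') u = entry v u + entry v' u.
Proof. by rewrite /entry mxE. Qed.
Lemma entryB v v' u : entry (v - v') u = entry v u - entry v' u.
Proof. by rewrite /entry !mxE. Qed.
Lemma entryZ a v u : entry (a *: v) u = a * entry v u.
Proof. by rewrite /entry mxE. Qed.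
Lemma entry_sum I (s : seq I) (P : pred I) (F : I -> tens) u :
  entry (\sum_(i <- s | P i) F i) u = \sum_(i <- s | P i) entry (F i) u.
Proof. by rewrite /entry summxE. Qed.

Lemma bas_expand v : v = \sum_u entry v u *: bas u.
Proof.
apply: entryP => t; rewrite entry_sum (bigD1 t) //= big1 => [|u /negPf ut].
  by rewrite entryZ entry_vec eqxx mulr1 addr0.
by rewrite entryZ entry_vec eq_sym ut mulr0.
Qed.

Lemma entry_mul (B : 'M[K]_#|{ffun 'I_r -> 'I_n}|) v u :
  entry (B *m v) u = \sum_t B (enum_rank u) (enum_rank t) * entry v t.
Proof.
rewrite /entry mxE (reindex (fun t : word => enum_rank t)) //=.
by exists enum_val => t _; rewrite ?enum_rankK ?enum_valK.
Qed.

Lemma entry_place s v u : entry (place_mx K n s *m v) u = entry v (permute u s).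
Proof.
rewrite entry_mul (bigD1 (permute u s)) //= big1 => [|t /negPf tu].
  by rewrite mxE !enum_rankK eqxx mul1r addr0.
by rewrite mxE !enum_rankK -[X in t == X]/(permute u s) tu mul0r.
Qed.

Lemma permute1 u : permute u 1 = u.
Proof. by apply/ffunP=> k; rewrite ffunE perm1. Qed.
Lemma permuteM u s t : permute u (s * t) = permute (permute u t) s.
Proof. by apply/ffunP=> k; rewrite !ffunE permM. Qed.
Lemma permuteK s : cancel (permute^~ s) (permute^~ s^-1%g).
Proof. by move=> u; rewrite -permuteM mulVg permute1. Qed.
Lemma permuteKV s : cancel (permute^~ s^-1%g) (permute^~ s).
Proof. by move=> u; rewrite -permuteM mulgV permute1. Qed.

Lemma place_bas s u : place_mx K n s *m bas u = bas (permute u s^-1).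
Proof.
apply: entryP => t; rewrite entry_place !entry_vec; congr (_%:R).
by rewrite -(can_eq (permuteK s) t) permuteKV.
Qed.

Lemma schur_mxP (B B' : 'M[K]_#|{ffun 'I_r -> 'I_n}|) :
  (forall u, B *m bas u = B' *m bas u) -> B = B'.
Proof.
move=> BB'; apply/matrixP=> i j; have:= BB' (enum_val j).
move/(congr1 (entry^~ (enum_val i))); rewrite !entry_mul.
by do 2![rewrite (bigD1 (enum_val j)) //= big1 => [|u /negPf uj];
  rewrite ?entry_vec ?uj ?mulr0 // eqxx mulr1 addr0]; rewrite !enum_valK.
Qed.

(** Encoding a Young subgroup by a colouring of the places turns inclusions of subgroups into
    implications between equalities of colours, and fusing rows into composing with a map on
    colours. *)
Definition young_fixed (c : 'I_r -> nat) (v : tens) :=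
  forall s : 'S_r, (forall k, c (s k) = c k) -> place_mx K n s *m v = v.

Lemma young_fixed_entry c v (s : 'S_r) u : young_fixed c v ->
  (forall k, c (s k) = c k) -> entry v (permute u s) = entry v u.
Proof. by move=> cv cs; rewrite -entry_place cv. Qed.

Lemma young_fixedD c v v' :
  young_fixed c v -> young_fixed c v' -> young_fixed c (v + v').
Proof. by move=> cv cv' s cs; rewrite mulmxDr cv ?cv'. Qed.
Lemma young_fixedZ c x v : young_fixed c v -> young_fixed c (x *: v).
Proof. by move=> cv s cs; rewrite -scalemxAr cv. Qed.
Lemma young_fixed0 c : young_fixed c 0.
Proof. by move=> s cs; rewrite mulmx0. Qed.
Lemma young_fixedB c v v' :
  young_fixed c v -> young_fixed c v' -> young_fixed c (v - v').
Proof. by move=> cv cv' s cs; rewrite mulmxBr cv ?cv'. Qed.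
Lemma young_fixed_sum c I (s : seq I) (P : pred I) (F : I -> tens) :
  (forall i, P i -> young_fixed c (F i)) ->
  young_fixed c (\sum_(i <- s | P i) F i).
Proof.
move=> cF; apply: (big_ind (young_fixed c)) => //.
  exact: young_fixed0.
exact: young_fixedD.
Qed.

Lemma young_fixed_refine (c c' : 'I_r -> nat) v :
  (forall k l, c k = c l -> c' k = c' l) ->
  young_fixed c' v -> young_fixed c v.
Proof. by move=> cc' cv s cs; apply: cv => k; apply: cc'. Qed.

Lemma young_fixed_schur c (B : schur K n r) v :
  young_fixed c v -> young_fixed c (schur_mx B *m v).
Proof.
move=> cv s cs; case: B => B /= /forallP/(_ s)/eqP Bs.
by rewrite mulmxA -Bs -mulmxA cv.
Qed.

(** With the default 0 the last place is never an ascent. *)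
Definition letter (u : word) (i : nat) : nat :=
  if insub i is Some k then u k else 0%N.
Lemma letterE u (k : 'I_r) : letter u k = u k.
Proof. by rewrite /letter valK. Qed.

Definition ascent u i := (letter u i < letter u i.+1)%N.
(** Numbers the maximal weakly decreasing blocks of [u]; as a colouring it encodes the largest Young
    subgroup of consecutive places inside whose classes [u] is already sorted. *)
Definition run u i : nat := \sum_(0 <= l < i) ascent u l.

Lemma runS u i : run u i.+1 = (run u i + ascent u i)%N.
Proof. by rewrite /run big_nat_recr. Qed.

Lemma run_mono u i j : (i <= j)%N -> (run u i <= run u j)%N.
Proof.
elim: j => [|j IH]; first by rewrite leqn0 => /eqP->.
by rewrite leq_eqVlt ltnS => /predU1P[-> //|/IH]; rewrite runS; lia.
Qed.

Lemma run_desc u i j : (i <= j)%N -> run u i = run u j ->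
  (letter u j <= letter u i)%N.
Proof.
elim: j => [|j IH]; first by rewrite leqn0 => /eqP->.
rewrite leq_eqVlt ltnS => /predU1P[-> //|ij] runE.
have:= run_mono u ij; move: runE; rewrite runS => e1 e2.
have e3 : run u i = run u j by lia.
have:= IH ij e3; move: e1 e2; rewrite /ascent; lia.
Qed.

(** An orbit sum with all coefficients 1. Summing over the group instead would multiply it by the
    order of a stabilizer, which may vanish in K. *)
Definition run_sum u : tens := vec (fun t =>
  [exists s : 'S_r, [forall k, run u (s k) == run u k] &&
     (t == permute u s)]%:R).

Lemma run_sum_fixed u : young_fixed (run u) (run_sum u).
Proof.
move=> s us; apply: entryP => t; rewrite entry_place !entry_vec; congr (nat_of_bool _)%:R.
apply/existsP/existsP => -[s' /andP[/forallP us' /eqP e]].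
- exists (s^-1 * s')%g; apply/andP; split; last first.
    by rewrite permuteM -e permuteK.
  by apply/forallP=> k; rewrite permM (eqP (us' _)) -{2}[k](permKV s) us.
- exists (s * s')%g; apply/andP; split; last by rewrite permuteM -e.
  by apply/forallP=> k; rewrite permM (eqP (us' _)) us.
Qed.

Lemma entry_run_sum u : entry (run_sum u) u = 1.
Proof.
rewrite entry_vec; case: existsP => // -[]; exists 1%g.
by rewrite permute1 eqxx andbT; apply/forallP=> k; rewrite perm1.
Qed.

(* Sorting a run in decreasing order strictly increases this weight. *)
Definition weight (u : word) : nat := \sum_(k < r) (r - k) * u k.

Lemma weight_swap u i (k l : 'I_r) : k = i :> nat -> l = i.+1 :> nat ->
  ascent u i -> (weight u < weight (permute u (tperm k l)))%N.
Proof.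
move=> ki li; rewrite /ascent -ki; have -> : k.+1 = l by rewrite ki li.
rewrite !letterE => ukl.
have kl : l != k by rewrite -val_eqE /= ki li; lia.
rewrite /weight (bigD1 k) // [X in (_ < X)%N](bigD1 k) //=.
rewrite (bigD1 l) // [X in (_ < _ + X)%N](bigD1 l) //= !ffunE tpermL tpermR.
rewrite [X in (_ < _ + (_ + X))%N](eq_bigr (fun j : 'I_r => (r - j) * u j)%N).
  by move: (ltn_ord l); rewrite li ki; set S := \sum_(_ | _) _; nia.
by move=> j /andP[jk jl]; rewrite ffunE tpermD // eq_sym.
Qed.

(** Both words are weakly decreasing on the runs of [u] and have the same letters there. At the
    first place [k] where they differ, following the orbit of [k] under [s] leads to earlier places
    forever, although the orbit must return to [k]. *)
Lemma run_sorted_uniq u v (s : 'S_r) :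
  (forall k, run u (s k) = run u k) -> v = permute u s ->
  (forall k l : 'I_r, (k <= l)%N -> run u k = run u l -> (v l <= v k)%N) ->
  v = u.
Proof.
move=> us vs vdesc; apply/eqP/negPn/negP => vu.
have /existsP[k0 k0P] : [exists k, v k != u k].
  apply: contraR vu; rewrite negb_exists => /forallP vu.
  by apply/eqP/ffunP=> k; apply/eqP; rewrite -[_ == _]negbK vu.
have [k kP kmin] := @arg_minnP _ k0 (fun k => v k != u k) val k0P.
have lt_eq (j : 'I_r) : (j < k)%N -> v j = u j.
  by move=> jk; apply/eqP; apply: contraTT jk => /kmin; rewrite -leqNgt.
have udesc : forall k l : 'I_r, (k <= l)%N -> run u k = run u l -> (u l <= u k)%N.
  by move=> i j ij /(run_desc ij); rewrite !letterE.
have runX i j : run u ((s ^+ i)%g j) = run u j.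
  by elim: i => [|i IH]; rewrite ?perm1 // expgSr permM us IH.
have runVX i : run u ((s ^- i)%g k) = run u k by rewrite -(runX i) permKV.
have order_s : (s ^+ #[s])%g k = k by rewrite expg_order perm1.
have os : #[s]%g = #[s]%g.-1.+1 by rewrite prednK // order_gt0.
(* The smaller value decides the direction: the orbit is followed under the inverse of [s] if [v k]
   is smaller, under [s] otherwise. Each new place carries too large a letter to be at or after
   [k]. *)
case: (ltngtP (v k) (u k)) => [lt|gt|/val_inj e]; last by rewrite e eqxx in kP.
- have step i : ((s ^- i)%g k <= k)%N -> v ((s ^- i.+1)%g k) = u ((s ^- i)%g k).
    by move=> _; rewrite vs ffunE expgS invMg permM permKV.
  have claim i : ((s ^- i)%g k <= k)%N /\ (u k <= u ((s ^- i)%g k))%N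
      /\ ((0 < i)%N -> ((s ^- i)%g k < k)%N).
    elim: i => [|i [IH1 [IH2 _]]]; first by rewrite invg1 perm1.
    set j := (s ^- i.+1)%g k.
    have vj : v j = u ((s ^- i)%g k) by apply: step.
    have jk : (j < k)%N.
      rewrite ltnNge; apply/negP => kj.
      have := vdesc k j kj; rewrite runVX => /(_ erefl); rewrite vj.
      by rewrite leqNgt (leq_trans lt).
    by split; [apply: ltnW | rewrite -(lt_eq j jk) vj].
  have [_ [_ /(_ isT)]] := claim #[s]%g.-1.+1.
  by rewrite -os expg_order invg1 perm1 ltnn.
- have claim i : ((0 < i)%N -> ((s ^+ i)%g k < k)%N) /\ (v k <= v ((s ^+ i)%g k))%N.
    elim: i => [|i [IH1 IH2]]; first by rewrite perm1.
    set j := (s ^+ i.+1)%g k.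
    have uj : u j = v ((s ^+ i)%g k) by rewrite vs ffunE /j expgSr permM.
    have jk : (j < k)%N.
      rewrite ltnNge; apply/negP => kj.
      have := udesc k j kj; rewrite runX => /(_ erefl); rewrite uj.
      by rewrite leqNgt (leq_trans gt).
    by split=> //; rewrite (lt_eq j jk) uj.
  by have [/(_ isT)] := claim #[s]%g.-1.+1; rewrite -os order_s ltnn.
Qed.

(** A word of maximal weight in the orbit has no ascent inside a run, since swapping an ascent
    raises the weight; by uniqueness of sorting it is [u]. *)
Lemma run_sum_triangular u t : entry (run_sum u) t != 0 ->
  t != u -> (weight t < weight u)%N.
Proof.
rewrite entry_vec; case: existsP => [[s /andP[us /eqP ts]] _|]; last by rewrite eqxx.
pose P v := [exists s : 'S_r, [forall k, run u (s k) == run u k] &&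
     (v == permute u s)].
have Pt : P t by apply/existsP; exists s; rewrite us ts /=.
have max_eq v : P v -> (forall v', P v' -> (weight v' <= weight v)%N) -> v = u.
  case/existsP=> s' /andP[/forallP us' /eqP vs'] vmax.
  apply: (@run_sorted_uniq u v s') => // [k|k l]; first exact/eqP.
  have noasc i : (i.+1 < r)%N -> run u i = run u i.+1 -> ~~ ascent v i.
    move=> ir ri; apply/negP => asc.
    pose k' := Ordinal (ltnW ir); pose l' := Ordinal ir.
    have /(_ erefl erefl) := @weight_swap v i k' l'; move=> /(_ asc).
    rewrite ltnNge => /negP[]; apply: vmax; apply/existsP.
    exists (tperm k' l' * s')%g; apply/andP; split; last by rewrite permuteM vs'.
    apply/forallP=> j; rewrite permM (eqP (us' _)).
    by case: tpermP => // ->; rewrite /= ri.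
  suff gen d : forall j, (k + d = j)%N -> (j < r)%N -> run u k = run u j ->
      (letter v j <= letter v k)%N.
    by move=> kl ukl; rewrite -!letterE; apply: (gen (l - k)%N); rewrite ?subnKC.
  elim: d => [|d IH] j kd jr; first by move: kd; rewrite addn0 => <-.
  move=> e; have ej : j = (k + d).+1 by lia.
  have m1 := run_mono u (leq_addr d k); have m2 := run_mono u (leqnSn (k + d)).
  rewrite ej in e jr *.
  apply: leq_trans (IH _ erefl _ _); [|lia|lia].
  by have := noasc _ jr; rewrite /ascent -leqNgt; apply; lia.
have [v Pv vmax] := @arg_maxnP _ t P weight Pt.
have vu : v = u by apply: max_eq.
have le_tu : (weight t <= weight u)%N by have := vmax t Pt; rewrite vu.
move=> tu; rewrite ltn_neqAle le_tu andbT; apply: contraNneq tu => e; apply/eqP.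
apply: max_eq => // v' /vmax; by rewrite vu e.
Qed.

(** The classes of a monotone colouring are intervals, so comparing neighbouring places suffices. *)
Lemma run_step_eq (c : 'I_r -> nat) u :
  {homo c : k l / (k <= l)%N >-> (k <= l)%N} ->
  (forall k l : 'I_r, l = k.+1 :> nat -> c k = c l -> ~~ ascent u k) ->
  forall k l, c k = c l -> run u k = run u l.
Proof.
move=> cmono cdesc.
have gen d : forall (k l : 'I_r), (k + d = l)%N -> c k = c l -> run u k = run u l.
  elim: d => [|d IH] k l kl ckl; first by have -> : k = l by apply: val_inj; rewrite /= -kl addn0.
  have kdr : (k + d < r)%N by have := ltn_ord l; lia.
  pose j := Ordinal kdr.
  have h1 : (c k <= c j)%N by apply: cmono; rewrite /= leq_addr.
  have h2 : (c j <= c l)%N by apply: cmono => /=; lia.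
  have -> : run u k = run u j by apply: IH => //; lia.
  have lj : l = j.+1 :> nat by rewrite /=; lia.
  have -> : run u l = run u j.+1 by rewrite lj.
  rewrite runS.
  have nas : ~~ ascent u j by apply: (cdesc j l lj); lia.
  by rewrite (negPf nas) addn0.
move=> k l ckl; case: (leqP k l) => kl; first by apply: (gen (l - k)%N); rewrite ?subnKC.
by symmetry; apply: (gen (k - l)%N); rewrite ?subnKC // ltnW.
Qed.

(* The run sums are a basis adapted to all the spaces of Young invariants:    *)
(* peel off the words of largest weight in the support.                       *)
Lemma young_fixed_span (c : 'I_r -> nat) v :
  {homo c : k l / (k <= l)%N >-> (k <= l)%N} -> young_fixed c v ->
  exists2 x : word -> K, v = \sum_u x u *: run_sum u &
    forall u, x u != 0 -> forall k l, c k = c l -> run u k = run u l.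
Proof.
move=> cmono cv.
suff gen B : forall v, young_fixed c v -> (forall u, entry v u != 0 -> (weight u < B)%N) ->
  exists2 x : word -> K, v = \sum_u x u *: run_sum u &
    forall u, x u != 0 -> forall k l, c k = c l -> run u k = run u l.
  apply: (gen (\max_u weight u).+1) => // u _.
  by rewrite ltnS leq_bigmax.
elim: B => [|B IH] {}v {}cv vB.
  exists (fun _ => 0) => [|u]; last by rewrite eqxx.
  rewrite big1 => [|u _]; last by rewrite scale0r.
  apply: entryP => u; rewrite entry0; apply/eqP/negPn/negP => /vB //.
have top u : entry v u != 0 -> weight u = B -> forall k l, c k = c l -> run u k = run u l.
  move=> vu uB; apply: run_step_eq => // k l lk ckl; apply/negP => asc.
  have := @weight_swap u k k l erefl lk asc; rewrite ltnNge uB -ltnS => /negP[].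
  apply: vB; rewrite (young_fixed_entry _ cv) //.
  by move=> j; case: tpermP => // ->.
pose t := \sum_(u | weight u == B) entry v u *: run_sum u.
have ct : young_fixed c t.
  apply: young_fixed_sum => u /eqP uB; have [->|vu] := eqVneq (entry v u) 0.
    by rewrite scale0r; apply: young_fixed0.
  by apply: young_fixedZ; apply: young_fixed_refine (top u vu uB) _; apply: run_sum_fixed.
have [||x vE xP] := IH (v - t).
- exact: young_fixedB.
- move=> u; apply: contra_neqT; rewrite -leqNgt entryB entry_sum => Bu.
  have [uB|uB] := eqVneq (weight u) B.
    rewrite (bigD1 u) ?uB //= entryZ entry_run_sum mulr1 big1 ?addr0 ?subrr //.
    move=> u' /andP[/eqP u'B u'u]; rewrite entryZ; apply/eqP; rewrite mulf_eq0.
    apply/orP; right; apply: contra_eqT uB => /run_sum_triangular.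
    by rewrite eq_sym u'B => /(_ u'u); lia.
  rewrite big1 => [|u' /eqP u'B].
    rewrite subr0; apply/eqP; apply: contraNT uB => /vB; rewrite ltnS => ?.
    by rewrite eqn_leq Bu andbT.
  rewrite entryZ; apply/eqP; rewrite mulf_eq0.
  apply/orP; right; apply: contraTT Bu => /run_sum_triangular.
  rewrite u'B -ltnNge; apply; apply: contraNneq uB => ->; exact/eqP.
exists (fun u => x u + (if weight u == B then entry v u else 0)) => [|u].
  have vt : v = v - t + t by rewrite subrK.
  rewrite [LHS]vt vE /t [X in _ + X]big_mkcond -big_split /=.
  by apply: eq_bigr => u _; rewrite scalerDl; case: ifP => // _; rewrite scale0r.
have [x0|/xP//] := eqVneq (x u) 0; rewrite x0 add0r.
by case: ifP => [/eqP uB vu|_]; [apply: top | rewrite eqxx].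
Qed.

Definition mx_of_bas (G : word -> tens) : 'M[K]_#|{ffun 'I_r -> 'I_n}| :=
  \matrix_(i, j) entry (G (enum_val j)) (enum_val i).

Lemma mul_mx_of_bas G u : mx_of_bas G *m bas u = G u.
Proof.
apply: entryP => t; rewrite entry_mul (bigD1 u) //= big1 => [|u' /negPf uu'].
  by rewrite entry_vec eqxx mulr1 addr0 mxE !enum_rankK.
by rewrite entry_vec uu' mulr0.
Qed.

(** The run sums span and there are as many of them as words, so their matrix is invertible and
    values on them can be prescribed freely. *)
Lemma run_sum_extend (G : word -> tens) :
  exists F : 'M[K]_#|{ffun 'I_r -> 'I_n}|, forall u, F *m run_sum u = G u.
Proof.
have surj (v : tens) : exists x : tens, mx_of_bas run_sum *m x == v.
  (* For the injective colouring the Young subgroup is trivial and every tensor is fixed. *)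
  have [||x -> _] := @young_fixed_span (fun k => val k) v; first by [].
    move=> s ss; have -> : s = 1%g by apply/permP=> k; rewrite perm1; apply: val_inj.
    by apply: entryP => u; rewrite entry_place permute1.
  exists (\sum_u x u *: bas u); apply/eqP; rewrite mulmx_sumr.
  by apply: eq_bigr => u _; rewrite -scalemxAr mul_mx_of_bas.
have BC : mx_of_bas run_sum *m mx_of_bas (fun u => xchoose (surj (bas u))) = 1%:M.
  apply: schur_mxP => u; rewrite -mulmxA mul_mx_of_bas mul1mx.
  exact/eqP/(xchooseP (surj (bas u))).
have [Bu _] := mulmx1_unit BC.
exists (mx_of_bas G *m invmx (mx_of_bas run_sum)) => u.
by rewrite -[X in _ *m X]mul_mx_of_bas -mulmxA mulKmx // mul_mx_of_bas.
Qed.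

End Words.

Lemma reshape_index_hook a b i : (0 < a)%N -> (i < a + b)%N ->
  reshape_index (a :: nseq b 1%N) i = (i.+1 - a)%N.
Proof.
move=> a0 ib; rewrite /reshape_index /=; have [d0|d0] := posnP (i.+1 - a).
  by rewrite d0.
rewrite -[RHS](prednK d0); congr _.+1.
have : (i.+1 - a <= b)%N by lia.
elim: b (i.+1 - a)%N d0 {ib} => [|b IH] [|d] //= _; rewrite subn1 /= ltnS => db.
by case: d db => [|d] db //=; rewrite IH.
Qed.

Lemma reshape_offset_hook a b i : (0 < a)%N -> (i < a + b)%N ->
  reshape_offset (a :: nseq b 1%N) i = if (i < a)%N then i else 0%N.
Proof.
move=> a0 ib; rewrite /reshape_offset reshape_index_hook //.
case: ltnP => ia; first by rewrite (eqP (_ : i.+1 - a == 0)%N) ?subn0 // subn_eq0.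
have [d dE] : exists d, i = (a + d)%N by exists (i - a)%N; lia.
rewrite dE; have -> : ((a + d).+1 - a = d.+1)%N by lia.
rewrite /= take_nseq ?sumn_nseq; lia.
Qed.

(** The label j+1 is vacated and the later rows keep theirs, so that fusions at different places can
    be compared without renumbering. *)
Definition fuse (j l : nat) : nat := if l == j.+1 then j else l.

Lemma fuseE j l : fuse j l = (l - (l == j.+1))%N.
Proof. by rewrite /fuse; case: eqP => [->|_]; rewrite ?subn1 ?subn0. Qed.

(** Exhibits the double fusion as a function of [fuse i l]; by definition it is already one of
    [fuse j l]. Hence it is coarser than both single fusions. *)
Lemma fuse_fuse i j l : (i < j)%N ->
  fuse i (fuse j l) = if fuse i l == j.+1 then fuse i j else fuse i l.
Proof.
move=> ij; rewrite /fuse; have [->|lj] := eqVneq l j.+1.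
  have /negPf-> : j.+1 != i.+1 by rewrite eqSS gtn_eqF.
  by rewrite eqxx.
by have [_|_] := eqVneq l i.+1; [rewrite ltn_eqF // ltnW|rewrite (negPf lj)].
Qed.

Lemma fuse_mono j : {homo fuse j : x y / (x <= y)%N >-> (x <= y)%N}.
Proof. by move=> x y; rewrite !fuseE; lia. Qed.

(** Two consecutive rows merged by the double fusion are already merged by one of the single ones;
    this is why the double fusion adds no new generator of the Young subgroup. *)
Lemma fuse_step i j x : (i < j)%N ->
  fuse i (fuse j x) = fuse i (fuse j x.+1) -> x = i \/ x = j.
Proof.
move=> ij; have [->|xj] := eqVneq x j; first by right.
have -> : fuse j x.+1 = x.+1 by rewrite /fuse eqSS (negPf xj).
have [->|xj1] := eqVneq x j.+1.
  have -> : fuse j j.+1 = j by rewrite /fuse eqxx.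
  by rewrite !fuseE; lia.
have -> : fuse j x = x by rewrite /fuse (negPf xj1).
by rewrite !fuseE; lia.
Qed.

(** * A presentation of the hook Weyl module *)

Section Hook.
Variables (K : fieldType) (n r a b : nat).
Hypotheses (a0 : (0 < a)%N) (rE : r = (a + b)%N).

Local Notation word := {ffun 'I_r -> 'I_n}.
Local Notation tens := 'cV[K]_#|{ffun 'I_r -> 'I_n}|.
Local Notation hook := (a :: nseq b 1%N).
Local Notation antisym := (col_antisym K n r hook).

(** The row number: truncation sends the first [a] places to row 0, and the place a+i lies in row
    i+1. *)
Definition row_color (k : 'I_r) : nat := (k.+1 - a)%N.

(** The first column of the hook; the other columns are single places, so it carries the whole
    column group. *)
Definition col_place (k : nat) := (k == 0%N) || (a <= k)%N.

Lemma row_stab_hook s :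
  (s \in row_stab r hook) = [forall k, row_color (s k) == row_color k].
Proof.
rewrite inE; apply: eq_forallb => k.
by rewrite !reshape_index_hook // -rE.
Qed.

Lemma offset_hook (k : 'I_r) :
  reshape_offset hook k = if (k < a)%N then k : nat else 0%N.
Proof. by rewrite reshape_offset_hook // -rE. Qed.

Lemma col_stab_hookP (s : 'S_r) :
  reflect (forall k : 'I_r, ~~ col_place k -> s k = k) (s \in col_stab r hook).
Proof.
rewrite inE; apply: (iffP forallP) => [sk k|sk k].
  rewrite /col_place negb_or -ltnNge => /andP[k0 ka].
  move/eqP: (sk k); rewrite !offset_hook ka.
  case: ltnP => [_ /val_inj //|_ e]; by rewrite -e in k0.
rewrite !offset_hook; have [ck|/sk-> //] := boolP (col_place k).
have [csk|/sk e] := boolP (col_place (s k)); last by rewrite (perm_inj e).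
move: ck csk; rewrite /col_place; set x := nat_of_ord k; set y := nat_of_ord (s k).
by case: (ltnP y a) => ya; case: (ltnP x a) => xa h1 h2; apply/eqP; lia.
Qed.

Lemma divided_power_hook v :
  v \in divided_power K n r hook <-> young_fixed row_color v.
Proof.
rewrite memvE; split=> [/subv_bigcapP vR s cs|cv].
  have sR : s \in row_stab r hook by rewrite row_stab_hook; apply/forallP=> k; rewrite cs.
  have := vR s sR; rewrite -memvE memv_ker lfunE /= mulmxBl mul1mx subr_eq0.
  by move/eqP.
apply/subv_bigcapP=> s; rewrite row_stab_hook => /forallP cs.
by rewrite -memvE memv_ker lfunE /= mulmxBl mul1mx cv ?subrr // => k; apply/eqP.
Qed.

Lemma weyl_hookP v : v \in weyl_space K n r hook <->
  exists2 x, young_fixed row_color x & v = antisym *m x.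
Proof.
split=> [/memv_imgP[x /divided_power_hook cx ->]|[x /divided_power_hook cx ->]].
  by exists x => //; rewrite lfunE.
by apply/memv_imgP; exists x; rewrite ?lfunE.
Qed.

Lemma entry_antisym v u : entry (antisym *m v) u =
  \sum_(s in col_stab r hook) (-1) ^+ s * entry v (permute u s).
Proof.
rewrite mulmx_suml entry_sum; apply: eq_bigr => s _.
by rewrite -scalemxAl entryZ entry_place.
Qed.

Lemma antisym_schur (B : schur K n r) (v : tens) :
  antisym *m (schur_mx B *m v) = schur_mx B *m (antisym *m v).
Proof.
rewrite !mulmxA; congr (_ *m _).
rewrite mulmx_sumr mulmx_suml; apply: eq_bigr => s _.
by rewrite -scalemxAl -scalemxAr; case: B => B /= /forallP/(_ s)/eqP->.
Qed.

Lemma col_stab_tperm (k l : 'I_r) : col_place k -> col_place l ->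
  forall s, (tperm k l * s \in col_stab r hook)%g = (s \in col_stab r hook).
Proof.
move=> ck cl s; have tE (j : 'I_r) : ~~ col_place j -> tperm k l j = j.
  by move=> cj; rewrite tpermD //; apply: contraNneq cj => <-.
apply/col_stab_hookP/col_stab_hookP => sk j cj.
  by have := sk j cj; rewrite permM tE.
by rewrite permM tE ?sk.
Qed.

Lemma col_stab_tpermR (k l : 'I_r) : col_place k -> col_place l ->
  forall s, (s * tperm k l \in col_stab r hook)%g = (s \in col_stab r hook).
Proof.
move=> ck cl s; have tE (j : 'I_r) : ~~ col_place j -> tperm k l j = j.
  by move=> cj; rewrite tpermD //; apply: contraNneq cj => <-.
apply/col_stab_hookP/col_stab_hookP => sk j cj.
  by apply: (@perm_inj _ (tperm k l)); rewrite [RHS]tE // -permM sk.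
by rewrite permM sk ?tE.
Qed.

End Hook.

Section FusedColors.
Variables r a : nat.

Definition fused_color j (k : 'I_r) := fuse j (row_color a k).

Lemma row_color_mono : {homo @row_color r a : k l / (k <= l)%N >-> (k <= l)%N}.
Proof. by move=> k l; rewrite /row_color; lia. Qed.

Lemma fused_color_mono j :
  {homo fused_color j : k l / (k <= l)%N >-> (k <= l)%N}.
Proof.
by move=> k l /row_color_mono; rewrite /fused_color !fuseE; lia.
Qed.

End FusedColors.

(** Even terms are matched with odd ones. Showing that the sum equals its own negative would prove
    nothing in characteristic 2. *)
Lemma alternating_sum0 (K : fieldType) r (P : pred 'S_r) (f : 'S_r -> K)
    (h : 'S_r -> 'S_r) :
  bijective h -> (forall s, P (h s) = P s) -> (forall s, f (h s) = f s) ->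
  (forall s, odd_perm (h s) = ~~ odd_perm s) ->
  \sum_(s | P s) (-1) ^+ s * f s = 0.
Proof.
move=> hb hP hf ho; rewrite (bigID (@odd_perm _)) /= (reindex h) /=; last first.
  exact: onW_bij.
rewrite (eq_bigl (fun s => P s && ~~ odd_perm s)) => [|s]; last by rewrite hP ho.
rewrite -big_split /= big1 // => s /andP[_ so].
by rewrite ho hf (negPf so) expr1 expr0 mulN1r mul1r addNr.
Qed.

(** * Straightening: the kernel of the column antisymmetrizer on row invariants *)

Section HookKernel.
Variables (K : fieldType) (n r a b : nat).
Hypotheses (a0 : (0 < a)%N) (rE : r = (a + b)%N).

Local Notation word := {ffun 'I_r -> 'I_n}.
Local Notation tens := 'cV[K]_#|{ffun 'I_r -> 'I_n}|.
Local Notation hook := (a :: nseq b 1%N).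
Local Notation antisym := (col_antisym K n r hook).
Local Notation row_color := (@row_color r a).
Local Notation fused_color := (@fused_color r a).
Local Notation col_place := (col_place a).

Lemma odd_tperm_mul (k l : 'I_r) s : k != l ->
  odd_perm (tperm k l * s) = ~~ odd_perm s.
Proof. by move=> kl; rewrite odd_mul_tperm kl. Qed.

Lemma antisym_kill c v (k l : 'I_r) : young_fixed c v -> k != l ->
  col_place k -> col_place l -> c k = c l -> antisym *m v = 0.
Proof.
move=> cv kl ck cl ckl; apply: entryP => u; rewrite entry_antisym entry0.
apply: (@alternating_sum0 _ _ _ _ (fun s => tperm k l * s)%g) => [|s|s|s].
- by exists (fun s => tperm k l * s)%g => s; rewrite mulgA tperm2 mul1g.
- exact: col_stab_tperm.
- rewrite permuteM (young_fixed_entry _ cv) //.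
  by move=> j; case: tpermP => // ->.
- exact: odd_tperm_mul.
Qed.

Lemma antisym_tperm v u (k l : 'I_r) : k != l -> col_place k -> col_place l ->
  entry (antisym *m v) (permute u (tperm k l)) = - entry (antisym *m v) u.
Proof.
move=> kl ck cl; rewrite !entry_antisym -sumrN.
rewrite [RHS](reindex_inj (mulIg (tperm k l))) /=.
apply: eq_big => [s|s _]; first by rewrite col_stab_tpermR.
by rewrite odd_permM odd_tperm kl addbT signrN mulNr opprK -permuteM.
Qed.

(** Proved by the pairing of permutations, since the sign rule alone would only give that twice the
    entry vanishes. *)
Lemma antisym_repeat v (u : word) (k l : 'I_r) : k != l -> col_place k -> col_place l ->
  u k = u l -> entry (antisym *m v) u = 0.
Proof.
move=> kl ck cl ukl; rewrite entry_antisym.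
apply: (@alternating_sum0 _ _ _ _ (fun s => s * tperm k l)%g) => [|s|s|s].
- by exists (fun s => s * tperm k l)%g => s; rewrite -mulgA tperm2 mulg1.
- exact: col_stab_tpermR.
- rewrite permuteM; congr (entry _ (permute _ _)).
  by apply/ffunP=> j; rewrite ffunE; case: tpermP => // ->.
- by rewrite odd_permM odd_tperm kl addbT.
Qed.

(* Reversed reading words of semistandard hook tableaux. *)
Definition standard (u : word) :=
  forall i, (i.+1 < r)%N -> ascent u i = (a <= i.+1)%N.

Lemma run_standard u i : standard u -> (i < r)%N -> run u i = (i.+1 - a)%N.
Proof.
move=> su; elim: i => [|i IH] ir; first by rewrite /run big_geq //; lia.
by rewrite runS IH ?su; lia.
Qed.

Lemma standard_row u i j : standard u -> (i <= j < a)%N ->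
  (letter u j <= letter u i)%N.
Proof.
move=> su /andP[ij ja]; apply: run_desc => //.
by rewrite !run_standard //; lia.
Qed.

Lemma standard_col u i j : standard u -> (a <= i.+1)%N -> (i < j < r)%N ->
  (letter u i < letter u j)%N.
Proof.
move=> su ai /andP[]; elim: j => // j IH; rewrite ltnS leq_eqVlt.
case/predU1P=> [<- ir|ij jr]; first by have := su i ir; rewrite ai /ascent.
have : ascent u j by rewrite su //; lia.
by move/(ltn_trans (IH ij (ltnW jr))).
Qed.

Hypothesis r0 : (0 < r)%N.
Lemma corner_subproof : (a.-1 < r)%N. Proof. by lia. Qed.
Definition place0 : 'I_r := Ordinal r0.
Definition corner : 'I_r := Ordinal corner_subproof.

(** Runs are sorted decreasingly, so the smallest letter of the first row stands at place a-1,
    whereas the column group moves place 0. The swap puts that letter into the column without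
    leaving the row orbit. *)
Definition witness (u : word) : word := permute u (tperm place0 corner).

Lemma letter_witness u i : (i < r)%N -> letter (witness u) i =
  if i == 0%N then letter u a.-1 else if i == a.-1 then letter u 0 else letter u i.
Proof.
move=> ir; rewrite -[i]/(val (Ordinal ir)) letterE ffunE.
case: tpermP => [->|->|/eqP + /eqP].
- by rewrite /= -letterE.
- by rewrite /= eqxx -letterE /=; case: eqP => [->|].
by rewrite -!val_eqE /= => /negPf-> /negPf->; rewrite -letterE.
Qed.

Lemma mono_perm_fix (s : 'S_r) (d : nat) :
  (forall k : 'I_r, (k < d)%N -> s k = k) ->
  (forall k l : 'I_r, (d <= k < l)%N -> (s k < s l)%N) -> s = 1%g.
Proof.
move=> sd smono; apply/permP=> k; rewrite perm1.
elim/ltn_ind: {k}(val k) {-2}k (erefl (val k)) => i IH k ki.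
case: (ltnP k d) => [/sd //|dk].
have lt (j : 'I_r) : (j < k)%N -> s j = j by move=> jk; apply: (IH j) => //; rewrite -ki.
apply/val_inj; case: (ltngtP (s k) k) => // sk.
  by have := lt _ sk => /perm_inj e; rewrite e ltnn in sk.
have [j sj] : exists j, s j = k by exists ((s^-1)%g k); rewrite permKV.
case: (ltngtP j k) => [jk|kj|/val_inj e].
- by have := lt j jk; rewrite sj => e; rewrite e ltnn in jk.
- by have := smono k j; rewrite dk kj => /(_ isT); rewrite sj; lia.
- by rewrite -e sj e ltnn in sk.
Qed.

(** The letter at the corner is minimal in a standard word, which forces [s] to fix place 0; then
    [s] permutes the leg between two strictly increasing fillings and is trivial. Finally the row is
    determined by its sorted form. *)
Lemma witness_support u u' s : standard u -> standard u' ->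
  s \in col_stab r hook -> entry (run_sum K u') (permute (witness u) s) != 0 ->
  s = 1%g /\ u' = u.
Proof.
move=> su su' /(col_stab_hookP a0 rE) sC; rewrite entry_vec.
case: existsP => [[s' /andP[/forallP us' /eqP E]] _|]; last by rewrite eqxx.
have colP k : row_color (s' k) = row_color k.
  by have /eqP := us' k; rewrite !run_standard.
have fix' (k : 'I_r) : (a <= k)%N -> s' k = k.
  by move=> ak; apply: val_inj => /=; have := colP k; rewrite /row_color; lia.
have Ev (k : 'I_r) : letter (witness u) (s k) = letter u' (s' k).
  by have /ffunP/(_ k) := E; rewrite [LHS]ffunE [RHS]ffunE !letterE => ->.
have witk (k : 'I_r) : (a <= k)%N -> letter (witness u) k = letter u k.
  by move=> ak; rewrite letter_witness //; case: eqP => [|_]; [lia|case: eqP => // ?; lia].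
have wit0 : letter (witness u) 0 = letter u a.-1 by rewrite letter_witness.
have low (k : 'I_r) : (letter u a.-1 <= letter (witness u) k)%N.
  case: (leqP a k) => ka.
    by rewrite witk //; apply/ltnW/standard_col => //; have := ltn_ord k; lia.
  by rewrite letter_witness //; case: eqP => // k0; case: eqP => k1;
    apply: standard_row => //; lia.
(* Otherwise a leg place of [u'] carries the minimum of [u], and the corner of [u'] would carry a
   letter below that minimum. *)
have s0 : s place0 = place0.
  apply/eqP/negPn/negP => s0.
  have [k2 sk2] : exists k2, s k2 = place0 by exists ((s^-1)%g place0); rewrite permKV.
  have k20 : k2 != place0 by apply: contraNneq s0 => e; rewrite -{1}e sk2.
  have ak2 : (a <= k2)%N.
    have : col_place k2.
      by apply: contraNT k20 => /sC e; rewrite -[k2]e sk2.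
    rewrite /col_place => /orP[/eqP e|//].
    by move: k20; rewrite -val_eqE /= e.
  have e2 : letter u' k2 = letter u a.-1 by rewrite -{1}(fix' _ ak2) -Ev sk2 wit0.
  have lt2 : (letter u' a.-1 < letter u a.-1)%N.
    by rewrite -e2; apply: standard_col => //; have := ltn_ord k2; lia.
  have := low (s ((s'^-1)%g corner)); rewrite Ev permKV /=; lia.
have s1 : s = 1%g.
  have sa (j : 'I_r) : (a <= j)%N -> (a <= s j)%N.
    move=> aj; rewrite leqNgt; apply/negP => lt.
    have : s (s j) = s j.
      have [e|ne] := posnP (s j); first by have -> : s j = place0 by apply: val_inj.
      by apply: sC; rewrite /col_place; lia.
    by move/perm_inj => e; move: lt; rewrite e; lia.
  apply: (@mono_perm_fix s a) => [k ka|k l /andP[ak kl]].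
    have [k0|k0] := posnP k; last by apply: sC; rewrite /col_place; lia.
    by have -> : k = place0 by apply: val_inj.
  have al : (a <= l)%N by lia.
  have := Ev k; have := Ev l; rewrite !fix' ?witk ?sa // => el ek.
  have lt : (letter u' k < letter u' l)%N.
    by apply: standard_col => //; have := ltn_ord l; lia.
  case: (ltngtP (s k) (s l)) => // [gt|/val_inj e].
    have : (letter u (s l) < letter u (s k))%N.
      by apply: standard_col => //; [have := sa l al; lia|have := ltn_ord (s k); lia].
    by rewrite ek el; lia.
  by move: lt; rewrite -ek -el e ltnn.
split=> //; symmetry.
apply: (@run_sorted_uniq _ _ u' u (tperm place0 corner * s')%g) => [k||k l kl].
- rewrite permM (eqP (us' _)); case: tpermP => // ->; rewrite !run_standard //=; lia.
- by rewrite permuteM -E s1 permute1 /witness -permuteM tperm2 permute1.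
rewrite !run_standard // => e; rewrite -!letterE.
have [-> //|ne] := eqVneq (k : nat) l.
by apply: standard_row => //; lia.
Qed.

Lemma entry_witness u u' : standard u -> standard u' ->
  entry (antisym *m run_sum K u') (witness u) = (u' == u)%:R.
Proof.
move=> su su'; rewrite entry_antisym.
have C1 : 1%g \in col_stab r hook by apply/(col_stab_hookP a0 rE) => k _; rewrite perm1.
rewrite (bigD1 1%g) //= odd_perm1 expr0 mul1r permute1 big1 ?addr0; last first.
  move=> s /andP[sC s1].
  have [->|/(witness_support su su' sC)[e _]] :=
    eqVneq (entry (run_sum K u') (permute (witness u) s)) 0; first by rewrite mulr0.
  by rewrite e eqxx in s1.
have [->|uu'] := eqVneq u' u; last first.
  apply/eqP; apply: contraNT uu'.
  by rewrite -{1}[witness u]permute1 => /(witness_support su su' C1)[_ ->].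
rewrite entry_vec; case: existsP => // -[]; exists (tperm place0 corner).
rewrite eqxx andbT; apply/forallP=> k.
by case: tpermP => // ->; rewrite !run_standard //=; lia.
Qed.

(** The rows j and j+1 each meet the first column, so the fused invariants are fixed by a
    transposition of two column places. *)
Lemma fused_kill j v : (j < b)%N -> young_fixed (fused_color j) v ->
  antisym *m v = 0.
Proof.
move=> jb cv; have h1 : (a + j < r)%N by lia.
have h2 : ((if j == 0 then 0 else a + j.-1) < r)%N by case: ifP => //; lia.
apply: (@antisym_kill _ _ (Ordinal h1) (Ordinal h2) cv).
- by rewrite -val_eqE /=; case: ifP => ?; lia.
- by rewrite /col_place /= leq_addr orbT.
- by rewrite /col_place /=; case: ifP; rewrite ?eqxx ?leq_addr ?orbT.
rewrite /fused_color /fuse /row_color /=.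
by case: (j =P 0%N) => j0 /=; do 2 case: eqP => ?; lia.
Qed.

(** Ascents of [u] occur only between rows, and failing to be constant on the fused rows j and j+1
    forces one exactly at their border. *)
Lemma nonstandard_fused u :
  (forall k l, row_color k = row_color l -> run u k = run u l) ->
  (forall j : 'I_b, exists2 kl, fused_color j kl.1 = fused_color j kl.2 & run u kl.1 <> run u kl.2) ->
  standard u.
Proof.
move=> cu nj i ir; have h k l : row_color k = row_color l -> run u k = run u l by apply: cu.
case: (leqP a i.+1) => ai; last first.
  apply: contraTF isT => asc; have := h (Ordinal (ltnW ir)) (Ordinal ir).
  by rewrite /row_color /= runS asc => /(_ ltac:(lia)); lia.
have jb : (i.+1 - a < b)%N by lia.
have [[k l] /= e] := nj (Ordinal jb); apply: contraPT => nasc.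
apply; apply: (run_step_eq (@fused_color_mono r a (Ordinal jb))) e.
move=> k' l' lk; rewrite /fused_color /fuse /=.
have [e|ne] := eqVneq (k' : nat) i; first by rewrite e.
move=> e; apply/negP => asc; have := h k' l'; rewrite lk runS asc.
have : row_color k' = row_color l'.
  by move: e; rewrite /row_color lk; do 2 case: eqP; lia.
move=> -> /(_ erefl); lia.
Qed.

(** Each run sum in the expansion of [v] is either fixed by a fusion, hence killed, or standard. The
    witnesses separate the images of the standard ones, so their coefficients vanish. *)
Lemma hook_presentation v : young_fixed row_color v -> antisym *m v = 0 ->
  exists2 y : 'I_b -> tens, (forall j : 'I_b, young_fixed (fused_color j) (y j)) &
    v = \sum_j y j.
Proof.
case/(young_fixed_span (@row_color_mono r a)) => x vE xP kill.
pose R (j : 'I_b) (u : word) := [forall k, forall l, (fused_color j k == fused_color j l) ==> (run u k == run u l)].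
(* A word fixed by several fusions is assigned to a single one of them, so that nothing is counted
   twice. *)
pose y (j : 'I_b) := \sum_(u | [pick j : 'I_b | R j u] == Some j) x u *: run_sum K u.
have yfix (j : 'I_b) : young_fixed (fused_color j) (y j).
  apply: young_fixed_sum => u; case: pickP => // j' Rj /eqP[<-].
  apply: young_fixedZ; apply: young_fixed_refine (@run_sum_fixed K n r u) => k l e.
  by have /forallP/(_ k)/forallP/(_ l) := Rj; rewrite e eqxx => /eqP.
have split_v : v = \sum_(u | [pick j : 'I_b | R j u] == None) x u *: run_sum K u + \sum_j y j.
  rewrite vE (bigID (fun u => [pick j : 'I_b | R j u] == None)) /=; congr (_ + _).
  rewrite /y.
  rewrite [RHS](exchange_big_dep (fun u => [pick j : 'I_b | R j u] != None)) /=.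
    by apply: eq_bigr => u; case: pickP => // j _ _; rewrite (big_pred1 j) // => i; rewrite eq_sym.
  by move=> j u _ /eqP->.
exists y => //; rewrite split_v; rewrite [X in X + _]big1 ?add0r // => u0 pu0.
have [->|xu0] := eqVneq (x u0) 0; first by rewrite scale0r.
have std u : [pick j : 'I_b | R j u] == None -> x u != 0 -> standard u.
  case: pickP => // nR _ xu; apply: nonstandard_fused => [k l|j]; first exact: xP xu k l.
  have /negbT := nR j; rewrite negb_forall => /existsP[k]; rewrite negb_forall => /existsP[l].
  by rewrite negb_imply => /andP[/eqP e /eqP ne]; exists (k, l).
have := congr1 (fun v : tens => entry v (witness (u0 : word))) kill.
rewrite split_v mulmxDr mulmx_sumr [X in _ + X]mulmx_sumr entry0 entryD.
rewrite [X in _ + X]entry_sum [X in _ + X]big1 => [|j _]; last first.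
  by rewrite (fused_kill _ (yfix j)) // entry0.
rewrite addr0 entry_sum (bigD1 u0) //= -scalemxAr entryZ.
have su0 := std u0 pu0 xu0; rewrite entry_witness // eqxx mulr1.
rewrite big1 ?addr0 => [/eqP|u /andP[pu uu0]]; first by rewrite (negPf xu0).
have [->|xu] := eqVneq (x u) 0; first by rewrite scale0r mulmx0 entry0.
have su := std u pu xu.
by rewrite -scalemxAr entryZ entry_witness // (negPf uu0) mulr0.
Qed.

End HookKernel.

(** * First extensions as cocycles in weight spaces *)

Section Generators.
Variables (K : fieldType) (n r : nat).

Local Notation word := {ffun 'I_r -> 'I_n}.
Local Notation tens := 'cV[K]_#|{ffun 'I_r -> 'I_n}|.
Local Notation schur := (schur K n r).
Local Notation act B v := (schur_mx B *m v).

Definition word_fixed (w : word) (v : tens) := young_fixed (fun k => w k : nat) v.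

Lemma word_fixed_place w v s t : word_fixed w v -> permute w s = permute w t ->
  place_mx K n s^-1 *m v = place_mx K n t^-1 *m v.
Proof.
move=> wv st; apply: entryP => u; rewrite !entry_place.
have -> : permute u s^-1 = permute (permute u t^-1) (s^-1 * t).
  by rewrite -permuteM -mulgA mulgV mulg1.
apply: (young_fixed_entry _ wv) => k; congr (nat_of_ord _).
by rewrite permM; have /ffunP/(_ (s^-1%g k)) := st; rewrite !ffunE permKV => ->.
Qed.

(** The element of S xi_w that sends the word [w] to [v] and kills all words of other weight. It is
    well defined when [v] is fixed by the stabilizer of [w], the choice of [s] being then
    immaterial. *)
Definition gen_mx (w : word) (v : tens) : 'M[K]_#|{ffun 'I_r -> 'I_n}| :=
  mx_of_bas (fun u => if [pick s | permute w s == u] is Some s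
                      then place_mx K n s^-1 *m v else 0).

Lemma gen_mx_orbit w v s : word_fixed w v ->
  gen_mx w v *m bas K (permute w s) = place_mx K n s^-1 *m v.
Proof.
move=> wv; rewrite mul_mx_of_bas; case: pickP => [t /eqP e|/(_ s)].
  exact: word_fixed_place wv e.
by rewrite eqxx.
Qed.

Lemma gen_mx_out w v u : (forall s, permute w s != u) ->
  gen_mx w v *m bas K u = 0.
Proof.
move=> wu; rewrite mul_mx_of_bas; case: pickP => // s.
by rewrite (negPf (wu s)).
Qed.

Lemma orbit_dec (w u : word) :
  (exists s, u = permute w s) \/ (forall s, permute w s != u).
Proof.
case: (pickP (fun s => permute w s == u)) => [s /eqP|] e; first by left; exists s.
by right=> s; rewrite e.
Qed.

Lemma place_mxM s t (v : tens) :
  place_mx K n s *m (place_mx K n t *m v) = place_mx K n (t * s) *m v.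
Proof. by apply: entryP => u; rewrite !entry_place permuteM. Qed.

Lemma gen_mx_commutant w v : word_fixed w v -> gen_mx w v \in @place_commutant K n r.
Proof.
move=> wv; apply/forallP=> t; apply/eqP/schur_mxP => u.
rewrite -!mulmxA place_bas; case: (orbit_dec w u) => [[s ->]|wu].
  rewrite -permuteM !gen_mx_orbit // place_mxM; congr (place_mx _ _ _ *m _).
  by rewrite invMg invgK.
rewrite !gen_mx_out ?mulmx0 // => s; apply: contra (wu (t * s)%g).
by rewrite permuteM => /eqP->; rewrite permuteKV.
Qed.

(* Opaque on purpose: unification must not unfold matrices of operators. *)
Lemma gen_exists w v :
  {B : schur | word_fixed w v -> schur_mx B = gen_mx w v}.
Proof.
exists (insubd 0 (gen_mx w v)) => wv.
by rewrite -[schur_mx _]/(val _) insubdK // gen_mx_commutant.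
Qed.

Definition gen w v : schur := sval (gen_exists w v).

Lemma genE w v : word_fixed w v -> schur_mx (gen w v) = gen_mx w v.
Proof. exact: (svalP (gen_exists w v)). Qed.

Lemma act_place (B : schur) s (v : tens) :
  act B (place_mx K n s *m v) = place_mx K n s *m act B v.
Proof. by case: B => B /= /forallP/(_ s)/eqP Bs; rewrite !mulmxA Bs. Qed.

Lemma gen_bas w v : word_fixed w v -> act (gen w v) (bas K w) = v.
Proof.
move=> wv; rewrite genE // -[w in bas _ w]permute1 gen_mx_orbit // invg1.
by apply: entryP => u; rewrite entry_place permute1.
Qed.

Lemma schur_ext (B C : schur) :
  (forall u, act B (bas K u) = act C (bas K u)) -> B = C.
Proof. by move=> BC; apply: val_inj; apply: schur_mxP. Qed.

Lemma word_fixed_bas (w u : word) : (forall k l, w k = w l -> u k = u l) ->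
  word_fixed w (bas K u).
Proof.
move=> wu s ws; rewrite place_bas; congr bas; apply/ffunP=> k; rewrite ffunE.
apply: wu; apply: val_inj => /=.
by rewrite -[in RHS](permKV s k) ws.
Qed.

(** Identifies the left ideal S xi_w with the tensors fixed by the stabilizer of [w]; computations
    in the algebra become computations with vectors. *)
Lemma gen_mul w v (B : schur) : word_fixed w v -> B * gen w v = gen w (act B v).
Proof.
move=> wv; have wBv : word_fixed w (act B v) by apply: young_fixed_schur.
apply: schur_ext => u; rewrite -[schur_mx (_ * _)]/(schur_mx B *m schur_mx (gen w v)).
rewrite -mulmxA !genE //; case: (orbit_dec w u) => [[s ->]|wu].
  by rewrite !gen_mx_orbit // act_place.
by rewrite !gen_mx_out ?mulmx0.
Qed.

Lemma schur_mx_sum I (s : seq I) (P : pred I) (F : I -> schur) :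
  schur_mx (\sum_(i <- s | P i) F i) = \sum_(i <- s | P i) schur_mx (F i).
Proof. by apply: (big_morph (@schur_mx K n r)). Qed.

Lemma gen_sum w I (s : seq I) (P : pred I) (F : I -> tens) :
  (forall i, P i -> word_fixed w (F i)) ->
  gen w (\sum_(i <- s | P i) F i) = \sum_(i <- s | P i) gen w (F i).
Proof.
move=> wF; have wS : word_fixed w (\sum_(i <- s | P i) F i) by apply: young_fixed_sum.
apply: schur_ext => u; rewrite schur_mx_sum mulmx_suml genE //.
case: (orbit_dec w u) => [[t ->]|wu].
  rewrite gen_mx_orbit // mulmx_sumr; apply: eq_bigr => i Pi.
  by have wFi := wF i Pi; rewrite genE // gen_mx_orbit.
rewrite gen_mx_out // big1 // => i Pi.
by have wFi := wF i Pi; rewrite genE // gen_mx_out.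
Qed.

(** For [w'] coarser than [w] this operator is a product of divided powers: it sums over all ways of
    undoing the relabelling, each with coefficient 1. *)
Lemma gen_actE (w w' : word) (x : tens) t :
  (forall k l, w k = w l -> w' k = w' l) ->
  entry (act (gen w (bas K w')) x) t =
  \sum_(u | [exists s, (permute w s == u) && (permute w' s == t)]) entry x u.
Proof.
move=> ww'; have wf := word_fixed_bas ww'.
rewrite [x in LHS]bas_expand mulmx_sumr entry_sum [RHS]big_mkcond /=.
apply: eq_bigr => u _; rewrite -scalemxAr entryZ genE //.
case: existsP => [[p /andP[/eqP <- /eqP <-]]|nex].
  by rewrite gen_mx_orbit // entry_place entry_vec permuteK eqxx mulr1.
case: (orbit_dec w u) => [[p up]|wu]; last by rewrite gen_mx_out // entry0 mulr0.
rewrite up gen_mx_orbit // entry_place entry_vec; case: eqP => [e|]; rewrite ?mulr0 //.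
by case: nex; exists p; rewrite up eqxx -e permuteKV eqxx.
Qed.

End Generators.

Section OrbitMap.
Variables (A : pzRingType) (M : lmodType A) (m : M).
Definition orbit_map (B : A^o) : M := (B : A) *: m.
Fact orbit_map_linear : linear orbit_map.
Proof. by move=> c B C; rewrite /orbit_map scalerDl scalerA. Qed.
HB.instance Definition _ :=
  GRing.isLinear.Build A A^o M _ orbit_map orbit_map_linear.
End OrbitMap.

Section ExtFormula.
Variables (K : fieldType) (n a b : nat) (la : seq nat).
Local Notation r := (a + b)%N.
Hypotheses (a0 : (0 < a)%N).

Local Notation word := {ffun 'I_r -> 'I_n}.
Local Notation tens := 'cV[K]_#|{ffun 'I_r -> 'I_n}|.
Local Notation schur := (schur K n r).
Local Notation act B v := (schur_mx B *m v).
Local Notation hook := (a :: nseq b 1%N).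
Local Notation antisym := (col_antisym K n r hook).
Local Notation M := (weyl K n r hook).
Local Notation N := (weyl K n r la).
Local Notation inN v := ((v : tens) \in weyl_space K n r la).

Variables (w : word) (w1 : nat -> word) (w2 : nat -> nat -> word).
Hypotheses (wE : forall k, w k = row_color a k :> nat)
  (w1E : forall j k, (j < b)%N -> w1 j k = fuse j (row_color a k) :> nat)
  (w2E : forall i j k, (i < j < b)%N ->
     w2 i j k = fuse i (fuse j (row_color a k)) :> nat).

Let e := gen w (bas K w).
Let e1 j := gen (w1 j) (bas K (w1 j)).
Let theta j := gen w (bas K (w1 j)).
Let theta1 i j := gen (w1 i) (bas K (w2 i j)).
Let theta2 i j := gen (w1 j) (bas K (w2 i j)).

(* A homomorphism from the projective module S * gen u (bas u) to N is a vector *)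
(* of the u-weight space of N, so x is a homomorphism on the sum of the fused   *)
(* projectives, and the equations kill the relations given by pairs of fusions. *)
Definition weight_cocycle (x : nat -> tens) :=
  [/\ forall j, (j < b)%N -> inN (x j) /\ act (e1 j) (x j) = x j &
      forall i j, (i < j < b)%N -> act (theta1 i j) (x i) = act (theta2 i j) (x j)].

Definition weight_coboundary (x : nat -> tens) :=
  exists2 y : tens, inN y /\ act e y = y &
    forall j, (j < b)%N -> x j = act (theta j) y.

Lemma fixed_w (v : tens) : word_fixed w v <-> young_fixed (row_color a) v.
Proof. by split=> wv s ws; apply: wv => k; have := ws k; rewrite -!wE. Qed.
Lemma fixed_w1 j (v : tens) : (j < b)%N -> word_fixed (w1 j) v <-> young_fixed (fused_color a j) v.
Proof. by move=> jb; split=> wv s ws; apply: wv => k; have := ws k; rewrite /fused_color -!w1E. Qed.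

Lemma w_w1 j : (j < b)%N -> forall k l, w k = w l -> w1 j k = w1 j l.
Proof.
by move=> jb k l /(congr1 (@nat_of_ord n)) wkl; apply: val_inj; rewrite /= !w1E // -!wE wkl.
Qed.
Lemma w1_w2r i j : (i < j < b)%N -> forall k l, w1 j k = w1 j l -> w2 i j k = w2 i j l.
Proof.
move=> ij k l /(congr1 (@nat_of_ord n)) wkl; apply: val_inj.
by rewrite /= !w2E // -!w1E ?wkl //; case/andP: ij.
Qed.
Lemma w1_w2l i j : (i < j < b)%N -> forall k l, w1 i k = w1 i l -> w2 i j k = w2 i j l.
Proof.
move=> ij k l /(congr1 (@nat_of_ord n)) wkl; apply: val_inj.
have ib : (i < b)%N by lia.
move: wkl; rewrite /= !w2E // !w1E //.
by case/andP: ij => ij _; rewrite !fuse_fuse // => ->.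
Qed.

Lemma w_w k l : w k = w l -> w k = w l. Proof. by []. Qed.
Lemma w1_w1 j k l : w1 j k = w1 j l -> w1 j k = w1 j l. Proof. by []. Qed.

Let f_e := @word_fixed_bas K n _ w w w_w.
Let f_e1 j := @word_fixed_bas K n _ (w1 j) (w1 j) (@w1_w1 j).
Let f_theta j (jb : (j < b)%N) := @word_fixed_bas K n _ w (w1 j) (w_w1 jb).
Let f_theta1 i j (ij : (i < j < b)%N) := @word_fixed_bas K n _ (w1 i) (w2 i j) (w1_w2l ij).
Let f_theta2 i j (ij : (i < j < b)%N) := @word_fixed_bas K n _ (w1 j) (w2 i j) (w1_w2r ij).

Lemma fixed_w_of_w1 j (v : tens) : (j < b)%N -> word_fixed (w1 j) v -> word_fixed w v.
Proof.
by move=> jb; apply: young_fixed_refine => k l /val_inj /(w_w1 jb) ->.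
Qed.

Lemma gen_theta j (v : tens) : (j < b)%N -> word_fixed (w1 j) v ->
  gen w v = gen (w1 j) v * theta j.
Proof.
move=> jb wv; rewrite gen_mul; last exact: f_theta.
by rewrite gen_bas.
Qed.

Lemma theta_e j : (j < b)%N -> theta j * e = theta j.
Proof.
move=> jb; rewrite gen_mul; last exact: f_e.
by rewrite gen_bas //; apply: f_theta.
Qed.
Lemma e1_theta j : (j < b)%N -> e1 j * theta j = theta j.
Proof.
move=> jb; rewrite gen_mul; last exact: f_theta.
by rewrite gen_bas //; apply: f_e1.
Qed.
Lemma theta_comm i j : (i < j < b)%N -> theta1 i j * theta i = theta2 i j * theta j.
Proof.
move=> ij; have jb : (j < b)%N by case/andP: ij. have ib : (i < b)%N by lia.
rewrite gen_mul; last exact: f_theta. rewrite gen_bas; last exact: f_theta1.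
rewrite gen_mul; last exact: f_theta. by rewrite gen_bas //; apply: f_theta2.
Qed.

Lemma act_mul (B C : schur) (v : tens) : act (B * C) v = act B (act C v).
Proof. by rewrite mulmxA. Qed.

Lemma inN_act B (v : tens) : inN v -> inN (act B v).
Proof.
move=> vN; have := (@weyl_submod K n r la).2 B v 0 vN (mem0v _).
by rewrite addr0.
Qed.

(** The straightening theorem read in the algebra: the annihilator of the generator of the hook
    module, inside S xi_w, is the sum of the left ideals generated by the [theta j]. *)
Lemma kernel_decomp (B : schur) : antisym *m act B (bas K w) = 0 ->
  exists2 y : 'I_b -> tens, (forall j : 'I_b, word_fixed (w1 j) (y j)) &
    B * e = \sum_(j < b) gen (w1 j) (y j) * theta j.
Proof.
move=> kill; have cB : word_fixed w (act B (bas K w)) by apply: young_fixed_schur.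
have [|||y yP yE] := @hook_presentation K n r a b a0 erefl _ (act B (bas K w)).
- by rewrite addn_gt0 a0.
- exact/fixed_w.
- exact: kill.
have yw (j : 'I_b) : word_fixed (w1 j) (y j) by apply/fixed_w1.
exists y => //; rewrite gen_mul // yE gen_sum => [|j _]; last exact: fixed_w_of_w1 (yw j).
by apply: eq_bigr => j _; rewrite -gen_theta.
Qed.

(* A weight cocycle extends to the span of all merged invariants: on the      *)
(* adapted basis of run sums the prescriptions for different j agree.         *)
Lemma cocycle_glue x : weight_cocycle x -> exists F : 'M[K]_#|{ffun 'I_r -> 'I_n}|,
  forall j v, (j < b)%N -> word_fixed (w1 j) v -> F *m v = act (gen (w1 j) v) (x j).
Proof.
case=> [x1 x2].
pose R (j : 'I_b) (u : word) := [forall k : 'I_r, forall l : 'I_r,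
  (fused_color a j k == fused_color a j l) ==> (run u k == run u l)].
have RP (j : 'I_b) (u : word) : (forall k l : 'I_r, fused_color a j k = fused_color a j l -> run u k = run u l) <-> R j u.
  split=> [h|/forallP h k l ckl].
    by apply/forallP=> k; apply/forallP=> l; apply/implyP=> /eqP/h->.
  by have /forallP/(_ l) := h k; rewrite ckl eqxx => /eqP.
have Rfix (j : 'I_b) (u : word) : R j u -> word_fixed (w1 j) (run_sum K u).
  move/RP => Rj; apply/fixed_w1 => //.
  by apply: young_fixed_refine (@run_sum_fixed K n r u).
have [F FE] := @run_sum_extend K n r (fun u => if [pick j | R j u] is Some j then act (gen (w1 j) (run_sum K u)) (x j) else 0).
exists F => j v jb wv.
have /(young_fixed_span (@fused_color_mono r a j))[y -> yP] : young_fixed (fused_color a j) v by apply/fixed_w1.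
have agree (i i' : 'I_b) (u : word) : (i < i')%N -> R i u -> R i' u ->
    act (gen (w1 i) (run_sum K u)) (x i) = act (gen (w1 i') (run_sum K u)) (x i').
  move=> ii' Ri Ri'; have ib : (i < i' < b)%N by rewrite ii' /=.
  (* A run sum fixed by two fusions is fixed by their common coarsening, hence both prescriptions
     factor through weight [w2 i i'], where the cocycle equation compares them. *)
  have f2 : word_fixed (w2 i i') (run_sum K u).
    have h : forall k l : 'I_r, w2 i i' k = w2 i i' l :> nat -> run u k = run u l.
      apply: run_step_eq => [k l kl|k l lk].
        by rewrite !w2E //; do 2!apply: fuse_mono; apply: row_color_mono.
      rewrite !w2E // => ckl; apply/negP => asc.
      have [h|h] : fused_color a i k = fused_color a i l \/ fused_color a i' k = fused_color a i' l.
        rewrite /fused_color; have [<-|e'] := eqVneq (row_color a k) (row_color a l).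
          by left.
        have e'' : row_color a l = (row_color a k).+1.
          by move: e'; rewrite /row_color lk; lia.
        move: ckl; rewrite e'' => /(fuse_step ii')[->|->]; [left|right];
          by rewrite !fuseE eqxx; lia.
      + by have := (RP i u).2 Ri k l h; rewrite lk runS asc; lia.
      + by have := (RP i' u).2 Ri' k l h; rewrite lk runS asc; lia.
    by apply: young_fixed_refine h _; apply: run_sum_fixed.
  have e1' : gen (w1 i) (run_sum K u) = gen (w2 i i') (run_sum K u) * theta1 i i'.
    by rewrite gen_mul ?gen_bas //; apply: f_theta1.
  have e2' : gen (w1 i') (run_sum K u) = gen (w2 i i') (run_sum K u) * theta2 i i'.
    by rewrite gen_mul ?gen_bas //; apply: f_theta2.
  apply: etrans (congr1 (fun B => act B (x i)) e1') _.
  apply: etrans (act_mul _ _ _) _.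
  apply: etrans (congr1 (fun z => act _ z) (x2 _ _ ib)) _.
  apply: etrans (esym (act_mul _ _ _)) _.
  exact: (congr1 (fun B => act B (x i')) (esym e2')).
have Rj u : y u != 0 -> R (Ordinal jb) u by move=> yu; apply/RP => k l; apply: yP.
have Fu u : y u != 0 -> F *m run_sum K u = act (gen (w1 j) (run_sum K u)) (x j).
  move=> yu; rewrite FE; case: pickP => [i Ri|/(_ (Ordinal jb))]; last by rewrite Rj.
  case: (ltngtP i (Ordinal jb)) => ij.
  - exact: (agree i (Ordinal jb) u ij Ri (Rj u yu)).
  - exact: esym (agree (Ordinal jb) i u ij (Rj u yu) Ri).
  - by rewrite ij.
have fixy u : word_fixed (w1 j) (y u *: run_sum K u).
  have [->|yu] := eqVneq (y u) 0; first by rewrite scale0r; apply: young_fixed0.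
  by apply: young_fixedZ; apply: (Rfix (Ordinal jb)); apply: Rj.
rewrite gen_sum // schur_mx_sum mulmx_sumr mulmx_suml; apply: eq_bigr => u _.
have [->|yu] := eqVneq (y u) 0.
  have -> : gen (w1 j) (0 *: run_sum K u) = 0.
    rewrite scale0r; apply: schur_ext => t; rewrite genE; last exact: young_fixed0.
    by case: (orbit_dec (w1 j) t) => [[s ->]|h]; rewrite ?gen_mx_orbit ?gen_mx_out ?mulmx0 ?mul0mx //; apply: young_fixed0.
  by rewrite scale0r mulmx0 mul0mx.
have wu : word_fixed (w1 j) (run_sum K u) by apply: (Rfix (Ordinal jb)); apply: Rj.
rewrite -scalemxAr Fu //.
have -> : gen (w1 j) (y u *: run_sum K u) = schur_scalar n r (y u) * gen (w1 j) (run_sum K u).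
  rewrite gen_mul //; congr gen; exact: esym (mul_scalar_mx _ _).
apply: etrans (esym (mul_scalar_mx _ _)) _; exact: mulmxA.
Qed.

Lemma weyl_scaleE la' (B : schur) (v : weyl K n r la') :
  weyl_val (B *: v) = act B (weyl_val v).
Proof. by []. Qed.
Lemma weyl_addE la' (u v : weyl K n r la') :
  weyl_val (u + v) = weyl_val u + weyl_val v :> tens.
Proof. by []. Qed.
Lemma weyl_subE la' (u v : weyl K n r la') :
  weyl_val (u - v) = weyl_val u - weyl_val v :> tens.
Proof. by []. Qed.
Lemma weyl_sumE la' I (s : seq I) (P : pred I) (F : I -> weyl K n r la') :
  weyl_val (\sum_(i <- s | P i) F i) = \sum_(i <- s | P i) weyl_val (F i) :> tens.
Proof. by apply: (big_morph (@weyl_val K n r la')). Qed.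
Lemma weyl_scalarE la' (c : K) (v : weyl K n r la') :
  weyl_val (schur_scalar n r c *: v) = c *: weyl_val v :> tens.
Proof. by rewrite weyl_scaleE /= mul_scalar_mx. Qed.

Lemma schur_scalar_comm c (B : schur) : schur_scalar n r c * B = B * schur_scalar n r c.
Proof. by apply: val_inj; exact: esym (scalar_mxC _ _). Qed.

Lemma generator_subproof : antisym *m bas K w \in @weyl_pred K n r hook.
Proof.
apply/(@weyl_hookP K n r a b a0 erefl); exists (bas K w) => //.
exact/fixed_w.
Qed.
Definition hook_gen : M := Weyl generator_subproof.

Lemma hook_gen_act (B : schur) :
  weyl_val (B *: hook_gen) = antisym *m act B (bas K w) :> tens.
Proof. by rewrite weyl_scaleE antisym_schur. Qed.

Lemma hook_gen_surj : surjective (orbit_map hook_gen).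
Proof.
case=> y yM; have /(@weyl_hookP K n r a b a0 erefl)[x cx yE] := yM.
have wx : word_fixed w x by apply/fixed_w.
by exists (gen w x); apply: val_inj; apply: etrans (hook_gen_act _) _; rewrite gen_bas.
Qed.

Lemma theta_kill j : (j < b)%N -> antisym *m act (theta j) (bas K w) = 0.
Proof.
move=> jb; rewrite gen_bas; last exact: f_theta.
apply: (@fused_kill K n r a b a0 erefl _ j) => //; first by rewrite addn_gt0 a0.
by apply/fixed_w1 => //; apply: f_e1.
Qed.

(** [F] is merely a matrix; on the kernel of the presentation it commutes with S and lands in N,
    because there every vector is a sum of fused invariants on which [F] is prescribed. *)
Lemma cocycle_glue_kernel x F : weight_cocycle x ->
  (forall j v, (j < b)%N -> word_fixed (w1 j) v -> F *m v = act (gen (w1 j) v) (x j)) ->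
  forall B, antisym *m act B (bas K w) = 0 -> inN (F *m act B (bas K w)) /\
    forall C, F *m act C (act B (bas K w)) = act C (F *m act B (bas K w)).
Proof.
case=> x1 _ FE B /kernel_decomp[y yP yE].
have Bw : act B (bas K w) = \sum_j y j.
  have -> : act B (bas K w) = act (B * e) (bas K w).
    by rewrite act_mul [act e _]gen_bas //; apply: f_e.
  rewrite yE schur_mx_sum mulmx_suml; apply: eq_bigr => j _.
  rewrite act_mul [act (theta j) _]gen_bas; last exact: f_theta.
  by rewrite gen_bas.
rewrite Bw mulmx_sumr; split.
  by apply: rpred_sum => j _; rewrite (FE j) //; apply: inN_act; case: (x1 j).
move=> C; rewrite !mulmx_sumr; apply: eq_bigr => j _.
have Cy : word_fixed (w1 j) (act C (y j)) by apply: young_fixed_schur; apply: yP.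
by rewrite (FE j _ (ltn_ord j) Cy) (FE j _ (ltn_ord j) (yP j)) -gen_mul // act_mul.
Qed.

Lemma weight_coboundaryB x x' :
  weight_coboundary x -> weight_coboundary x' -> weight_coboundary (fun j => x j - x' j).
Proof.
case=> [y [yN ye] xE] [y' [yN' ye'] xE']; exists (y - y').
  by rewrite mulmxBr ye ye' rpredB.
by move=> j jb; rewrite xE // xE' // mulmxBr.
Qed.

Lemma weight_coboundary_comb d (c : 'I_d -> K) (x : 'I_d -> nat -> tens) :
  (forall l, weight_coboundary (x l)) ->
  weight_coboundary (fun j => \sum_l c l *: x l j).
Proof.
move=> xB; pose P l y := inN y /\ act e y = y /\ forall j, (j < b)%N -> x l j = act (theta j) y.
have /fin_all_exists[Y YP] : forall l, exists y, P l y.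
  by move=> l; have [y [? ?] ?] := xB l; exists y.
exists (\sum_l c l *: Y l).
  split; first by apply: rpred_sum => l _; apply: rpredZ; case: (YP l).
  rewrite mulmx_sumr; apply: eq_bigr => l _.
  by rewrite -scalemxAr; congr (_ *: _); case: (YP l) => _ [].
move=> j jb; rewrite mulmx_sumr; apply: eq_bigr => l _.
by rewrite -scalemxAr; congr (_ *: _); case: (YP l) => _ [_]; apply.
Qed.

Lemma weight_coboundary_ext x x' : (forall j, (j < b)%N -> x j = x' j) ->
  weight_coboundary x -> weight_coboundary x'.
Proof. by move=> xx' [y yP xE]; exists y => // j jb; rewrite -xx' // xE. Qed.

(** * Comparison with an arbitrary projective resolution *)

Section Resolved.
Variable P : proj_resolution M.

Let aug := res_aug P.
Let diff0 := res_diff P 0.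

Lemma resolution_projective : projective (P 0).
Proof. by case: P. Qed.
Lemma resolution_surj : surjective aug.
Proof. by rewrite /aug; case: P. Qed.
Lemma resolution_exact0 q : aug q = 0 <-> exists y, diff0 y = q.
Proof. by rewrite /aug /diff0; case: P q. Qed.
Lemma resolution_exact1 y : diff0 y = 0 <-> exists z, res_diff P 1 z = y.
Proof. by rewrite /diff0; case: P y => ? ? ? ? ? ? h; apply: h. Qed.

(** [P 0] is projective and S maps onto the hook module by acting on its generator. Together with a
    preimage [p] of that generator this compares both coverings of the module. *)
Lemma lift_exists : exists alpha : {linear P 0 -> schur^o},
  forall q, (alpha q : schur) *: hook_gen = aug q.
Proof. exact: resolution_projective hook_gen_surj. Qed.

Lemma base_exists : exists2 p : P 0, e *: p = p & aug p = hook_gen.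
Proof.
have [p pE] := resolution_surj hook_gen; exists (e *: p).
  rewrite scalerA; congr (_ *: _); rewrite [LHS]gen_mul; last exact: f_e.
  by rewrite gen_bas //; apply: f_e.
rewrite linearZ /= pE; apply: val_inj; apply: etrans (hook_gen_act e) _.
by rewrite gen_bas //; apply: f_e.
Qed.

Variables (alpha : {linear P 0 -> schur^o}) (p : P 0).
Hypotheses (alphaE : forall q, (alpha q : schur) *: hook_gen = aug q)
  (pe : e *: p = p) (paug : aug p = hook_gen).

(** The implication makes the statement true for every [j], so that one choice function serves all
    of them. *)
Lemma theta_lift j : exists y, (j < b)%N ==> (diff0 y == theta j *: p).
Proof.
have [jb|] := boolP (j < b)%N; last by exists 0.
have /resolution_exact0[y yE] : aug (theta j *: p) = 0.
  rewrite linearZ /= paug; apply: val_inj; apply: etrans (hook_gen_act _) _.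
  exact: theta_kill.
by exists y; rewrite yE eqxx.
Qed.
Definition lift j := xchoose (theta_lift j).
Lemma liftE j : (j < b)%N -> diff0 (lift j) = theta j *: p.
Proof. by move=> jb; have /implyP/(_ jb)/eqP := xchooseP (theta_lift j). Qed.

Definition cocycle_weights (f : P 1 -> N) j : tens := weyl_val (f (lift j)).

Section Cocycle.
Variable f : P 1 -> N.
Hypotheses (flin : linear f) (fcoc : cocycle f).

Lemma flinD x y : f (x + y) = f x + f y.
Proof. by have := flin 1 x y; rewrite !scale1r. Qed.
Lemma flin0 : f 0 = 0.
Proof. by apply: (addrI (f 0)); rewrite -flinD !addr0. Qed.
Lemma flinZ B x : f (B *: x) = B *: f x.
Proof. by have := flin B x 0; rewrite !addr0 flin0 addr0. Qed.
Lemma flinB x y : f (x - y) = f x - f y.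
Proof. by rewrite -scaleN1r flinD flinZ scaleN1r. Qed.
Lemma flin_sum I (s : seq I) (Q : pred I) (F : I -> P 1) :
  f (\sum_(i <- s | Q i) F i) = \sum_(i <- s | Q i) f (F i).
Proof. exact: (big_morph f flinD flin0). Qed.

(** A cocycle is a function of the boundary; this makes every construction below independent of the
    chosen preimages. *)
Lemma cocycle_wd x y : diff0 x = diff0 y -> f x = f y.
Proof.
move=> xy; have /resolution_exact1[z zE] : diff0 (x - y) = 0 by rewrite raddfB /= xy subrr.
by apply/eqP; rewrite -subr_eq0 -flinB -zE fcoc.
Qed.

Lemma cocycle_weightsP : weight_cocycle (cocycle_weights f).
Proof.
split=> [j jb|i j ij].
  split; first by rewrite /cocycle_weights; case: (f _).
  rewrite /cocycle_weights -weyl_scaleE -flinZ; congr weyl_val; apply: cocycle_wd.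
  by rewrite linearZ /= liftE // scalerA e1_theta.
have ib : (i < b)%N by lia. have jb : (j < b)%N by lia.
rewrite /cocycle_weights.
have -> : act (theta1 i j) (weyl_val (f (lift i))) = weyl_val (f (theta1 i j *: lift i)).
  by rewrite flinZ.
have -> : act (theta2 i j) (weyl_val (f (lift j))) = weyl_val (f (theta2 i j *: lift j)).
  by rewrite flinZ.
congr weyl_val; apply: cocycle_wd.
have -> : diff0 (theta1 i j *: lift i) = (theta1 i j * theta i) *: p.
  by rewrite linearZ /= liftE // scalerA.
have -> : diff0 (theta2 i j *: lift j) = (theta2 i j * theta j) *: p.
  by rewrite linearZ /= liftE // scalerA.
by rewrite theta_comm.
Qed.

Lemma coboundary_weights : coboundary f -> weight_coboundary (cocycle_weights f).
Proof.
case=> g gE; exists (weyl_val (g p)).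
  by split; [case: (g p)|rewrite -weyl_scaleE -linearZ /= pe].
by move=> j jb; rewrite /cocycle_weights gE -/diff0 liftE // linearZ.
Qed.

(** Every boundary decomposes along the [theta j *: p], where [f] is given by its weights, so a
    vector [y] trivializing the weights should be the value of a trivializing map at [p]. *)
Lemma weights_coboundary : weight_coboundary (cocycle_weights f) -> coboundary f.
Proof.
case=> y [yN ye] yE; pose ym : N := Weyl yN.
have exd q : exists x, diff0 x == q - (alpha q : schur) *: p.
  have /resolution_exact0[x xE] : aug (q - (alpha q : schur) *: p) = 0.
    by rewrite linearB linearZ /= paug alphaE subrr.
  by exists x; rewrite xE.
have [s sE] : exists s : P 0 -> P 1, forall q, diff0 (s q) = q - (alpha q : schur) *: p.
  by exists (fun q => xchoose (exd q)) => q; apply/eqP/(xchooseP (exd q)).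
(* The difference of [q] and [alpha q *: p] is a boundary, on which [g] has to agree with [f]; the
   section [s] is not linear, but [f \o s] behaves linearly by [cocycle_wd]. *)
pose g (q : P 0) : N := (alpha q : schur) *: ym + f (s q).
have glin : linear g.
  move=> c q q'; rewrite /g.
  have alin : alpha (c *: q + q') = c * (alpha q : schur) + (alpha q' : schur) :> schur.
    by rewrite linearD linearZ.
  have -> : f (s (c *: q + q')) = c *: f (s q) + f (s q').
    rewrite -flinZ -flinD; apply: cocycle_wd; rewrite linearD linearZ /= !sE.
    by rewrite alin scalerDl -scalerA scalerBr opprD addrACA.
  by rewrite alin scalerDl -scalerA scalerDr addrACA.
pose gL : {linear P 0 -> N} := HB.pack g (GRing.isLinear.Build _ _ _ _ g glin).
exists gL => x; rewrite [gL _]/(g (diff0 x)) /g.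
have [|z zP zE] := @kernel_decomp (alpha (diff0 x)).
  rewrite -hook_gen_act alphaE.
  have -> : aug (diff0 x) = 0 by apply/resolution_exact0; exists x.
  by [].
have -> : f (s (diff0 x)) =
    f x - \sum_(j < b) gen (w1 j) (z j) *: f (lift j).
  have -> : \sum_(j < b) gen (w1 j) (z j) *: f (lift j) = f (\sum_(j < b) gen (w1 j) (z j) *: lift j).
    by rewrite flin_sum; apply: eq_bigr => j _; rewrite flinZ.
  rewrite -flinB; apply: cocycle_wd; rewrite sE raddfB /=.
  congr (_ - _); rewrite -{1}pe scalerA [_ * e]zE scaler_suml linear_sum.
  by apply: eq_bigr => j _; rewrite linearZ /= liftE // scalerA.
have -> : (alpha (diff0 x) : schur) *: ym = \sum_(j < b) gen (w1 j) (z j) *: f (lift j).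
  apply: val_inj; apply: etrans (weyl_scaleE _ _) _.
  apply: etrans _ (esym (weyl_sumE _ _ _)); rewrite [weyl_val ym]/=.
  rewrite -{1}ye -act_mul [_ * e]zE schur_mx_sum mulmx_suml; apply: eq_bigr => j _.
  by rewrite act_mul -yE.
by rewrite addrC subrK.
Qed.

End Cocycle.

(** The cocycle is [F] applied to the image of the boundary under [alpha], which lies in the kernel
    of the presentation. Its weights are [x] only up to a coboundary, as [alpha p] need not be 1. *)
Lemma cocycle_of_weights x : weight_cocycle x ->
  exists2 f : {linear P 1 -> N}, cocycle f &
    weight_coboundary (fun j => cocycle_weights f j - x j).
Proof.
move=> xC; have [F FE] := cocycle_glue xC; have FK := cocycle_glue_kernel xC FE.
have kill q : antisym *m act (alpha (diff0 q) : schur) (bas K w) = 0.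
  rewrite -hook_gen_act alphaE.
  have -> : aug (diff0 q) = 0 by apply/resolution_exact0; exists q.
  by [].
have FN q : F *m act (alpha (diff0 q) : schur) (bas K w) \in @weyl_pred K n r la.
  by case: (FK _ (kill q)).
pose f q : N := Weyl (FN q).
have flin : linear f.
  move=> c q q'; apply: val_inj; apply: etrans _ (esym (weyl_addE _ _)).
  rewrite weyl_scaleE /= -(FK _ (kill q)).2 -mulmxDr; congr (_ *m _).
  by rewrite linearD linearZ /= linearD linearZ /= mulmxDl -act_mul.
pose fL : {linear P 1 -> N} := HB.pack f (GRing.isLinear.Build _ _ _ _ f flin).
exists fL.
  move=> z; apply: val_inj => /=.
  have -> : diff0 (res_diff P 1 z) = 0 by apply/resolution_exact1; exists z.
  by rewrite linear0 mul0mx mulmx0.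
have kill1 : antisym *m act ((alpha p : schur) - 1) (bas K w) = 0.
  rewrite -hook_gen_act scalerBl scale1r alphaE paug subrr.
  by [].
have [FN1 Fact1] := FK _ kill1; set om := act _ _ in FN1 Fact1.
(* [alpha p] and 1 agree on the generator, so [om] lies in the kernel and its image under [F]
   measures the discrepancy. *)
exists (act e (F *m om)).
  split; first exact: inN_act.
  by rewrite -act_mul [e * e]gen_mul ?gen_bas //; apply: f_e.
move=> j jb; have -> : cocycle_weights fL j = F *m act (theta j) (bas K w + om).
  rewrite /cocycle_weights /= liftE // linearZ /=; congr (_ *m _).
  have -> : bas K w + om = act (alpha p : schur) (bas K w).
    by rewrite /om /= mulmxBl mul1mx addrC subrK.
  by rewrite -act_mul.
rewrite mulmxDr [F *m _]mulmxDr Fact1 -act_mul theta_e //.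
rewrite [act (theta j) (bas K w)]gen_bas; last exact: f_theta.
have [x1 _] := xC.
rewrite (FE j _ jb (@f_e1 j)).
by have [_ /= xj] := x1 j jb; rewrite [act _ (x j)]xj addrAC subrr add0r.
Qed.

End Resolved.

(** Taking weights is compatible with K-combinations, reaches every weight cocycle modulo
    coboundaries and detects coboundaries, so a basis may be tested on weights. *)
Lemma Ext1_dim_weights d (z : 'I_d -> nat -> tens) :
  (forall l, weight_cocycle (z l)) ->
  (forall x, weight_cocycle x ->
    exists! c : 'rV[K]_d, weight_coboundary (fun j => x j - \sum_l c 0 l *: z l j)) ->
  Ext_dim (schur_scalar n r) 1 M N d.
Proof.
move=> zC zB P; have [alpha alphaE] := lift_exists P; have [p pe paug] := base_exists P.
have /fin_all_exists[E EP] : forall l, exists f : {linear P 1 -> N},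
    cocycle f /\ weight_coboundary (fun j => cocycle_weights paug f j - z l j).
  by move=> l; have [f ? ?] := cocycle_of_weights alphaE paug (zC l); exists f.
exists E; split=> [l|f fC]; first by case: (EP l).
have comb_lin (c : 'rV[K]_d) : linear (fun x => f x - \sum_l schur_scalar n r (c 0 l) *: E l x).
  move=> B x y.
  have -> : \sum_l schur_scalar n r (c 0 l) *: E l (B *: x + y) =
      B *: (\sum_l schur_scalar n r (c 0 l) *: E l x) +
      \sum_l schur_scalar n r (c 0 l) *: E l y.
    rewrite scaler_sumr -big_split; apply: eq_bigr => l _ /=.
    by rewrite linearP scalerDr !scalerA schur_scalar_comm.
  by rewrite linearP scalerBr opprD addrACA.
have comb_coc (c : 'rV[K]_d) : cocycle (fun x => f x - \sum_l schur_scalar n r (c 0 l) *: E l x).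
  move=> x; rewrite fC big1 ?subr0 // => l _.
  by have [-> _] := EP l; rewrite scaler0.
have comb_weights (c : 'rV[K]_d) j :
    cocycle_weights paug (fun x => f x - \sum_l schur_scalar n r (c 0 l) *: E l x) j =
    cocycle_weights paug f j - \sum_l c 0 l *: cocycle_weights paug (E l) j.
  rewrite /cocycle_weights weyl_subE weyl_sumE; congr (_ - _).
  by apply: eq_bigr => l _; rewrite weyl_scalarE.
have EB (c : 'rV[K]_d) : weight_coboundary (fun j =>
    \sum_l c 0 l *: (cocycle_weights paug (E l) j - z l j)).
  by apply: weight_coboundary_comb => l; case: (EP l).
have [|c [cB cU]] := zB (cocycle_weights paug f).
  by apply: cocycle_weightsP => //; apply: linearP.
exists c; split=> [|c' c'B].
  apply: (weights_coboundary alphaE pe); [exact: comb_lin|exact: comb_coc|].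
  apply: weight_coboundary_ext (weight_coboundaryB cB (EB c)) => j jb.
  rewrite comb_weights -addrA -opprD -big_split; congr (_ - _); apply: eq_bigr => l _.
  by rewrite /= scalerBr addrC subrK.
apply: cU; have cE := weight_coboundary_comb (fun l => - c' 0 l) (fun l => (EP l).2).
have cw : weight_coboundary (cocycle_weights paug
    (fun x => f x - \sum_l schur_scalar n r (c' 0 l) *: E l x)).
  by apply: coboundary_weights.
apply: weight_coboundary_ext (weight_coboundaryB cw cE) => j jb.
rewrite comb_weights -addrA -opprD -big_split; congr (_ - _); apply: eq_bigr => l _.
by rewrite /= scaleNr scalerBr opprB addrC subrK.
Qed.

End ExtFormula.

(** * Tableau coordinates of weight vectors *)

Section Contents.
Variables (n r : nat).
Local Notation word := {ffun 'I_r -> 'I_n}.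

Definition mult (u : word) (c : nat) : nat := #|[set k | u k == c :> nat]|.

Definition orbit_of (w u : word) := [exists s, u == permute w s].

Lemma mult_permute u s c : mult (permute u s) c = mult u c.
Proof.
rewrite /mult -[RHS](card_preimset _ (@perm_inj _ s)).
by apply: eq_card => k; rewrite !inE ffunE.
Qed.

(* Repairing one place at a time, a rearrangement can be chosen to fix all    *)
(* the places where the two words already agree.                              *)
Lemma content_permute (t t' : word) : (forall c, mult t c = mult t' c) ->
  exists2 s, t' = permute t s & forall k, t k = t' k -> s k = k.
Proof.
elim: {t}_.+1 {-2}t (ltnSn #|[set k | t k != t' k]|) => // N IH t ltN tt'.
have [/eqP e|] := posnP #|[set k | t k != t' k]|.
  exists 1%g => [|k _]; last by rewrite perm1.
  rewrite permute1; apply/ffunP=> k; apply/eqP; rewrite eq_sym.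
  by move: e; rewrite cards_eq0 => /eqP/setP/(_ k); rewrite !inE => /negbFE.
case/card_gt0P=> k; rewrite inE => tk.
have /existsP[l /andP[/eqP tl tl']] : [exists l, (t l == t' k) && (t' l != t' k)].
  apply: contraT; rewrite negb_exists => /forallP sub.
  have : [set j | t j == t' k :> nat] \proper [set j | t' j == t' k :> nat].
    apply/properP; split.
      apply/subsetP=> j; rewrite !inE => tj.
      by have := sub j; rewrite -!val_eqE /= tj /= negbK.
    by exists k; rewrite !inE ?eqxx // -[_ == _]/(t k == t' k).
  by move/proper_card; rewrite -/(mult t (t' k)) -/(mult t' (t' k)) tt' ltnn.
have lk : l != k by apply: contraNneq tl' => ->.
pose t1 := permute t (tperm k l).
have t1k : t1 k = t' k by rewrite ffunE tpermL.
have [||s t's sfix] := IH t1.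
- rewrite ltnS in ltN; apply: leq_trans ltN; apply: proper_card; apply/properP; split.
    apply/subsetP=> j; rewrite !inE /t1 ffunE; case: tpermP => [->|->|_ _ //].
      by rewrite tl eqxx.
    by move=> _; rewrite tl eq_sym.
  by exists k; rewrite !inE ?t1k ?eqxx.
- by move=> c; rewrite mult_permute.
exists (s * tperm k l)%g => [|j tj]; first by rewrite permuteM.
have jk : j != k by apply: contraNneq tk => <-; rewrite tj.
have jl : j != l by apply: contraNneq tl' => e; rewrite -tl -e tj.
rewrite permM sfix ?tpermD // 1?eq_sym //.
by rewrite ffunE tpermD // eq_sym.
Qed.

End Contents.

Section Coordinates.
Variables (K : fieldType) (n r a m : nat).
Hypotheses (a1 : (1 < a)%N) (rE : r = (a + m)%N).

Local Notation word := {ffun 'I_r -> 'I_n}.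
Local Notation tens := 'cV[K]_#|{ffun 'I_r -> 'I_n}|.
Local Notation schur := (schur K n r).
Local Notation act B v := (schur_mx B *m v).
Local Notation hook := (a :: nseq m 1%N).
Local Notation antisym := (col_antisym K n r hook).
Local Notation inN v := ((v : tens) \in weyl_space K n r hook).
Local Notation col_place := (col_place a).

Let a0 : (0 < a)%N := ltnW a1.

Lemma rank_pos : (0 < r)%N. Proof. by rewrite rE addn_gt0 a0. Qed.
Let p0 : 'I_r := place0 rank_pos.

Lemma weyl_antisym v : inN v -> exists2 x, young_fixed (row_color a) x & v = antisym *m x.
Proof. by move/(@weyl_hookP K n r a m a0 rE). Qed.

Lemma entry_col_perm v u (s : 'S_r) : inN v -> (forall k : 'I_r, ~~ col_place k -> s k = k) ->
  entry v (permute u s) = (-1) ^+ s * entry v u.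
Proof.
case/weyl_antisym=> x _ -> sC; rewrite !entry_antisym.
rewrite big_distrr [RHS](reindex_inj (mulIg s)) /=.
have sC' : s \in col_stab r hook by apply/(@col_stab_hookP r a m a0 rE).
apply: eq_big => [t|t _].
  apply/(@col_stab_hookP r a m a0 rE)/(@col_stab_hookP r a m a0 rE) => tC k ck.
    by rewrite permM tC // sC.
  have := tC k ck; rewrite permM => e; apply: (@perm_inj _ s); by rewrite e sC.
rewrite odd_permM signr_addb [RHS]mulrA [X in _ = X * _]mulrCA -signr_addb addbb mulr1.
by rewrite -permuteM.
Qed.

(** Only permutations of the arm commute with the column group; symmetry under the corner place is
    lost after antisymmetrizing. *)
Lemma entry_row_perm v u (s : 'S_r) : inN v -> (forall k : 'I_r, col_place k -> s k = k) ->
  entry v (permute u s) = entry v u.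
Proof.
case/weyl_antisym=> x xR -> sR; rewrite !entry_antisym; apply: eq_bigr => t.
move/(@col_stab_hookP r a m a0 rE) => tC.
have snc (k : 'I_r) : ~~ col_place k -> ~~ col_place (s k).
  by apply: contra => h; have /perm_inj e := sR _ h; rewrite e in h.
have comm : (t * s = s * t)%g.
  apply/permP=> k; rewrite !permM; have [ck|nk] := boolP (col_place k).
    rewrite [s k]sR // sR //; apply: contraT => h.
    by have /perm_inj e := tC _ h; rewrite e ck in h.
  by rewrite (tC k nk) tC ?snc.
rewrite -permuteM comm permuteM (young_fixed_entry _ xR) // => k.
have [ck|nk] := boolP (col_place k); first by rewrite sR.
by move: (snc k nk) (nk); rewrite /col_place /row_color; lia.
Qed.

Lemma entry_tperm v u (k l : 'I_r) : inN v -> k != l -> col_place k -> col_place l ->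
  entry v (permute u (tperm k l)) = - entry v u.
Proof. by case/weyl_antisym=> x _ -> ? ? ?; apply: antisym_tperm. Qed.

Lemma entry_repeat v (u : word) (k l : 'I_r) : inN v -> k != l -> col_place k -> col_place l ->
  u k = u l -> entry v u = 0.
Proof. by case/weyl_antisym=> x _ -> ? ? ? ?; apply: (@antisym_repeat _ _ _ _ _ a0 rE _ _ k l). Qed.

(* Antisymmetrizing over the column and one more place of the first row gives *)
(* zero; the cosets of the column group are indexed by the exchanged place.   *)
Lemma entry_garnir v u (q : 'I_r) : inN v -> ~~ col_place q ->
  entry v u = \sum_(c : 'I_r | col_place c) entry v (permute u (tperm c q)).
Proof.
case/weyl_antisym=> x xR -> qR.
pose G := [pred s : 'S_r | [forall k : 'I_r, (col_place k || (k == q)) || (s k == k)]].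
have GP (s : 'S_r) : reflect (forall k : 'I_r, ~~ col_place k -> k != q -> s k = k) (G s).
  apply: (iffP forallP) => [h k ck kq|h k].
    by have := h k; rewrite (negPf ck) (negPf kq) => /eqP.
  by case: (boolP (col_place k)) => //= ck; case: eqVneq => //= kq; rewrite h.
have p0q : p0 != q by apply: contraNneq qR => <-.
have sum0 : \sum_(s | G s) (-1) ^+ s * entry x (permute u s) = 0.
  apply: (@alternating_sum0 _ _ _ _ (fun s => tperm p0 q * s)%g) => [|s|s|s].
  - by exists (fun s => tperm p0 q * s)%g => s; rewrite mulgA tperm2 mul1g.
  - apply/GP/GP => h k ck kq; have := h k ck kq; rewrite permM tpermD // 1?eq_sym //.
      by apply: contraNneq ck => ->.
    by apply: contraNneq ck => ->.
  - rewrite permuteM (young_fixed_entry _ xR) // => j.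
    by case: tpermP => // ->; move: qR; rewrite /col_place /row_color /=; lia.
  - by rewrite odd_mul_tperm p0q.
have part (c : 'I_r) : col_place c || (c == q) ->
    \sum_(s | G s && (s q == c)) (-1) ^+ s * entry x (permute u s) =
    (if c == q then 1 else -1) * entry (antisym *m x) (permute u (tperm c q)).
  move=> cq; rewrite entry_antisym (reindex_inj (mulIg (tperm c q))) /= mulr_sumr.
  apply: eq_big => [s|s].
    rewrite permM -(inj_eq (@perm_inj _ (tperm c q))) tpermK tpermL.
    apply/andP/(@col_stab_hookP r a m a0 rE) => [[/GP h /eqP e] k ck|h].
      have [->//|kq] := eqVneq k q.
      have := h k ck kq; rewrite permM => e'; apply: (@perm_inj _ (tperm c q)).
      rewrite e' tpermD // 1?eq_sym //.
      by case/orP: cq => [cc|/eqP->]; [apply: contraNneq ck => ->|].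
    split; last by rewrite h.
    apply/GP=> k ck kq; rewrite permM h // tpermD // 1?eq_sym //.
    by case/orP: cq => [cc|/eqP->]; [apply: contraNneq ck => ->|].
  move=> _; rewrite permuteM odd_permM odd_tperm; case: eqVneq => [_|_] /=.
    by rewrite addbF mul1r.
  by rewrite addbT signrN !mulNr mul1r.
move: sum0; rewrite (partition_big (fun s : 'S_r => s q) (fun c : 'I_r => col_place c || (c == q))) /=.
  rewrite (bigD1 q) ?eqxx ?orbT //= part ?eqxx ?orbT // mul1r tperm1 permute1.
  move/eqP; rewrite addr_eq0 => /eqP ->; rewrite -sumrN.
  apply: eq_big => [c|c /andP[cq cnq]].
    by have [->|] := eqVneq c q; rewrite ?andbF ?(negPf qR) ?andbT ?orbF.
  by rewrite part // (negPf cnq) mulN1r opprK.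
move=> s /GP h; apply: contraT; rewrite negb_or => /andP[nc nq].
by move: (nc); have /perm_inj e := h _ nc nq; rewrite e eqxx in nq.
Qed.

Definition col_reads (t : word) (l : seq nat) :=
  (letter t 0 == 0%N) && (mkseq (fun i => letter t (a + i)) m == l).

(** The coordinate at the tableau with corner 0 and leg [l]. Any reading word will do, since two of
    them with the same content differ by an arm permutation; if there is none, the value is 0. *)
Definition tab_coord (w : word) (v : tens) (l : seq nat) : K :=
  if [pick t | orbit_of w t && col_reads t l] is Some t then entry v t else 0.

Lemma orbit_mult (w t : word) c : orbit_of w t -> mult t c = mult w c.
Proof. by case/existsP=> s /eqP->; rewrite mult_permute. Qed.

Lemma mult_orbit (w t : word) : (forall c, mult w c = mult t c) -> orbit_of w t.
Proof. by case/content_permute=> s -> _; apply/existsP; exists s. Qed.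

Lemma orbit_permute (w t : word) s : orbit_of w (permute t s) = orbit_of w t.
Proof.
apply/idP/idP => /orbit_mult h; apply: mult_orbit => c; rewrite -h ?mult_permute //.
Qed.

Lemma letter_col t l i : col_reads t l -> (i < m)%N -> letter t (a + i) = nth 0%N l i.
Proof. by case/andP=> _ /eqP<- im; rewrite nth_mkseq. Qed.

Lemma tab_coordE w v t l : inN v -> orbit_of w t -> col_reads t l -> tab_coord w v l = entry v t.
Proof.
move=> vN tw tl; rewrite /tab_coord; case: pickP => [t' /andP[t'w t'l]|/(_ t)]; last by rewrite tw tl.
have [|s t's sfix] := @content_permute _ _ t t'.
  by move=> c; rewrite (orbit_mult _ tw) (orbit_mult _ t'w).
rewrite t's entry_row_perm // => k /orP ck; apply: sfix; apply: val_inj => /=.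
rewrite -!letterE; case: ck => [/eqP->|ak].
  by case/andP: tl => /eqP-> _; case/andP: t'l => /eqP-> _.
have [i im ->] : exists2 i, (i < m)%N & k = (a + i)%N :> nat.
  by exists (k - a)%N; have := ltn_ord k; lia.
by rewrite !(@letter_col _ l).
Qed.

End Coordinates.

(** * Relabelling all letters y as x, in tableau coordinates *)

Section Theta.
Variables (K : fieldType) (n r : nat).
Local Notation word := {ffun 'I_r -> 'I_n}.
Local Notation tens := 'cV[K]_#|{ffun 'I_r -> 'I_n}|.
Local Notation act B v := (schur_mx B *m v).
Variables (w w' : word) (x : nat) (y : 'I_n).
Hypotheses (xy : x != y) (w'E : forall k, w' k = (if w k == y then x else w k) :> nat).

Definition fill (t : word) (B : {set 'I_r}) : word :=
  [ffun k => if k \in B then y else t k].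

Lemma theta_refine k l : w k = w l -> w' k = w' l.
Proof. by move=> e; apply: val_inj; rewrite /= !w'E e. Qed.

Lemma orbit_not_y (t : word) k : orbit_of w' t -> (t k == y) = false.
Proof.
case/existsP=> s /eqP->; rewrite ffunE -val_eqE /= w'E.
by case: ifP => // _; apply/negbTE.
Qed.

Lemma mult_x : mult w' x = (mult w x + mult w y)%N.
Proof.
rewrite /mult -cardsUI.
have -> : [set k | w k == x :> nat] :&: [set k | w k == y :> nat] = set0.
  apply/setP=> k; rewrite !inE; apply/andP=> -[/eqP e1 /eqP e2].
  by move: xy; rewrite -e1 e2 eqxx.
rewrite cards0 addn0; apply: eq_card => k; rewrite !inE w'E -val_eqE /=.
by case: ifP => h; rewrite ?eqxx ?orbT ?orbF.
Qed.

Lemma fill_permute (t : word) (B : {set 'I_r}) : orbit_of w' t ->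
  B \subset [set k | t k == x :> nat] -> #|B| = mult w y ->
  exists2 s, fill t B = permute w s & t = permute w' s.
Proof.
move=> tw' /subsetP BX cB.
have tX c : mult t c = mult w' c by apply: orbit_mult tw'.
have [c|s fs _] := @content_permute _ _ w (fill t B).
  have [->|cy] := eqVneq c y.
    rewrite -cB; apply: eq_card => k; rewrite !inE ffunE.
    by case: ifP => _; rewrite ?eqxx // [RHS](orbit_not_y _ tw').
  have [->|cx] := eqVneq c x.
    apply/eqP; rewrite -(eqn_add2r (mult w y)) -mult_x -tX -{1}cB /mult.
    rewrite -(cardsID B [set k | t k == x :> nat]) addnC.
    apply/eqP; congr (_ + _)%N; last first.
      by apply: eq_card => k; rewrite !inE; apply: andb_idl => /BX; rewrite inE.
    apply: eq_card => k; rewrite !inE ffunE andbC; case: ifP => /= _; rewrite ?andbF ?andbT //.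
    by apply/esym/negbTE; rewrite eq_sym.
  have -> : mult w c = mult w' c.
    apply: eq_card => k; rewrite !inE w'E; have [->|//] := eqVneq (w k) y.
    by rewrite eq_sym (negPf cy) eq_sym (negPf cx).
  rewrite -tX; apply: eq_card => k; rewrite !inE ffunE; have [/BX|//] := boolP (k \in B).
  rewrite inE => /eqP->.
  by rewrite [x == c]eq_sym (negPf cx) eq_sym (negPf cy).
exists s => //; apply/ffunP=> k; apply: val_inj; rewrite ffunE /= w'E.
have := congr1 (fun f : word => f k) fs; rewrite /= !ffunE => <-.
have [/BX|_] := boolP (k \in B); first by rewrite inE eqxx => /eqP.
by rewrite (orbit_not_y _ tw').
Qed.

(** The words above [t] arise by turning some of its letters [x] back into [y]; weight
    considerations only fix how many. Binomial coefficients appear once the entries depend only on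
    the column. *)
Lemma entry_theta v t : (forall u, entry v u != 0 -> orbit_of w u) -> orbit_of w' t ->
  entry (act (gen w (bas K w')) v) t =
  \sum_(B : {set 'I_r} | (B \subset [set k | t k == x :> nat]) && (#|B| == mult w y))
    entry v (fill t B).
Proof.
move=> vw tw'; rewrite gen_actE; last exact: theta_refine.
rewrite (reindex_onto (fill t) (fun u => [set k | u k == y])) /=; last first.
  move=> u /existsP[s /andP[/eqP <- /eqP ts]]; apply/ffunP=> k; rewrite !ffunE inE ffunE.
  case: eqVneq => [->//|h]; apply: val_inj; rewrite -ts ffunE /= w'E.
  by rewrite (negPf h).
apply: eq_bigl => B; apply/andP/andP => [[/existsP[s /andP[/eqP ws /eqP ts]] /eqP Bk]|[BX /eqP cB]].
  split.
    apply/subsetP=> k; rewrite -{1}Bk -ws !inE ffunE => /eqP wsk.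
    by rewrite -ts ffunE w'E wsk eqxx.
  by rewrite -[in X in X == _]Bk -ws -(mult_permute w s y) /mult; apply/eqP/eq_card => k; rewrite !inE.
have [s fs ts] := fill_permute tw' BX cB; split.
  by apply/existsP; exists s; rewrite -fs -ts !eqxx.
apply/eqP/setP=> k; rewrite inE ffunE.
by case: ifP => _; rewrite ?eqxx // (orbit_not_y _ tw').
Qed.

Lemma fill_orbit (t : word) (B : {set 'I_r}) : orbit_of w' t ->
  B \subset [set k | t k == x :> nat] -> #|B| = mult w y -> orbit_of w (fill t B).
Proof.
move=> tw' BX cB; have [s -> _] := fill_permute tw' BX cB.
by apply/existsP; exists s.
Qed.

Lemma mult_orbit_x t : orbit_of w' t -> #|[set k | t k == x :> nat]| = mult w' x.
Proof. by move=> tw'; apply: orbit_mult tw'. Qed.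

End Theta.

Section CoordTheta.
Variables (K : fieldType) (n r a m : nat).
Hypotheses (a1 : (1 < a)%N) (rE : r = (a + m)%N).
Local Notation word := {ffun 'I_r -> 'I_n}.
Local Notation tens := 'cV[K]_#|{ffun 'I_r -> 'I_n}|.
Local Notation act B v := (schur_mx B *m v).
Local Notation hook := (a :: nseq m 1%N).
Local Notation inN v := ((v : tens) \in weyl_space K n r hook).
Local Notation tab_coord := (@tab_coord K n r a m).
Local Notation col_reads := (@col_reads n r a m).
Variables (w w' : word) (x : nat) (y : 'I_n).
Hypotheses (xy : x != y) (w'E : forall k, w' k = (if w k == y then x else w k) :> nat).
Variables (v : tens).
Hypotheses (vN : inN v) (vw : forall u, entry v u != 0 -> orbit_of w u).

Local Notation beta := (mult w y).
Local Notation mu := (mult w' x).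

Lemma col_readsP t l : size l = m -> reflect
  (letter t 0 = 0%N /\ forall i, (i < m)%N -> letter t (a + i) = nth 0%N l i)
  (col_reads t l).
Proof.
move=> sl; apply: (iffP idP) => [h|[h0 hl]].
  by split=> [|i im]; [case/andP: h => /eqP|apply: letter_col h im].
apply/andP; split; first exact/eqP.
apply/eqP/(@eq_from_nth _ 0%N) => [|i]; rewrite size_mkseq ?sl // => im.
by rewrite nth_mkseq // hl.
Qed.

Lemma letter_fill (t : word) (B : {set 'I_r}) (k : 'I_r) :
  letter (fill y t B) k = if k \in B then y : nat else letter t k.
Proof. by rewrite !letterE ffunE; case: ifP. Qed.

Lemma col_ord i : (i < m)%N -> (a + i < r)%N.
Proof. by move=> im; rewrite rE ltn_add2l. Qed.

Lemma count_draws (X : {set 'I_r}) N :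
  #|[pred B : {set 'I_r} | (B \subset X) && (#|B| == N)]| = 'C(#|X|, N).
Proof. by rewrite -cards_draws; apply: eq_card => B; rewrite !inE. Qed.

Lemma count_draws_notin (X : {set 'I_r}) p N : p \in X ->
  #|[pred B : {set 'I_r} | (B \subset X) && (#|B| == N) && (p \notin B)]| = 'C(#|X|.-1, N).
Proof.
move=> pX; have -> : #|X|.-1 = #|X :\ p| by rewrite (cardsD1 p X) pX.
rewrite -count_draws; apply: eq_card => B; rewrite !inE subsetD1 -andbA andbCA andbC.
by rewrite -!andbA; congr (_ && _); rewrite andbC.
Qed.

Lemma count_draws_in (X : {set 'I_r}) p N : p \in X -> (0 < N)%N ->
  #|[pred B : {set 'I_r} | (B \subset X) && (#|B| == N) && (p \in B)]| = 'C(#|X|.-1, N.-1).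
Proof.
move=> pX N0; have := cardID [pred B : {set 'I_r} | p \in B] [pred B : {set 'I_r} | (B \subset X) && (#|B| == N)].
rewrite count_draws => e.
have X0 : (0 < #|X|)%N by apply/card_gt0P; exists p.
have pascal : 'C(#|X|, N) = ('C(#|X|.-1, N) + 'C(#|X|.-1, N.-1))%N.
  by rewrite -{1}(prednK X0) -{1}(prednK N0) binS (prednK N0).
apply: (@addnI 'C(#|X|.-1, N)); rewrite -[RHS]pascal -[RHS]e.
rewrite -(count_draws_notin N pX) addnC.
by congr (_ + _)%N; apply: eq_card => B; rewrite !inE // andbC.
Qed.

Section At.
Variables (t : word) (l : seq nat).
Hypotheses (tw' : orbit_of w' t) (tl : col_reads t l) (sl : size l = m)
  (l0 : 0%N \notin l) (lu : uniq l).

Let X : {set 'I_r} := [set k | t k == x :> nat].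

Lemma theta_at : entry (act (gen w (bas K w')) v) t =
  \sum_(B : {set 'I_r} | (B \subset X) && (#|B| == beta)) entry v (fill y t B).
Proof. exact: entry_theta. Qed.

Lemma cardX : #|X| = mu. Proof. exact: mult_orbit_x tw'. Qed.

Lemma memX (k : 'I_r) : (k \in X) = (letter t k == x).
Proof. by rewrite inE letterE. Qed.

Lemma fill_coord (B : {set 'I_r}) l' : B \subset X -> #|B| = beta -> size l' = m ->
  (forall k : 'I_r, k = 0%N :> nat -> k \notin B) ->
  (forall k : 'I_r, forall i, (i < m)%N -> k = (a + i)%N :> nat ->
     nth 0%N l' i = if k \in B then y : nat else nth 0%N l i) ->
  entry v (fill y t B) = tab_coord w v l'.
Proof.
move=> BX cB sl' h0 hl'; symmetry; apply: (@tab_coordE _ _ _ _ _ a1 rE) => //.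
  exact: (@fill_orbit _ _ w w' x).
have [t0 tcol] := (col_readsP _ sl) tl.
apply/(col_readsP _ sl'); split=> [|i im].
  pose p := place0 (rank_pos a1 rE).
  by rewrite -[0%N]/(val p) letter_fill (negPf (h0 p _)).
rewrite -[(a + i)%N]/(val (Ordinal (col_ord im))) letter_fill tcol //.
by rewrite (hl' (Ordinal (col_ord im)) i).
Qed.

(** All relabelled places lie in the arm, so every subset contributes the same coordinate. *)
Lemma coord_theta_free : x != 0%N -> x \notin l ->
  entry (act (gen w (bas K w')) v) t = tab_coord w v l *+ 'C(mu, beta).
Proof.
move=> x0 xl; have [t0 tcol] := (col_readsP _ sl) tl.
rewrite theta_at -cardX -count_draws -sumr_const; apply: eq_big => // B /andP[BX /eqP cB].
apply: fill_coord => // [k k0|k i im ki].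
  by apply: contra x0 => /(subsetP BX); rewrite memX k0 t0 eq_sym.
case: ifP => // /(subsetP BX); rewrite memX ki tcol // => /eqP e.
by case/negP: xl; rewrite -e mem_nth // sl.
Qed.

(** Exactly one place carrying [x] lies in the column; the two terms correspond to leaving it or
    relabelling it. *)
Lemma coord_theta_col i : (i < m)%N -> nth 0%N l i = x -> (0 < beta)%N ->
  entry (act (gen w (bas K w')) v) t =
  tab_coord w v l *+ 'C(mu.-1, beta) + tab_coord w v (set_nth 0%N l i y) *+ 'C(mu.-1, beta.-1).
Proof.
move=> im lix b0; have [t0 tcol] := (col_readsP _ sl) tl.
pose p := Ordinal (col_ord im).
have pX : p \in X by rewrite memX /= tcol // lix.
have x0 : x != 0%N by apply: contraNneq l0 => <-; rewrite -lix mem_nth // sl.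
have colX (k : 'I_r) j : (j < m)%N -> k = (a + j)%N :> nat -> k \in X -> j = i.
  move=> jm kj; rewrite memX kj tcol // -lix => /eqP e.
  by apply/eqP; rewrite -(nth_uniq 0%N _ _ lu) ?sl // e.
have zeroX (B : {set 'I_r}) (k : 'I_r) : B \subset X -> k = 0%N :> nat -> k \notin B.
  by move=> BX k0; apply: contra x0 => /(subsetP BX); rewrite memX k0 t0 eq_sym.
rewrite theta_at (bigID (fun B : {set 'I_r} => p \in B)) /= addrC -cardX.
rewrite -(count_draws_notin _ pX) -(count_draws_in pX) // -!sumr_const; congr (_ + _).
  apply: eq_big => // B /andP[/andP[BX /eqP cB] pB].
  apply: fill_coord => // [k|k j jm kj]; first exact: zeroX.
  case: ifP => // kB; have ji := colX k j jm kj (subsetP BX k kB).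
  by case/negP: pB; rewrite (_ : p = k) //; apply: val_inj; rewrite /= kj ji.
apply: eq_big => // B /andP[/andP[BX /eqP cB] pB].
apply: fill_coord => // [|k|k j jm kj]; first by rewrite size_set_nth sl; apply/maxn_idPr.
  exact: zeroX.
rewrite nth_set_nth /=; case: eqP => [ji|ji].
  by rewrite (_ : k = p) ?pB //; apply: val_inj; rewrite /= kj ji.
by case: ifP => // kB; case: ji; apply: colX kj (subsetP BX k kB).
Qed.

(** The corner has become [y] and a letter 0 remains at the arm place [q]. The Garnir relation at
    [q] brings that 0 into the column: at the corner it restores [l], and at a leg place one column
    transposition, hence one sign, moves it to the corner and [y] into the leg. *)
Lemma entry_top_y (B : {set 'I_r}) (q : 'I_r) : x = 0%N -> B \subset X -> #|B| = beta ->
  place0 (rank_pos a1 rE) \in B -> (0 < q < a)%N -> fill y t B q = 0%N :> nat ->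
  entry v (fill y t B) =
  tab_coord w v l - \sum_(i < m) tab_coord w v (set_nth 0%N l i y).
Proof.
move=> x0 BX cB p0B qa q0; set p := place0 _ in p0B.
have [t0 tcol] := (col_readsP _ sl) tl.
set u := fill y t B in q0 *.
have uw : orbit_of w u by apply: (@fill_orbit _ _ w w' x).
have ucol (k : 'I_r) i : (i < m)%N -> k = (a + i)%N :> nat -> u k = nth 0%N l i :> nat.
  move=> im ki; rewrite ffunE; case: ifP => [kB|_].
    have := subsetP BX k kB; rewrite memX ki tcol // x0 => /eqP e.
    by case/negP: l0; rewrite -e mem_nth // sl.
  by rewrite -letterE ki tcol.
have up : u p = y by rewrite ffunE p0B.
have nq : ~~ col_place a q by rewrite /col_place; move: qa; clear; lia.
rewrite (entry_garnir a1 rE _ vN nq) (bigD1 p) //=; congr (_ + _).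
  symmetry; apply: (@tab_coordE _ _ _ _ _ a1 rE) => //; first by rewrite orbit_permute.
  apply/(col_readsP _ sl); split=> [|i im].
    by rewrite -[0%N]/(val p) letterE ffunE tpermL q0.
  rewrite -[(a + i)%N]/(val (Ordinal (col_ord im))) letterE ffunE tpermD; first exact: ucol.
    by rewrite -val_eqE /=; move: a1; clear; lia.
  by rewrite -val_eqE /=; move: qa; clear; lia.
pose h (i : 'I_m) : 'I_r := Ordinal (col_ord (ltn_ord i)).
have hinj : injective h by move=> i j [/eqP]; rewrite eqn_add2l => /eqP/val_inj.
rewrite (eq_bigl (mem (h @: setT))) => [|c]; last first.
  apply/andP/imsetP => [[cc cp]|[i _ ->]]; last first.
    by rewrite /col_place /= leq_addr orbT -val_eqE /=; split=> //; move: a1; clear; lia.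
  have ac : (a <= c)%N by move: cc cp; rewrite /col_place -val_eqE /=; clear; lia.
  have cm : (c - a < m)%N by move: (ltn_ord c) rE ac; clear; lia.
  by exists (Ordinal cm) => //; apply: val_inj; rewrite /= subnKC.
rewrite big_imset /=; last by move=> i j _ _; apply: hinj.
rewrite -sumrN; apply: eq_big => [i|i _]; first by rewrite inE.
have hp : p != h i by rewrite -val_eqE /=; move: a1; clear; lia.
have hq : h i != q by rewrite -val_eqE /=; move: qa; clear; lia.
have qp : q != p by rewrite -val_eqE /=; move: qa; clear; lia.
rewrite -[LHS]opprK -(@entry_tperm _ _ _ _ _ a1 rE _ _ p (h i)) //; last first.
  by rewrite /col_place /= leq_addr orbT.
congr (- _); symmetry; apply: (@tab_coordE _ _ _ _ _ a1 rE) => //; first by rewrite !orbit_permute.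
have ss : size (set_nth 0%N l i y) = m by rewrite size_set_nth sl; apply/maxn_idPr.
apply/(col_readsP _ ss); split=> [|j jm].
  by rewrite -[0%N]/(val p) letterE 2!ffunE tpermL tpermL q0.
rewrite -[(a + j)%N]/(val (Ordinal (col_ord jm))) letterE 2!ffunE nth_set_nth /=.
have [ji|ji] := eqVneq j i.
  rewrite (_ : Ordinal (col_ord jm) = h i); last by apply: val_inj; rewrite /= ji.
  by rewrite tpermR tpermD ?up // eq_sym.
have n1 : h i != Ordinal (col_ord jm) by rewrite -val_eqE /= eqn_add2l eq_sym.
have n2 : q != Ordinal (col_ord jm) by rewrite -val_eqE /=; move: qa; clear; lia.
have n3 : p != Ordinal (col_ord jm) by rewrite -val_eqE /=; move: a1; clear; lia.
by rewrite !tpermD //; apply: ucol.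
Qed.

(** Subsets avoiding the corner give the coordinate at [l], the others are straightened; Pascal's
    rule merges the two contributions at [l]. *)
Lemma coord_theta_top : x = 0%N -> (0 < beta)%N -> (0 < mult w 0)%N ->
  entry (act (gen w (bas K w')) v) t =
  tab_coord w v l *+ 'C(mu, beta) -
  (\sum_(i < m) tab_coord w v (set_nth 0%N l i y)) *+ 'C(mu.-1, beta.-1).
Proof.
move=> x0 b0 w0; have [t0 tcol] := (col_readsP _ sl) tl.
pose p := place0 (rank_pos a1 rE).
have pX : p \in X by rewrite memX t0 x0.
have mu0 : (0 < mu)%N by rewrite -cardX; apply/card_gt0P; exists p.
have -> : 'C(mu, beta) = ('C(mu.-1, beta) + 'C(mu.-1, beta.-1))%N.
  by rewrite -{1}(prednK mu0) -{1}(prednK b0) binS (prednK b0).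
rewrite mulrnDr -addrA -mulrnBl.
rewrite theta_at (bigID (fun B : {set 'I_r} => p \in B)) /= addrC -cardX.
rewrite -(count_draws_notin _ pX) -(count_draws_in pX) // -!sumr_const; congr (_ + _).
  apply: eq_big => // B /andP[/andP[BX /eqP cB] pB].
  apply: fill_coord => // [k k0|k j jm kj]; first by rewrite (_ : k = p) //; apply: val_inj.
  case: ifP => // /(subsetP BX); rewrite memX kj tcol // x0 => /eqP e.
  by case/negP: l0; rewrite -e mem_nth // sl.
apply: eq_big => // B /andP[/andP[BX /eqP cB] pB].
have uw : orbit_of w (fill y t B) by apply: (@fill_orbit _ _ w w' x).
have : (0 < mult (fill y t B) 0)%N by rewrite (orbit_mult _ uw).
case/card_gt0P=> q; rewrite inE => /eqP q0.
apply: (@entry_top_y B q) => //.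
apply/andP; split; [rewrite lt0n|rewrite ltnNge]; apply/negP => h.
  have e : q = p by apply: val_inj; apply/eqP.
  by move: q0; rewrite e ffunE pB => y0; move: xy; rewrite x0 y0.
have qm : (q - a < m)%N by move: (ltn_ord q) rE h; clear; lia.
have qE : q = (a + (q - a))%N :> nat by rewrite subnKC.
move: q0; rewrite ffunE; case: ifP => [_ y0|_]; first by move: xy; rewrite x0 y0.
rewrite -letterE qE tcol // => e.
by case/negP: l0; rewrite -e mem_nth // sl.
Qed.

End At.

End CoordTheta.

(** * Tableau coordinates determine a weight vector and take arbitrary values *)

Section CoordBasis.
Variables (K : fieldType) (n r a m : nat).
Hypotheses (a1 : (1 < a)%N) (rE : r = (a + m)%N).
Local Notation word := {ffun 'I_r -> 'I_n}.
Local Notation tens := 'cV[K]_#|{ffun 'I_r -> 'I_n}|.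
Local Notation act B v := (schur_mx B *m v).
Local Notation hook := (a :: nseq m 1%N).
Local Notation antisym := (col_antisym K n r hook).
Local Notation inN v := ((v : tens) \in weyl_space K n r hook).
Local Notation coord := (@tab_coord K n r a m).
Local Notation coordE := (@tab_coordE K n r a m a1 rE).
Local Notation col_reads := (@col_reads n r a m).
Local Notation p0 := (place0 (rank_pos a1 rE)).
Let a0 : (0 < a)%N := ltnW a1.

Lemma letter_ord (t : word) i (ir : (i < r)%N) : letter t i = t (Ordinal ir).
Proof. by rewrite -letterE. Qed.

Lemma letter_p0 (t : word) : letter t 0 = t p0.
Proof. by rewrite -letterE. Qed.

Lemma reads_exists (w : word) l : letter w 0 = 0%N -> size l = m -> uniq l ->
  0%N \notin l -> {in l, forall x, (0 < mult w x)%N} ->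
  exists2 t, orbit_of w t & col_reads t l.
Proof.
move=> w0 sl lu l0 lw.
suff [t tw [t0 tl]] : exists2 t, orbit_of w t &
    letter t 0 = 0%N /\ forall i, (i < m)%N -> letter t (a + i) = nth 0%N l i.
  by exists t => //; apply/(col_readsP a _ sl).
suff gen i : (i <= m)%N -> exists2 t, orbit_of w t &
    letter t 0 = 0%N /\ forall j, (j < i)%N -> letter t (a + j) = nth 0%N l j.
  exact: gen.
elim: i => [|i IH] im; first by exists w; [apply: mult_orbit|].
have [t tw [t0 tl]] := IH (ltnW im).
have li : nth 0%N l i \in l by rewrite mem_nth ?sl.
have : (0 < mult t (nth 0%N l i))%N by rewrite (orbit_mult _ tw) lw.
case/card_gt0P=> k; rewrite inE => /eqP tk.
pose q := Ordinal (col_ord rE im).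
have k0 : k != p0.
  by apply: contraNneq l0 => e; rewrite -t0 letter_p0 -e tk.
exists (permute t (tperm k q)); first by rewrite orbit_permute.
split.
  rewrite letter_p0 ffunE tpermD // -?letter_p0 //.
  by rewrite -val_eqE /=; move: a1; clear; lia.
move=> j; rewrite ltnS leq_eqVlt => /predU1P[->|ji].
  by rewrite (letter_ord _ (col_ord rE im)) ffunE tpermR.
have jm : (j < m)%N := ltn_trans ji im.
rewrite (letter_ord _ (col_ord rE jm)) ffunE tpermD -?letter_ord ?tl //.
  apply/eqP => e.
  have : letter t (a + j) = nth 0%N l i by rewrite (letter_ord _ (col_ord rE jm)) -e tk.
  rewrite tl // => /eqP; rewrite nth_uniq ?sl // => /eqP e'.
  by rewrite e' ltnn in ji.
by rewrite -val_eqE /= eqn_add2l gtn_eqF.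
Qed.

Lemma tab_coord_swap w v l1 l2 x y : inN v -> (size l1 + size l2).+2 = m ->
  coord w v (l1 ++ x :: y :: l2) = - coord w v (l1 ++ y :: x :: l2).
Proof.
move=> vN sm.
have half x' y' t : orbit_of w t -> col_reads t (l1 ++ x' :: y' :: l2) ->
    coord w v (l1 ++ x' :: y' :: l2) = - coord w v (l1 ++ y' :: x' :: l2).
  move=> tw tl.
  have s1 : (size l1 < m)%N by lia.
  have s2 : ((size l1).+1 < m)%N by lia.
  have sl : size (l1 ++ x' :: y' :: l2) = m by rewrite size_cat /=; lia.
  have sl' : size (l1 ++ y' :: x' :: l2) = m by rewrite size_cat /=; lia.
  pose k1 := Ordinal (col_ord rE s1); pose k2 := Ordinal (col_ord rE s2).
  rewrite (coordE vN tw tl) (@coordE w v (permute t (tperm k1 k2))) ?orbit_permute //.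
    rewrite (entry_tperm a1 rE) ?opprK //.
    - by rewrite -val_eqE /= eqn_add2l; clear; lia.
    - by rewrite /col_place /= leq_addr orbT.
    - by rewrite /col_place /= leq_addr orbT.
  have [t0 tc] := (col_readsP a _ sl) tl.
  apply/(col_readsP a _ sl'); split=> [|i im].
    by rewrite letter_p0 ffunE tpermD -?letter_p0 // -val_eqE /=; move: a1; clear; lia.
  rewrite (letter_ord _ (col_ord rE im)) ffunE.
  have tK j (jm : (j < m)%N) : t (Ordinal (col_ord rE jm)) = nth 0%N (l1 ++ x' :: y' :: l2) j :> nat.
    by rewrite -tc // -letter_ord.
  case: tpermP => [[/eqP]|[/eqP]|/eqP n1 /eqP n2].
  - by rewrite eqn_add2l => /eqP->; rewrite tK !nth_cat ltnn ltnNge leqnSn /= subnn subSnn.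
  - by rewrite eqn_add2l => /eqP->; rewrite tK !nth_cat ltnn ltnNge leqnSn /= subnn subSnn.
  move: n1 n2; rewrite -!val_eqE /= !eqn_add2l tK !nth_cat => n1 n2.
  case: ltnP => // h; have [j ->] : exists j, i = ((size l1).+2 + j)%N.
    by exists (i - (size l1).+2)%N; move: n1 n2 h; clear; lia.
  by rewrite !addSn -!addnS addKn.
have e0 l : (forall t, ~~ (orbit_of w t && col_reads t l)) -> coord w v l = 0.
  by move=> h; rewrite /tab_coord; case: pickP => // t; rewrite (negPf (h t)).
case: (pickP (fun t => orbit_of w t && col_reads t (l1 ++ x :: y :: l2))) => [t /andP[tw tl]|h].
  exact: half tw tl.
case: (pickP (fun t => orbit_of w t && col_reads t (l1 ++ y :: x :: l2))) => [t /andP[tw tl]|h'].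
  by rewrite (half y x t tw tl) opprK.
by rewrite !e0 ?oppr0 // => t; rewrite ?h ?h'.
Qed.

(** An arbitrary entry is reduced to standard coordinates: a 0 in the arm is brought into the column
    by a Garnir relation, then to the corner by a transposition, and the leg is sorted. *)
Lemma tab_coord_inj w v : inN v -> (forall u, entry v u != 0 -> orbit_of w u) ->
  (0 < mult w 0)%N ->
  (forall l, sorted ltn l -> 0%N \notin l -> size l = m ->
     {in l, forall x, (0 < mult w x)%N} -> coord w v l = 0) -> v = 0.
Proof.
move=> vN vw w0 vl; apply: entryP => t; rewrite entry0.
have [tw|ntw] := boolP (orbit_of w t); last by apply/eqP; apply: contraNT ntw => /vw.
have claim1 t' : orbit_of w t' -> t' p0 = 0%N :> nat -> entry v t' = 0.
  move=> {t tw} tw t0; pose P (s : 'S_r) := [forall k : 'I_r, (~~ col_place a k || (k == p0)) ==> (s k == k)].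
  have P1 : P 1%g by apply/forallP=> k; rewrite perm1 eqxx implybT.
  (* Minimal weight means that the leg has no descent; equal column letters make the entry vanish,
     so a nonzero entry has a strictly increasing leg. *)
  have [s Ps smin] := @arg_minnP _ 1%g P (fun s => weight (permute t' s)) P1.
  have Pfix (k : 'I_r) : ~~ col_place a k || (k == p0) -> s k = k.
    by move=> h; have /forallP/(_ k) := Ps; rewrite h => /eqP.
  set u := permute t' s in smin.
  have tu : entry v u = (-1) ^+ s * entry v t'.
    by apply: (entry_col_perm a1 rE) => // k nk; rewrite Pfix ?nk.
  suff u0 : entry v u = 0.
    by apply/eqP; move/eqP: u0; rewrite tu mulf_eq0 signr_eq0.
  apply/eqP; apply: contraTT isT => uN0.
  have uinj (k l : 'I_r) : col_place a k -> col_place a l -> u k = u l -> k = l.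
    move=> ck cl ukl; apply/eqP; apply: contraNT uN0 => kl.
    by rewrite (@entry_repeat _ _ _ _ _ a1 rE v u k l).
  have u00 : u p0 = 0%N :> nat by rewrite ffunE Pfix ?eqxx ?orbT.
  have ucol i : (i < m)%N -> letter u (a + i) != 0%N.
    move=> im; rewrite (letter_ord _ (col_ord rE im)); apply/eqP => e.
    have c1 : col_place a (Ordinal (col_ord rE im)) by rewrite /col_place /= leq_addr orbT.
    have e' : u (Ordinal (col_ord rE im)) = u p0 by apply: val_inj; rewrite /= u00 e.
    have /(congr1 val) /= := uinj _ p0 c1 isT e'.
    by move: a1; clear; lia.
  have usort : sorted ltn (mkseq (fun i => letter u (a + i)) m).
    apply/(sortedP 0%N) => i; rewrite size_mkseq => im; rewrite (nth_mkseq _ _ (ltnW im)) (nth_mkseq _ _ im).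
    have i1 := col_ord rE (ltnW im); have i2 := col_ord rE im.
    have ne : letter u (a + i) != letter u (a + i.+1).
      rewrite (letter_ord _ i1) (letter_ord _ i2); apply/eqP => /val_inj /uinj.
      by rewrite /col_place /= !leq_addr !orbT => /(_ isT isT)/(congr1 val) /= /eqP; rewrite eqn_add2l; clear; lia.
    suff: (letter u (a + i) < letter u (a + i.+1))%N by [].
    rewrite ltn_neqAle ne leqNgt.
    apply/negP => gt.
    pose k := Ordinal i1; pose l := Ordinal i2.
    have swp : permute u (tperm k l) = permute t' (tperm k l * s) by rewrite /u permuteM.
    have := smin (tperm k l * s)%g; rewrite -swp => h.
    have /h : P (tperm k l * s)%g.
      apply/forallP=> j; apply/implyP=> hj; rewrite permM.
      rewrite tpermD ?Pfix //.
        apply: contraTneq hj => <-; rewrite negb_or negbK /col_place /= leq_addr orbT /=.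
        by rewrite -val_eqE /=; move: a1; clear; lia.
      apply: contraTneq hj => <-; rewrite negb_or negbK /col_place /= leq_addr orbT /=.
      by rewrite -val_eqE /=; move: a1; clear; lia.
    apply/negP; rewrite -ltnNge.
    have -> : weight u = weight (permute (permute u (tperm k l)) (tperm k l)).
      by rewrite -permuteM tperm2 permute1.
    apply: (@weight_swap _ _ _ (a + i)%N); rewrite //= ?addnS //.
    rewrite /ascent -addnS (letter_ord _ i1) (letter_ord _ i2) !ffunE tpermL tpermR.
    by move: gt; rewrite (letter_ord _ i1) (letter_ord _ i2) !ffunE.
  have uw : orbit_of w u by rewrite orbit_permute.
  have ureads : col_reads u (mkseq (fun i => letter u (a + i)) m).
    by rewrite /col_reads eqxx letter_p0 u00.
  case/negP: uN0; rewrite -(coordE vN uw ureads); apply/eqP/vl => //.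
  - by apply/mapP=> -[i]; rewrite mem_iota /= => /ucol /eqP h e; apply: h.
  - by rewrite size_mkseq.
  move=> x /mapP[i]; rewrite mem_iota /= => im ->.
  rewrite -(orbit_mult _ uw); apply/card_gt0P; exists (Ordinal (col_ord rE im)).
  by rewrite inE -letter_ord.
have claim2 t' (c : 'I_r) : orbit_of w t' -> col_place a c -> t' c = 0%N :> nat -> entry v t' = 0.
  move=> tw' cc tc; have [cp|cp] := eqVneq c p0; first by apply: claim1; rewrite -?cp.
  apply/eqP; rewrite -oppr_eq0 -(@entry_tperm _ _ _ _ _ a1 rE v t' c p0) //.
  by rewrite claim1 ?orbit_permute // ffunE tpermR.
have : (0 < mult t 0)%N by rewrite (orbit_mult _ tw).
case/card_gt0P=> q; rewrite inE => /eqP tq.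
have [cq|nq] := boolP (col_place a q); first exact: claim2 tq.
rewrite (entry_garnir a1 rE _ vN nq) big1 // => c cc.
by apply: (claim2 _ c); rewrite ?orbit_permute // ffunE tpermL.
Qed.

(** Maximizing the weight over permutations of the first row sorts it decreasingly and moves its
    letter 0 to place a-1. *)
Lemma standard_exists (w t : word) : orbit_of w t -> letter t 0 = 0%N ->
  (forall i, (i.+1 < m)%N -> (letter t (a + i) < letter t (a + i.+1))%N) ->
  (forall i, (i < m)%N -> (0 < letter t (a + i))%N) ->
  exists u : word, [/\ standard a u, orbit_of w u, letter u a.-1 = 0%N &
    forall i, (i < m)%N -> letter u (a + i) = letter t (a + i)].
Proof.
move=> tw t0 tinc tpos.
pose P (s : 'S_r) := [forall k : 'I_r, (a <= k)%N ==> (s k == k)].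
have P1 : P 1%g by apply/forallP=> k; rewrite perm1 eqxx implybT.
have [s Ps smax] := @arg_maxnP _ 1%g P (fun s => weight (permute t s)) P1.
have Pfix (k : 'I_r) : (a <= k)%N -> s k = k.
  by move=> h; have /forallP/(_ k) := Ps; rewrite h => /eqP.
set u := permute t s in smax.
have ucol i : (i < m)%N -> letter u (a + i) = letter t (a + i).
  move=> im; rewrite !(letter_ord _ (col_ord rE im)) ffunE Pfix //=; exact: leq_addr.
have urow i : (i.+1 < a)%N -> ~~ ascent u i.
  move=> ia; apply/negP => asc.
  have i1 : (i < r)%N by move: rE ia; clear; lia.
  have i2 : (i.+1 < r)%N by move: rE ia; clear; lia.
  pose k := Ordinal i1; pose l := Ordinal i2.
  have := @weight_swap _ _ u i k l erefl erefl asc; rewrite ltnNge => /negP[].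
  rewrite /u -permuteM; apply: smax; apply/forallP=> j; apply/implyP=> aj.
  rewrite permM tpermD ?Pfix // -val_eqE /=; move: aj ia; clear; lia.
have uw : orbit_of w u by rewrite orbit_permute.
have udec d : forall i, (i + d < a)%N -> (letter u (i + d) <= letter u i)%N.
  elim: d => [|d IH] i ia; first by rewrite addn0.
  apply: leq_trans (IH i _); last by move: ia; clear; lia.
  by rewrite addnS leqNgt; apply: urow; rewrite -addnS.
have umin : letter u a.-1 = 0%N.
  pose k := (s^-1)%g p0; have sk : s k = p0 by rewrite permKV.
  have ka : (k < a)%N.
    rewrite ltnNge; apply/negP => ak; have := Pfix k ak; rewrite sk => e.
    by move: ak; rewrite -e /= leqNgt a0.
  apply/eqP; rewrite -leqn0; have -> : a.-1 = (k + (a.-1 - k))%N.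
    by rewrite subnKC // -ltnS prednK.
  apply: leq_trans (udec _ _ _) _; first by rewrite subnKC ?prednK // -ltnS prednK.
  by rewrite letterE ffunE sk -letter_p0 t0.
exists u; split=> // i ir; case: (leqP a i.+1) => ai; last exact/negbTE/urow.
have [ia|ia] := leqP a i.
  have -> : i = (a + (i - a))%N by rewrite subnKC.
  rewrite /ascent -addnS !ucol ?tinc //; move: ir rE ia; clear; lia.
have -> : i = a.-1 by move: ai ia; clear; lia.
have m0 : (0 < m)%N by move: ir rE ai ia; clear; lia.
by rewrite /ascent umin prednK // -[a]addn0 ucol // tpos.
Qed.

(** Witnesses of standard words are legitimate reading words, so the identity matrix found in
    [entry_witness] is the matrix of coordinates. *)
Lemma tab_coord_basis (w : word) l0 : letter w 0 = 0%N -> sorted ltn l0 ->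
  0%N \notin l0 -> size l0 = m -> {in l0, forall x, (0 < mult w x)%N} ->
  exists v, [/\ inN v, forall u, entry v u != 0 -> orbit_of w u &
    forall l, sorted ltn l -> 0%N \notin l -> size l = m ->
      coord w v l = (l == l0)%:R].
Proof.
move=> w0 l0s l00 sl0 l0w.
have std t l : orbit_of w t -> col_reads t l -> sorted ltn l -> 0%N \notin l -> size l = m ->
  exists u : word, [/\ standard a u, orbit_of w u, letter u a.-1 = 0%N &
    forall i, (i < m)%N -> letter u (a + i) = nth 0%N l i].
  move=> tw tl ls l_0 sl; have [t0 tc] := (col_readsP a _ sl) tl.
  have [i im|i im|u [us uw u0 uc]] := standard_exists tw t0.
  - by rewrite (tc i (ltnW im)) (tc _ im); apply: (elimT (sortedP 0%N) ls); rewrite sl.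
  - by rewrite tc // lt0n; apply: contraNneq l_0 => <-; rewrite mem_nth ?sl.
  by exists u; split=> // i im; rewrite uc // tc.
have witreads u l : letter u a.-1 = 0%N -> size l = m ->
    (forall i, (i < m)%N -> letter u (a + i) = nth 0%N l i) ->
    col_reads (witness a0 rE (rank_pos a1 rE) u) l.
  move=> u0 sl uc; apply/(col_readsP a _ sl); split=> [|i im].
    by rewrite letter_witness ?(rank_pos a1 rE).
  rewrite letter_witness ?(col_ord rE im) // uc //.
  have /negPf-> : (a + i)%N != 0%N by move: a1; clear; lia.
  by have /negPf-> : (a + i)%N != a.-1 by move: a1; clear; lia.
have [t0 t0w t0l] := reads_exists w0 sl0 (sorted_uniq ltn_trans ltnn l0s) l00 l0w.
have [u0 [u0s u0w u00 u0c]] := std _ _ t0w t0l l0s l00 sl0.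
exists (antisym *m run_sum K u0).
have vN : inN (antisym *m run_sum K u0).
  apply/(@weyl_hookP K n r a m a0 rE); exists (run_sum K u0) => //.
  apply: young_fixed_refine (@run_sum_fixed K n r u0) => k l.
  by rewrite /row_color !(run_standard a0 rE u0s).
split=> //.
  move=> u; rewrite entry_antisym; apply: contraR => nu; rewrite big1 // => s _.
  have [->|] := eqVneq (entry (run_sum K u0) (permute u s)) 0; first by rewrite mulr0.
  rewrite entry_vec; case: existsP => [[s' /andP[_ /eqP e]] _|]; last by rewrite eqxx.
  by case/negP: nu; rewrite -(orbit_permute _ _ s) e orbit_permute.
move=> l ls l_0 sl; case: (pickP (fun t => orbit_of w t && col_reads t l)) => [t /andP[tw tl]|h]; last first.
  rewrite /tab_coord; case: pickP => [t|_]; first by rewrite h.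
  case: eqP => // e; have := h t0; by rewrite t0w e t0l.
have [u [us uw u_0 uc]] := std _ _ tw tl ls l_0 sl.
rewrite (@coordE w _ (witness a0 rE (rank_pos a1 rE) u)) //; first last.
- exact: witreads.
- by rewrite orbit_permute.
rewrite entry_witness //; congr (_%:R); congr nat_of_bool.
apply/eqP/eqP => [e|e].
  apply: (@eq_from_nth _ 0%N) => [|i]; rewrite sl ?sl0 // => im.
  by rewrite -uc // -u0c // e.
subst l; have [|s u0E sfix] := @content_permute _ _ u u0.
  by move=> c; rewrite (orbit_mult _ uw) (orbit_mult _ u0w).
apply: (@run_sorted_uniq _ _ u u0 s) => // [k|k l kl].
  have sK (k' : 'I_r) : (a <= k')%N -> s k' = k'.
    move=> ak; apply: sfix; apply: val_inj; rewrite /= -!letterE.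
    have -> : k' = (a + (k' - a))%N :> nat by rewrite subnKC.
    by rewrite uc ?u0c //; move: (ltn_ord k') rE ak; clear; lia.
  rewrite !(run_standard a0 rE us) //; case: (leqP a k) => ak; first by rewrite sK.
  have : (s k < a)%N; last by move: ak; clear; lia.
  rewrite ltnNge; apply/negP => h; have /perm_inj e := sK _ h.
  by move: h; rewrite e leqNgt ak.
rewrite !(run_standard a0 rE us) // => e; rewrite -!letterE.
have [-> //|ne] := eqVneq (k : nat) l.
by apply: (standard_row a0 rE u0s); move: ne kl e; clear; lia.
Qed.

End CoordBasis.

Local Open Scope fset_scope.
Local Open Scope ring_scope.

(** * Cocycles on sets of marks *)

Section Marks.
Variables (b m : nat).
Implicit Types (S T : {fset nat}).

(* A standard hook tableau is recorded by the set of its m column entries other *)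
(* than the corner.                                                            *)
Definition marks d S := (#|` S| == m) && all (fun i => d <= i <= b)%N S.

Lemma marksP d S : reflect (#|` S| = m /\ forall i, i \in S -> (d <= i <= b)%N) (marks d S).
Proof.
apply: (iffP andP) => -[/eqP h1 h2]; split=> //; first exact/allP.
by apply/allP.
Qed.

Definition mv (i j : nat) (S : {fset nat}) := j |` (S `\ i).

Lemma mem_mv (i j : nat) S (x : nat) : (x \in mv i j S) = (x == j) || (x != i) && (x \in S).
Proof. by rewrite !inE. Qed.

Lemma mvK i j S : i \in S -> j \notin S -> mv j i (mv i j S) = S.
Proof.
move=> iS jS; apply/fsetP=> x; rewrite !mem_mv.
have [->|xi] := eqVneq x i; first by rewrite iS.
by have [->|xj] := eqVneq x j; rewrite ?(negPf jS) //= ?xi.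
Qed.

Lemma mvC i j i' j' S : i != j' -> i' != j -> j != j' -> i != i' -> mv i j (mv i' j' S) = mv i' j' (mv i j S).
Proof.
move=> h1 h2 h3 h4; apply/fsetP=> x; rewrite !mem_mv.
have [->|] := eqVneq x j; first by rewrite (negPf h3) /= andbT eq_sym h2.
move=> _; have [->|] := eqVneq x j'; first by rewrite /= andbT eq_sym h1.
by rewrite /= andbCA.
Qed.

Lemma mv_mv i j l S : j \notin S -> mv j l (mv i j S) = mv i l S.
Proof.
move=> jS; apply/fsetP=> x; rewrite !mem_mv; case: (x == l) => //=.
by have [->|] := eqVneq x j; rewrite ?(negPf jS) ?andbF.
Qed.

Lemma card_mv i j S : i \in S -> j \notin S -> #|` mv i j S| = #|` S|.
Proof.
move=> iS jS; rewrite /mv cardfsU1 !inE (negPf jS) andbF /=.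
by rewrite [in RHS](cardfsD1 i) iS.
Qed.

Lemma marks_mv d i j S : marks d S -> i \in S -> j \notin S -> (d <= j <= b)%N ->
  marks d (mv i j S).
Proof.
move=> /marksP[c h] iS jS db; apply/marksP; rewrite card_mv //; split=> // x.
by rewrite mem_mv => /predU1P[->//|/andP[_ /h]].
Qed.

Lemma marksW d d' S : (d' <= d)%N -> marks d S -> marks d' S.
Proof.
move=> dd /marksP[c h]; apply/marksP; split=> // x /h /andP[dx ->].
by rewrite (leq_trans dd).
Qed.

Lemma mark_range d S i : marks d S -> i \in S -> (d <= i <= b)%N.
Proof. by case/marksP=> _; apply. Qed.

Lemma marks_notin d S i : marks d S -> (i < d)%N -> i \notin S.
Proof. by move=> vS id; apply/negP => /(mark_range vS); lia. Qed.

Definition msum S : nat := (\sum_(s <- S) s)%N.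

Lemma sum_mv (V : nmodType) (F : nat -> V) i j S : i \in S -> j \notin S ->
  \sum_(s <- mv i j S) F s = F j + \sum_(s <- S `\ i) F s.
Proof. by move=> iS jS; rewrite /mv big_fsetU1 //= !inE (negPf jS) andbF. Qed.

Lemma msum_mv i j S : i \in S -> j \notin S -> (msum (mv i j S) + i = msum S + j)%N.
Proof.
move=> iS jS; rewrite /msum /mv big_fsetU1 /=; last by rewrite !inE (negPf jS) andbF.
by rewrite [in RHS](big_fsetD1 i) //= -addnA addnC [(_ + i)%N]addnC.
Qed.

(** Unmarked letters stand in the arm; this count turns out to be all that a normalized cocycle sees
    of the marks. *)
Definition unmarked S i : nat := (\sum_(1 <= l < i.+1) (l \notin S))%N.

Lemma unmarked0 S : unmarked S 0 = 0%N. Proof. by rewrite /unmarked big_geq. Qed.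
Lemma unmarkedS S i : unmarked S i.+1 = (unmarked S i + (i.+1 \notin S))%N.
Proof. by rewrite /unmarked big_nat_recr. Qed.

Lemma unmarked_mv i j l S : i \in S -> j \notin S -> (0 < i)%N -> (0 < j)%N ->
  (unmarked (mv i j S) l + (j <= l) = unmarked S l + (i <= l))%N.
Proof.
move=> iS jS i0 j0; elim: l => [|l IH].
  by rewrite !unmarked0 (leqNgt i) (leqNgt j) i0 j0.
have leS x : ((x <= l.+1)%N : nat) = ((x == l.+1) + (x <= l)%N)%N by clear; lia.
rewrite !unmarkedS !leS mem_mv negb_or.
have [e|ne] := eqVneq j l.+1.
  have lS : l.+1 \notin S by rewrite -e.
  have /negPf-> : i != l.+1 by apply: contraNneq lS => <-.
  by rewrite lS /=; move: IH; clear; lia.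
have [e|ne'] := eqVneq i l.+1.
  by rewrite -e iS /=; move: IH; clear; lia.
by rewrite /=; move: IH; case: (l.+1 \in S) => /=; clear; lia.
Qed.

Lemma unmarked_mono S i j : (i <= j)%N -> (unmarked S i <= unmarked S j)%N.
Proof.
elim: j => [|j IH]; first by rewrite leqn0 => /eqP->.
by rewrite leq_eqVlt ltnS => /predU1P[-> //|/IH]; rewrite unmarkedS; lia.
Qed.

Lemma unmarked_total S : marks 1 S -> (unmarked S b + m = b)%N.
Proof.
move=> /marksP[<- h].
have -> : #|` S| = (\sum_(1 <= l < b.+1) (l \in S))%N.
  rewrite -sum1_size -[RHS]big_mkcond /= -[RHS]big_filter.
  apply: perm_big; apply: uniq_perm; rewrite ?fset_uniq ?filter_uniq ?iota_uniq // => x.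
  rewrite mem_filter mem_index_iota ltnS; apply/idP/andP => [xS|[]//].
  by split=> //; apply: h.
rewrite /unmarked -big_split /= -[RHS]subn0 -[b in RHS]/(b.+1.-1).
rewrite (eq_bigr (fun _ => 1%N)) => [|i _]; last by case: (i \in S).
by rewrite sum_nat_const_nat muln1; lia.
Qed.

Definition first_marks d : {fset nat} := [fset i in iota d m].

Lemma mem_first d i : (i \in first_marks d) = (d <= i < d + m)%N.
Proof. by rewrite !inE mem_iota. Qed.

Lemma card_first d : #|` first_marks d| = m.
Proof. by rewrite card_fseq undup_id ?iota_uniq // size_iota. Qed.

Lemma marks_first d : (d + m <= b.+1)%N -> marks d (first_marks d).
Proof.
move=> db; apply/marksP; split; first exact: card_first.
by move=> i; rewrite mem_first; lia.
Qed.

Lemma marks_descent d S : (0 < d)%N -> marks d S -> S != first_marks d ->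
  exists s, [/\ s \in S, (d < s)%N & s.-1 \notin S].
Proof.
move=> d0 /marksP[c h] ne.
case: (boolP (has (fun s => (d < s)%N && (s.-1 \notin S)) S)) => [/hasP[s sS /andP[ds nS]]|].
  by exists s.
move/hasPn=> cl; case/eqP: ne; apply/eqP; rewrite eqEfcard card_first c leqnn andbT.
have down j s : s \in S -> (d <= s - j)%N -> (s - j)%N \in S.
  elim: j => [|j IH] sS; first by rewrite subn0.
  move=> dj; have : (s - j)%N \in S by apply: IH => //; lia.
  move/cl; rewrite negb_and negbK subnS => /orP[|//].
  by move: d0 dj; clear; lia.
apply/fsubsetP=> s sS; rewrite mem_first; have /andP[ds _] := h s sS; rewrite ds /=.
rewrite ltnNge; apply/negP => ms.
have sub : [fset i in iota d m.+1] `<=` S.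
  apply/fsubsetP=> i; rewrite !inE mem_iota.
  move=> h'; have /andP[di im] : (d <= i < d + m.+1)%N by move: h'; clear; lia.
  have -> : i = (s - (s - i))%N by move: ms im; clear; lia.
  by apply: down => //; move: ms im di; clear; lia.
have := fsubset_leq_card sub.
by rewrite card_fseq undup_id ?iota_uniq // size_iota c ltnn.
Qed.

(** Induction on the sum of the marks: unless they are packed to the left, some mark can slide one
    step down. *)
Lemma marks_ind d (P : {fset nat} -> Prop) :
  (0 < d)%N ->
  (marks d (first_marks d) -> P (first_marks d)) ->
  (forall S s, marks d S -> s \in S -> (d < s)%N -> s.-1 \notin S ->
     (forall T, marks d T -> (msum T < msum S)%N -> P T) -> P S) ->
  forall S, marks d S -> P S.
Proof.
move=> d0 P0 PS S; elim: {S}_.+1 {-2}S (ltnSn (msum S)) => // N IH S SN vS.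
have [e|ne] := eqVneq S (first_marks d); first by rewrite e in vS *; apply: P0.
have [s [sS ds ns]] := marks_descent d0 vS ne.
by apply: (PS S s) => // T vT TS; apply: IH => //; apply: leq_trans TS _.
Qed.

End Marks.

Section MarkedComplex.
Variables (K : fieldType) (a b m : nat).
Implicit Types (S T : {fset nat}) (X : nat -> {fset nat} -> K) (Y y : {fset nat} -> K).
Local Notation marks := (marks b m).
Local Notation first := (first_marks m).
Local Notation U := unmarked.
Local Notation k := (b - m)%N.
Hypothesis mb : (m < b)%N.

(** Fusing the letters i and i+1 of multiplicity one, for i+1 not in S: if both are in the arm there
    are 2 choices of the place to relabel; if i is in the leg, the two choices are the tableau
    itself and its neighbour, with opposite signs. *)
Definition fuse_marks i Y S : K :=
  if i \in S then Y S - Y (mv i i.+1 S) else 2%:R * Y S.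

(** Fusing the letter 1 into the [a] letters 0: there are a+1 places to choose from, and the sum is
    the Garnir correction for choosing the corner. *)
Definition fuse_top Y S : K :=
  (a.+1)%:R * Y S - \sum_(s <- S) (-1) ^+ U S s * Y (mv s 1 S).

(* X j gives the coordinates of the j-th component; there is one equation for   *)
(* each pair i < j: far pairs and near pairs with 0 < i, pairs (0, j) with      *)
(* 1 < j, and the pair (0, 1).                                                 *)
Record marked_cocycle X : Prop := MarkedCocycle {
  mc_far : forall i j S, (0 < i)%N -> (i.+1 < j < b)%N -> marks 1 S ->
    i.+1 \notin S -> j.+1 \notin S -> fuse_marks i (X j) S = fuse_marks j (X i) S;
  mc_near : forall i S, (0 < i)%N -> (i.+1 < b)%N -> marks 1 S ->
    i.+1 \notin S -> i.+2 \notin S ->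
    (if i \in S then 2%:R * X i S + X i (mv i i.+2 S) else 3%:R * X i S) =
    (if i \in S then X i.+1 S - 2%:R * X i.+1 (mv i i.+1 S) else 3%:R * X i.+1 S);
  mc_top : forall j S, (1 < j < b)%N -> marks 2 S -> j.+1 \notin S ->
    fuse_top (X j) S = fuse_marks j (X 0%N) S;
  mc_corner : forall S, (1 < b)%N -> marks 3 S ->
    (a.+2)%:R * X 0%N S + \sum_(s <- S) (-1) ^+ U S s * X 0%N (mv s 2 S) =
    ('C(a.+2, 2))%:R * X 1%N S -
      (a.+1)%:R * \sum_(s <- S) (-1) ^+ U S s * X 1%N (mv s 1 S)
}.

(* The squares of commuting mark moves make the edge values a potential.      *)
Lemma potential X : marked_cocycle X -> exists y, forall j S, (0 < j < b)%N ->
  marks 1 S -> j \in S -> j.+1 \notin S -> X j S = y S - y (mv j j.+1 S).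
Proof.
move=> [far _ _ _].
suff gen N : exists y, forall j S, (0 < j < b)%N -> marks 1 S -> j \in S ->
    j.+1 \notin S -> (msum S < N)%N -> X j S = y S - y (mv j j.+1 S).
  have [y yE] := gen (b * m).+1; exists y => j S jb vS jS j1S; apply: yE => //.
  rewrite ltnS; have [c h] := marksP _ _ _ _ vS.
  rewrite -c -sum1_size big_distrr /= /msum !big_seq.
  by apply: leq_sum => i /h; lia.
elim: N => [|N [y yE]]; first by exists (fun _ => 0).
(* The potential is extended level by level in the sum of the marks, its value at T being dictated
   by one admissible move into T. The rest of the proof checks that any other move dictates the same
   value. *)
pose e T := ohead [seq s <- T | (1 < s)%N && (s.-1 \notin T)].
pose y' T := if msum T == N.+1 then
  (if e T is Some s then y (mv s s.-1 T) - X s.-1 (mv s s.-1 T) else 0) else y T.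
exists y' => j S jb vS jS j1S; rewrite ltnS => SN.
have j0 : (0 < j)%N by case/andP: jb.
have mT : msum (mv j j.+1 S) = (msum S).+1 by have := msum_mv jS j1S; lia.
rewrite /y' mT eqSS; have /negPf-> : msum S != N.+1 by rewrite neq_ltn ltnS SN.
have [eN|ne] := eqVneq (msum S) N; last by apply: yE => //; rewrite ltn_neqAle ne.
set T := mv j j.+1 S.
have jT : j \notin T by rewrite mem_mv eqxx orbF ltn_eqF.
have j1T : j.+1 \in T by rewrite mem_mv eqxx.
have : j.+1 \in [seq s <- T | (1 < s)%N && (s.-1 \notin T)] by rewrite mem_filter /= ltnS j0 jT.
rewrite /e; case E : [seq s <- T | _] => [//|s l] _ /=.
have : s \in [seq s <- T | (1 < s)%N && (s.-1 \notin T)] by rewrite E mem_head.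
rewrite mem_filter => /andP[/andP[s1 s1T] sT].
have vT : marks 1 T by apply: marks_mv => //; move: jb; clear; lia.
case: s s1 s1T sT {E} => // i; rewrite ltnS /= => i0 iT i1T.
have [[es]|nes] := eqVneq i.+1 j.+1.
  by rewrite es mvK // opprB addrCA subrr addr0.
have ij : i != j by apply: contra_neq nes => ->.
have i1S : i.+1 \in S by move: i1T; rewrite mem_mv (negPf nes) /= => /andP[].
have i1j : i.+1 != j by apply: contraNneq jT => <-.
have iS : i \notin S.
  by move: iT; rewrite mem_mv negb_or negb_and negbK (negPf ij) => /andP[].
have ij1 : i != j.+1 by apply: contraNneq iT => ->.
(* The lower corner of the square. The vacancies below both moving marks of T force the two moves to
   be far apart, so only far equations are used. *)
pose Q := mv i.+1 i S.
have ib : (1 <= i.+1 <= b)%N := mark_range vS i1S.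
have vQ : marks 1 Q by apply: marks_mv => //; move: ib i0; clear; lia.
have jQ : j \in Q by rewrite mem_mv jS [j == i.+1]eq_sym i1j orbT.
have j1Q : j.+1 \notin Q.
  by rewrite mem_mv negb_or eq_sym ij1 negb_and j1S orbT.
have iQ : i \in Q by rewrite mem_mv eqxx.
have i1Q : i.+1 \notin Q by rewrite mem_mv eqxx orbF eqn_leq ltnn.
have S'E : mv i.+1 i T = mv j j.+1 Q by rewrite /T /Q mvC // eq_sym.
have QS : mv i i.+1 Q = S by rewrite mvK.
have mQ : (msum Q < N)%N by have := msum_mv i1S iS; rewrite -/Q eN; clear; lia.
have e1 : X j Q = y Q - y (mv j j.+1 Q) by apply: yE.
have ib' : (0 < i < b)%N by move: ib i0; clear; lia.
have e2 : X i Q = y Q - y S by rewrite -[in RHS]QS; apply: yE.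
have sq : X j Q - X j S = X i Q - X i (mv i.+1 i T).
  rewrite S'E -[in LHS]QS; have [lt|ge] := ltnP i j.
    have := far i j Q; rewrite /fuse_marks iQ jQ; apply=> //.
    by move: lt i1j jb; clear; lia.
  have := far j i Q; rewrite /fuse_marks iQ jQ => -> //.
  by move: ge ij ij1 ib'; clear; lia.
have -> : X j S = X j Q - X i Q + X i (mv i.+1 i T).
  by rewrite -[X j S](subKr (X j Q)) sq opprB addrA addrAC.
by rewrite e1 e2 S'E; ring.
Qed.

(** A discrete primitive: the top equations say that letting a mark pass the unmarked letter number
    q+1 changes component 0 by (-1)^q z_q, and [gz] sums these changes. *)
Definition gz (z : nat -> K) q : K := - \sum_(1 <= i < q) (-1) ^+ i * z i.

Lemma gz1 z : gz z 1 = 0. Proof. by rewrite /gz big_geq ?oppr0. Qed.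
Lemma gzS z q : (0 < q)%N -> gz z q.+1 = gz z q - (-1) ^+ q * z q.
Proof. by move=> q0; rewrite /gz big_nat_recr //= opprD. Qed.
Lemma gz2 z : gz z 2 = z 1%N.
Proof. by rewrite gzS // gz1 sub0r expr1 mulN1r opprK. Qed.

(* Normal form of a cocycle whose values vanish whenever j is marked.          *)
Definition param_marks z j S : K :=
  if j == 0%N then z 0%N - \sum_(s <- S) gz z (U S s)
  else if j \in S then 0 else z (U S j).

Lemma unmarked_pos d S j : marks d S -> (1 < d)%N -> (0 < j)%N -> (0 < U S j)%N.
Proof.
move=> vS d1 j0; apply: leq_trans (unmarked_mono S j0).
by rewrite unmarkedS unmarked0 (marks_notin vS d1).
Qed.

Lemma unmarked_lt S j : marks 1 S -> (j < b)%N -> j.+1 \notin S -> (U S j < k)%N.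
Proof.
move=> vS jb nj; have := unmarked_total vS; have := unmarked_mono S jb.
by rewrite unmarkedS nj; clear; lia.
Qed.

(** Only the moving mark changes its number of unmarked letters, by one. *)
Lemma sum_gz_mv z S j : (0 < j)%N -> (0 < U S j)%N -> j \in S -> j.+1 \notin S ->
  \sum_(s <- mv j j.+1 S) gz z (U (mv j j.+1 S) s) =
  \sum_(s <- S) gz z (U S s) - (-1) ^+ U S j * z (U S j).
Proof.
move=> j0 q0 jS nj; rewrite sum_mv // [in RHS](big_fsetD1 j) //=.
have -> : U (mv j j.+1 S) j.+1 = (U S j).+1.
  by have := unmarked_mv j.+1 jS nj j0 (ltn0Sn _); rewrite (unmarkedS S) nj leqnn leqnSn; clear; lia.
rewrite gzS // -addrA [in RHS]addrAC -[in RHS]addrA; congr (_ + _).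
congr (_ + _); rewrite !big_seq; apply: eq_bigr => s.
rewrite !inE => /andP[sj sS]; congr (gz z _).
have sj1 : s != j.+1 by apply: contraNneq nj => <-.
by have := unmarked_mv s jS nj j0 (ltn0Sn _); move: sj sj1; clear; lia.
Qed.

Lemma fuse_top_single (F : {fset nat} -> K) S j : j \in S -> F S = 0 ->
  (forall t, t \in S -> t != j -> F (mv t 1 S) = 0) ->
  fuse_top F S = - ((-1) ^+ U S j * F (mv j 1 S)).
Proof.
move=> jS F0 Ft; rewrite /fuse_top F0 mulr0 sub0r (big_fsetD1 j) //=.
rewrite big_seq big1 ?addr0 // => t; rewrite !inE => /andP[tj tS].
by rewrite Ft ?mulr0.
Qed.

Lemma mark1_mv S t : marks 2 S -> t \in S -> marks 1 (mv t 1 S).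
Proof.
move=> vS tS; apply: (marks_mv (marksW _ vS) tS) => //; first exact: marks_notin vS _.
by have := mark_range vS tS; clear; lia.
Qed.

Lemma unmarked_mv1 S t j : marks 2 S -> t \in S -> (0 < j)%N ->
  (U (mv t 1 S) j + 1 = U S j + (t <= j))%N.
Proof.
move=> vS tS j0; have t0 : (0 < t)%N by have := mark_range vS tS; clear; lia.
by have := unmarked_mv j tS (marks_notin vS (ltnSn 1)) t0 isT; rewrite j0.
Qed.

Record param_rel (z : nat -> K) : Prop := ParamRel {
  pr_far : forall i j, (0 < i)%N -> (i.+1 < j < k)%N -> 2%:R * z i = 2%:R * z j;
  pr_near : forall i, (0 < i)%N -> (i.+1 < k)%N -> 3%:R * z i = 3%:R * z i.+1;
  pr_top : forall j, (1 < j < k)%N -> 2%:R * z 0%N = (a + m).+1%:R * z j;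
  pr_corner : (1 < k)%N -> (a + m).+2%:R * z 0%N = ('C((a + m).+2, 2))%:R * z 1%N
}.

Lemma first_gz z : \sum_(s <- first 2) gz z (U (first 2) s) = 0.
Proof.
rewrite big_seq big1 // => s; rewrite mem_first => /andP[s2 sm].
suff -> : U (first 2) s = 1%N by rewrite gz1.
elim: s s2 sm => // s IH; rewrite ltnS leq_eqVlt unmarkedS mem_first => /predU1P[<-|s1] sm.
  by rewrite unmarkedS unmarked0 mem_first sm.
by rewrite IH ?s1 ?(ltnW sm) // sm ltnS (ltnW s1).
Qed.

(** * Cocycles vanishing along mark moves are determined by their parameters *)

Section Normalized.
Variable X : nat -> {fset nat} -> K.
Hypotheses (Xc : marked_cocycle X) (Xe : forall j S, (0 < j < b)%N -> marks 1 S ->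
  j \in S -> j.+1 \notin S -> X j S = 0).

(** Read off with the marks packed to the left. Component 0 needs the letter 1 unmarked and starts
    at 2; behind the marks 1, ..., m, exactly al unmarked letters lie in 1, ..., m+al. *)
Definition cocycle_param al : K :=
  if al == 0%N then X 0%N (first 2) else X (m + al)%N (first 1).
Local Notation z := cocycle_param.

(** Marks slide to the left without changing the value: far from the pair by a far equation, and
    across the pair by a near equation, which shifts the component. *)
Lemma normalized_pair S : marks 1 S -> forall j, (0 < j < b)%N -> j \notin S ->
  j.+1 \notin S -> X j S = z (U S j).
Proof.
move: S; apply: (@marks_ind b m 1 _ isT).
  move=> v1 j /andP[j0 jb] nj nj1; move: nj; rewrite mem_first => nj.
  have mj : (m < j)%N by move: nj j0; clear; lia.
  have uj : (U (first 1) j + m = j)%N.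
    elim: j mj {j0 jb nj nj1} => // j IH; rewrite ltnS leq_eqVlt unmarkedS mem_first => /predU1P[<-|mj].
      have : U (first 1) m = 0%N.
        by rewrite /unmarked big_nat big1 // => i im; rewrite mem_first add1n im.
      by move=> ->; clear; lia.
    by have := IH mj; move: mj; clear; lia.
  rewrite /z; have -> : (U (first 1) j == 0%N) = false by move: uj mj; clear; lia.
  by congr (X _ _); rewrite addnC.
move=> S s vS sS s1 ns IH j jb nj nj1.
case: s sS s1 ns => // i iS i0 ns /=; rewrite /= in ns; rewrite ltnS in i0.
have rng := mark_range vS iS.
have v1 : marks 1 (mv i.+1 i S) by apply: marks_mv => //; move: rng i0; clear; lia.
have i1j : i.+1 != j by apply: contraNneq nj => <-.
have ij : i != j by apply: contraNneq nj1 => <-.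
(* The mark at j+2 jumps over the pair to j; the near equation at T then equates component j at S
   with component j+1 at T, its remaining terms vanishing by normalization. *)
have [ij2|ij2] := eqVneq i j.+1.
  subst i; have j0 : (0 < j)%N by case/andP: jb.
  pose T := mv j.+2 j S.
  have vT : marks 1 T by apply: marks_mv => //; move: rng j0; clear; lia.
  have jT : j \in T by rewrite mem_mv eqxx.
  have nT1 : j.+1 \notin T by rewrite mem_mv negb_or negb_and nj1 orbT andbT; clear; lia.
  have nT2 : j.+2 \notin T by rewrite mem_mv negb_or negb_and eqxx andbT; clear; lia.
  have j2b : (j.+1 < b)%N by move: rng; clear; lia.
  have := mc_near Xc j0 j2b vT nT1 nT2; rewrite jT.
  rewrite (Xe jb vT jT nT1) mulr0 add0r mvK //.
  have -> : X j.+1 (mv j j.+1 T) = 0.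
    apply: Xe; [by rewrite j2b| |by rewrite mem_mv eqxx|].
      by apply: marks_mv => //; move: j2b; clear; lia.
    by rewrite mem_mv negb_or negb_and nT2 orbT andbT; clear; lia.
  rewrite mulr0 subr0 => ->; rewrite IH //; last by have := msum_mv iS nj; rewrite -/T; clear; lia.
  have := unmarked_mv j.+1 iS nj isT j0; rewrite -/T (unmarkedS S) nj1 leqnSn.
  by move=> e; congr z; move: e; clear; lia.
have nS1 : i.+1 \notin mv i.+1 i S by rewrite mem_mv eqxx orbF; clear; lia.
have iS1 : i \in mv i.+1 i S by rewrite mem_mv eqxx.
have njm : j \notin mv i.+1 i S by rewrite mem_mv negb_or eq_sym ij negb_and nj orbT.
have njm1 : j.+1 \notin mv i.+1 i S by rewrite mem_mv negb_or eq_sym ij2 negb_and nj1 orbT.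
have ib : (0 < i < b)%N by move: rng i0; clear; lia.
have j0 : (0 < j)%N by case/andP: jb.
have e : X j (mv i.+1 i S) = X j S.
  apply/eqP; rewrite -subr_eq0; apply/eqP.
  have xi : X i (mv i.+1 i S) = 0 by apply: Xe.
  have [lt|ge] := ltnP i j.
    have := mc_far Xc i0 (j := j) _ v1 nS1 njm1; rewrite /fuse_marks iS1 (negPf njm) mvK //.
    by rewrite xi mulr0; apply; move: lt i1j jb; clear; lia.
  have := mc_far Xc j0 (j := i) _ v1 njm1 nS1; rewrite /fuse_marks iS1 (negPf njm) mvK //.
  by rewrite xi mulr0 => <- //; move: ge ij ij2 ib; clear; lia.
rewrite -e IH //; last by have := msum_mv iS ns; clear; lia.
have := unmarked_mv j iS ns isT i0; move: ij i1j => ij i1j e'; congr z.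
by move: e' ij i1j; clear; lia.
Qed.

Lemma normalized_value S j : (0 < j < b)%N -> marks 1 S -> j.+1 \notin S ->
  X j S = param_marks z j S.
Proof.
move=> jb vS nj; rewrite /param_marks; have /andP[/lt0n_neq0/negPf-> _] := jb.
by case: ifP => jS; [apply: Xe|apply: normalized_pair; rewrite ?jS].
Qed.

(** With j marked, a single term survives on the left of the top equation, which becomes the change
    of component 0 along one move. *)
Lemma normalized_top S : marks 2 S -> X 0%N S = param_marks z 0 S.
Proof.
rewrite /param_marks eqxx; move: S; apply: (@marks_ind b m 2 _ isT).
  by move=> _; rewrite first_gz // subr0.
move=> S s vS sS s2 ns IH; case: s sS s2 ns => // j jS; rewrite ltnS /= => j1 nj.
have j0 : (0 < j)%N := ltnW j1.
have rng := mark_range vS jS.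
have vT : marks 2 (mv j.+1 j S) by apply: marks_mv => //; move: rng j1; clear; lia.
set T := mv j.+1 j S in vT *.
have jT : j \in T by rewrite mem_mv eqxx.
have nT : j.+1 \notin T by rewrite mem_mv eqxx orbF; clear; lia.
have v1T : marks 1 T by apply: marksW vT.
have jb : (0 < j < b)%N by move: rng j0; clear; lia.
have jb1 : (1 < j < b)%N by move: rng j1; clear; lia.
have ST : mv j j.+1 T = S by rewrite mvK.
have mv1 t : t \in T -> j.+1 \notin mv t 1 T.
  by move=> tT; rewrite mem_mv negb_or negb_and nT orbT andbT; move: j0; clear; lia.
have := mc_top Xc jb1 vT nT; rewrite /fuse_marks jT ST.
rewrite (fuse_top_single jT) => [|| t tT tj]; last 2 first.
- exact: Xe.
- apply: Xe => //; [exact: mark1_mv|by rewrite mem_mv jT [j == t]eq_sym tj orbT|exact: mv1].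
have nj1 : j \notin mv j 1 T by rewrite mem_mv eqxx orbF; move: j1; clear; lia.
rewrite (normalized_pair (mark1_mv vT jT) jb nj1 (mv1 _ jT)).
have -> : U (mv j 1 T) j = U T j by have := unmarked_mv1 vT jT j0; rewrite leqnn => /addIn.
have q0 : (0 < U T j)%N by apply: (unmarked_pos vT).
rewrite IH //; last by have := msum_mv jS nj; rewrite -/T; clear; lia.
have := sum_gz_mv z j0 q0 jT nT; rewrite ST => -> e.
apply/eqP; rewrite -subr_eq0; apply/eqP.
set x := X 0%N S in e *; set g := \sum_(s <- T) _ in e *; set y := _ * z _ in e *.
by rewrite -[x]opprK -[- x](addKr (z 0%N - g)) -e; ring.
Qed.

End Normalized.

Lemma unmarked_first d j : (0 < d)%N -> U (first d) j = (j - minn m (j - d.-1))%N.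
Proof.
move=> d0; elim: j => [|j IH]; first by rewrite unmarked0.
by rewrite unmarkedS IH mem_first; move: d0; clear; lia.
Qed.

Lemma sum_const_marks d S (c : K) : marks d S -> \sum_(s <- S) c = m%:R * c.
Proof.
by case/marksP=> <- _; rewrite big_const_seq count_predT iter_addr_0 mulr_natl.
Qed.

Lemma sum_first d (F : nat -> K) : \sum_(s <- first d) F s = \sum_(0 <= i < m) F (d + i)%N.
Proof.
transitivity (\sum_(s <- iota d m) F s).
  apply: perm_big; apply: uniq_perm; rewrite ?fset_uniq ?iota_uniq // => x.
  by rewrite mem_first mem_iota.
by rewrite -[d in iota d]addn0 iotaDl big_map /index_iota subn0.
Qed.

Lemma sum_below : \sum_(0 <= i < m) \sum_(0 <= j < m) ((i < j)%N)%:R = ('C(m, 2))%:R :> K.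
Proof.
rewrite exchange_big_nat /= -bin2_sum natr_sum; apply: eq_big_nat => j /andP[_ jm].
rewrite -natr_sum; congr (_%:R).
have low : (\sum_(0 <= i < j) (i < j) = j)%N.
  rewrite big_nat (eq_bigr (fun _ => 1%N)) => [|i ij].
    by rewrite -big_nat sum_nat_const_nat subn0 muln1.
  by have -> : (i < j)%N by move: ij; clear; lia.
have high : (\sum_(j <= i < m) (i < j) = 0)%N.
  rewrite big_nat big1 // => i ij.
  by have -> : (i < j)%N = false by move: ij; clear; lia.
by rewrite (@big_cat_nat _ _ _ j) ?(ltnW jm) //= low high addn0.
Qed.

(** For the marks 3, ..., m+2 all counts are 2. Moving s to 2 lowers the count of the marks below s
    to 1 and leaves those above at 2, so the pairs of marks produce the binomial coefficient of
    m. *)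
Lemma corner_first z : (1 < k)%N ->
  (a.+2)%:R * param_marks z 0 (first 3) +
    \sum_(s <- first 3) (-1) ^+ U (first 3) s * param_marks z 0 (mv s 2 (first 3)) =
  (a + m).+2%:R * z 0%N - ((a.+2) * m + 'C(m, 2))%:R * z 1%N.
Proof.
move=> k1; set S := first 3.
have vS : marks 3 S by apply: marks_first; move: k1; clear; lia.
have uS s : s \in S -> U S s = 2%N.
  by rewrite mem_first unmarked_first //; clear; lia.
have n2 : 2%N \notin S by rewrite mem_first.
have -> : param_marks z 0 S = z 0%N - m%:R * z 1%N.
  rewrite /param_marks /= -(sum_const_marks (z 1%N) vS); congr (_ - _).
  by rewrite !big_seq; apply: eq_bigr => s /uS->; rewrite gz2.
have -> : \sum_(s <- S) (-1) ^+ U S s * param_marks z 0 (mv s 2 S) =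
    m%:R * z 0%N - ('C(m, 2))%:R * z 1%N.
  rewrite -(sum_const_marks (z 0%N) vS) -sum_below mulr_suml.
  rewrite -(sum_first 3 (fun s => (\sum_(0 <= j < m) (s < 3 + j)%N%:R) * z 1%N)) -sumrB.
  rewrite !big_seq; apply: eq_bigr => s sS; rewrite uS // sqrrN expr1n mul1r.
  rewrite /param_marks /=; congr (_ - _).
  have s0 : (0 < s)%N by move: sS; rewrite mem_first; clear; lia.
  rewrite sum_mv // -(sum_first 3 (fun j => (s < j)%N%:R)) mulr_suml.
  rewrite [in RHS](big_fsetD1 s) //= ltnn mul0r; congr (_ + _).
    have -> : U (mv s 2 S) 2 = 1%N.
      have := unmarked_mv 2 sS n2 s0 isT; rewrite (unmarked_first 2 (isT : 0 < 3)%N).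
      by move: sS; rewrite mem_first; clear; lia.
    exact: gz1.
  rewrite !big_seq; apply: eq_bigr => t; rewrite in_fsetD1 => /andP[ts tS].
  have ut := uS t tS; have := unmarked_mv t sS n2 s0 isT; rewrite ut.
  have -> : (2 <= t)%N by move: tS; rewrite mem_first; clear; lia.
  rewrite leq_eqVlt [s == t]eq_sym (negPf ts) /=.
  case: (s < t)%N => /= e.
    have -> : U (mv s 2 S) t = 2%N by move: e; clear; lia.
    by rewrite gz2 mul1r.
  have -> : U (mv s 2 S) t = 1%N by move: e; clear; lia.
  by rewrite gz1 mul0r.
have -> : ((a + m).+2%:R : K) = a.+2%:R + m%:R by rewrite -natrD.
by rewrite natrD natrM; ring.
Qed.

Lemma bin2D (x y : nat) : 'C(x + y, 2) = ('C(x, 2) + x * y + 'C(y, 2))%N.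
Proof.
elim: y => [|y IH]; first by rewrite muln0 !addn0.
by rewrite addnS !binS !bin1 IH; lia.
Qed.

Lemma param_edge z j S : (0 < j)%N -> j \in S -> param_marks z j S = 0.
Proof. by move=> j0 jS; rewrite /param_marks jS; case: eqP j0 => // ->. Qed.

Lemma param_pair z j S : (0 < j)%N -> j \notin S -> param_marks z j S = z (U S j).
Proof. by move=> j0 /negPf jS; rewrite /param_marks jS; case: eqP j0 => // ->. Qed.

Lemma corner_param z S : (1 < b)%N -> marks 3 S ->
  ('C(a.+2, 2))%:R * param_marks z 1 S -
      (a.+1)%:R * \sum_(s <- S) (-1) ^+ U S s * param_marks z 1 (mv s 1 S) =
  ('C(a.+2, 2))%:R * z 1%N.
Proof.
move=> b1 vS; rewrite param_pair ?(marks_notin vS) //.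
rewrite unmarkedS unmarked0 (marks_notin vS) //= big_seq big1 ?mulr0 ?subr0 // => s sS.
by rewrite param_edge ?mulr0 // mem_mv eqxx.
Qed.

(** * Sufficient conditions for parameters to define a cocycle *)

Section ParamCocycle.
Variable z : nat -> K.
Hypothesis zr : param_rel z.
(** The top equation at an unmarked pair, imposed on each mark separately: [be] counts the unmarked
    letters up to the pair and [q] those up to the mark. Moving a mark to 1 from beyond the pair
    lowers the pair's count by one, whence [be.-1]. *)
Hypothesis z_compat : forall be q, (1 < be < k)%N -> (0 < q <= k)%N ->
  ((q < be)%N -> 2%:R * gz z q = z be + (-1) ^+ q * z be) /\
  ((be < q)%N -> 2%:R * gz z q = z be + (-1) ^+ q * z be.-1).
Local Notation Phi := (param_marks z).

Lemma param_top_edge j S : (1 < j < b)%N -> marks 2 S -> j \in S -> j.+1 \notin S ->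
  Phi 0 S - Phi 0 (mv j j.+1 S) = - ((-1) ^+ U S j * z (U S j)).
Proof.
move=> /andP[j1 jb] vS jS nj; rewrite /param_marks /= sum_gz_mv //; first by ring.
  exact: ltnW.
by apply: (unmarked_pos vS) => //; apply: ltnW.
Qed.

Lemma param_mv1 j S t : (1 < j < b)%N -> marks 2 S -> t \in S -> j \notin mv t 1 S ->
  Phi j (mv t 1 S) = z (U S j + (t <= j)).-1.
Proof.
move=> /andP[j1 jb] vS tS nj; rewrite param_pair //; last exact: ltnW.
by rewrite -(unmarked_mv1 vS tS (ltnW j1)) addn1.
Qed.

Lemma param_top j S : (1 < j < b)%N -> marks 2 S -> j.+1 \notin S ->
  fuse_top (Phi j) S = fuse_marks j (Phi 0) S.
Proof.
move=> jb vS nj; have /andP[j1 jb'] := jb; have j0 := ltnW j1.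
rewrite /fuse_marks; case: ifPn => jS.
  rewrite param_top_edge // (fuse_top_single jS) => [|| t tT tj].
  - congr (- (_ * _)); rewrite param_mv1 //; last by rewrite mem_mv eqxx orbF; move: j1; clear; lia.
    by rewrite leqnn addn1.
  - exact: param_edge.
  - by rewrite param_edge // mem_mv jS [j == t]eq_sym tj orbT.
have njm t : t \in S -> j \notin mv t 1 S.
  by move=> tS; rewrite mem_mv negb_or negb_and jS orbT andbT; move: j1; clear; lia.
have be1 : (1 < U S j)%N.
  case: j {jb jb' nj njm j0} j1 jS => // j; rewrite ltnS => j0 jS.
  by rewrite unmarkedS jS; have := unmarked_pos vS isT j0; clear; lia.
have v1 : marks 1 S by apply: marksW vS.
have bek : (U S j < k)%N by apply: unmarked_lt.
have zt := pr_top zr (j := U S j); rewrite be1 bek in zt.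
have -> : Phi 0 S = z 0%N - \sum_(s <- S) gz z (U S s) by [].
rewrite /fuse_top param_pair // mulrBr zt //.
have -> : \sum_(s <- S) (-1) ^+ U S s * Phi j (mv s 1 S) =
    2%:R * (\sum_(s <- S) gz z (U S s)) - \sum_(s <- S) z (U S j).
  rewrite mulr_sumr -sumrB !big_seq; apply: eq_bigr => s sS.
  have q0 : (0 < U S s <= k)%N.
    have := mark_range vS sS; have := unmarked_total v1 => tot /andP[s2 sb].
    rewrite (unmarked_pos vS) //=; last by move: s2; clear; lia.
    by have := unmarked_mono S sb; move: tot; clear; lia.
  have bb : (1 < U S j < k)%N by rewrite be1.
  have [lo hi] := z_compat bb q0.
  rewrite param_mv1 ?njm //; case: (ltngtP s j) => [lt|gt|e]; last by rewrite -e sS in jS.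
    have lt' : (U S s < U S j)%N.
      case: j {jb jb' nj njm j0 jS be1 bek zt bb lo hi} j1 lt (jS) => // j _; rewrite ltnS => sj nj'.
      by rewrite unmarkedS nj' addn1 ltnS unmarked_mono.
    by rewrite (lo lt') addn1 /=; ring.
  have gt' : (U S j < U S s)%N by have := unmarked_mono S gt; rewrite unmarkedS nj addn1.
  by rewrite (hi gt') addn0; ring.
rewrite (sum_const_marks _ vS) -addSn natrD; ring.
Qed.

Lemma param_far i j S : (0 < i)%N -> (i.+1 < j < b)%N -> marks 1 S ->
  i.+1 \notin S -> j.+1 \notin S -> fuse_marks i (Phi j) S = fuse_marks j (Phi i) S.
Proof.
move=> i0 /andP[ij jb] vS ni nj; have j0 : (0 < j)%N by move: ij; clear; lia.
have ji : j != i by move: ij; clear; lia.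
have ji1 : j != i.+1 by move: ij; clear; lia.
have ij1 : i != j.+1 by move: ij; clear; lia.
rewrite /fuse_marks; case: (boolP (i \in S)) => iS; case: (boolP (j \in S)) => jS.
- rewrite !param_edge ?subrr // mem_mv ?iS ?jS ?ji ?orbT //.
  by rewrite [i == j]eq_sym ji orbT.
- rewrite (param_edge z i0 iS) mulr0 !param_pair //; last first.
    by rewrite mem_mv negb_or ji1 negb_and jS orbT.
  have := unmarked_mv j iS ni i0 (ltn0Sn _); rewrite (ltnW ij) (ltnW (ltnW ij)) => /addIn->.
  by rewrite subrr.
- rewrite (param_edge z j0 jS) mulr0 !param_pair //; last first.
    by rewrite mem_mv negb_or ij1 negb_and iS orbT.
  have := unmarked_mv i jS nj j0 (ltn0Sn _).
  have -> : (j.+1 <= i)%N = false by move: ij; clear; lia.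
  have -> : (j <= i)%N = false by move: ij; clear; lia.
  by rewrite !addn0 => ->; rewrite subrr.
rewrite !param_pair //; symmetry; apply: (pr_far zr).
  case: i i0 iS ij {ni ji ji1 ij1} => // i _ iS _; rewrite unmarkedS iS addn1; exact: ltn0Sn.
apply/andP; split; last exact: unmarked_lt.
have e1 : U S i.+1 = (U S i).+1 by rewrite unmarkedS ni addn1.
have e2 : U S j = (U S j.-1).+1.
  by rewrite -{1}(ltn_predK ij) unmarkedS (ltn_predK ij) jS addn1.
by rewrite -e1 e2 ltnS; apply: unmarked_mono; move: ij; clear; lia.
Qed.

Lemma param_near i S : (0 < i)%N -> (i.+1 < b)%N -> marks 1 S ->
  i.+1 \notin S -> i.+2 \notin S ->
  (if i \in S then 2%:R * Phi i S + Phi i (mv i i.+2 S) else 3%:R * Phi i S) =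
  (if i \in S then Phi i.+1 S - 2%:R * Phi i.+1 (mv i i.+1 S) else 3%:R * Phi i.+1 S).
Proof.
move=> i0 ib vS n1 n2; case: ifPn => iS.
  have -> : Phi i.+1 (mv i i.+1 S) = 0 by rewrite param_edge // mem_mv eqxx.
  rewrite (param_edge z i0 iS) !mulr0 add0r subr0.
  rewrite !param_pair //; last by rewrite mem_mv eqxx orbF; clear; lia.
  congr z; have := unmarked_mv i iS n2 i0 (ltn0Sn _); rewrite leqnn unmarkedS n1.
  by clear; lia.
rewrite !param_pair // unmarkedS n1 addn1; apply: (pr_near zr).
  by case: i i0 iS {ib n1 n2} => // i _ iS; rewrite unmarkedS iS addn1.
by have := unmarked_lt vS ib n2; rewrite unmarkedS n1 addn1.
Qed.

(** Along a mark move the left side of the corner equation changes by a combination which is the top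
    equation of the pair (0, j) at [T], where the moving mark stands at 2. Hence one set of marks
    suffices. *)
Lemma param_corner_step j S : (2 < j < b)%N -> marks 3 S -> j \in S -> j.+1 \notin S ->
  let L S := (a.+2)%:R * Phi 0 S + \sum_(s <- S) (-1) ^+ U S s * Phi 0 (mv s 2 S) in
  L S = L (mv j j.+1 S).
Proof.
move=> /andP[j2 jb] vS jS nj; have j1 := ltnW j2; have j0 := ltnW j1.
set q := U S j; set S' := mv j j.+1 S; set T := mv j 2 S => /=.
have n2 : 2%N \notin S by apply: marks_notin vS _.
have v2S : marks 2 S by apply: marksW vS.
have jbb : (1 < j < b)%N by rewrite j1.
have q0 : (0 < q)%N by apply: unmarked_pos v2S _ _.
have nj' : j.+1 \notin T.
  by rewrite mem_mv negb_or negb_and nj orbT andbT; move: j2; clear; lia.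
have vT : marks 2 T by apply: (marks_mv v2S) => //; move: jb j2; clear; lia.
have jT : j \notin T by rewrite mem_mv eqxx orbF; move: j2; clear; lia.
have jS' : j.+1 \in S' by rewrite mem_mv eqxx.
have n2S' : 2%N \notin S' by rewrite mem_mv negb_or negb_and n2 orbT andbT; move: j2; clear; lia.
have uT l : (U T l + (2 <= l) = U S l + (j <= l))%N by apply: unmarked_mv.
have uS' l : (U S' l + (j < l) = U S l + (j <= l))%N by apply: unmarked_mv.
have uTj : U T j = q by have := uT j; rewrite leqnn j1 => /addIn.
have uS'j : U S' j.+1 = q.+1.
  by have := uS' j.+1; rewrite ltnSn leqnSn (unmarkedS S) nj -/q; clear; lia.
have top : fuse_top (Phi j) T = 2%:R * Phi 0 T by rewrite param_top // /fuse_marks (negPf jT).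
have D t : t \in S -> t != j -> [/\ 2%N \in T, t \in T & t \in S `\ j].
  by move=> tS tj; rewrite /T !mem_mv eqxx tj tS orbT in_fsetD1 tj tS.
have mvT : mv j.+1 2 S' = T by rewrite /S' /T mv_mv.
have eT : fuse_top (Phi j) T = a.+2%:R * z q -
    \sum_(s <- S `\ j) (-1) ^+ U T s * Phi j (mv s 1 T).
  rewrite /fuse_top param_pair // uTj sum_mv //.
  have -> : U T 2 = 1%N.
    have uS2 : U S 2%N = 2%N.
      by rewrite !unmarkedS unmarked0 n2 (marks_notin vS).
    by have := uT 2%N; rewrite uS2; move: j2; clear; lia.
  rewrite param_mv1 //; last first.
  - by rewrite mem_mv negb_or negb_and jT orbT andbT; move: j2; clear; lia.
  - by rewrite mem_mv eqxx.
  rewrite uTj j1 addn1 /= expr1 -[a.+2]addn1 natrD; ring.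
rewrite [X in _ + X = _](big_fsetD1 j) //= [X in _ = _ + X](big_fsetD1 j.+1) //= mvT uS'j.
have -> : S' `\ j.+1 = S `\ j.
  apply/fsetP=> x; rewrite !in_fsetD1 mem_mv.
  by have [->|] := eqVneq x j.+1; rewrite /= ?(negPf nj) ?andbF.
apply/eqP; rewrite -subr_eq0; apply/eqP.
have e1 := param_top_edge jbb v2S jS nj; rewrite -/S' -/q in e1.
have -> : Phi 0 S' = Phi 0 S + (-1) ^+ q * z q by rewrite -[Phi 0 S'](subKr (Phi 0 S)) e1 opprK.
have diff : \sum_(s <- S `\ j) (-1) ^+ U S s * Phi 0 (mv s 2 S) -
    \sum_(s <- S `\ j) (-1) ^+ U S' s * Phi 0 (mv s 2 S') =
    (-1) ^+ q * \sum_(s <- S `\ j) (-1) ^+ U T s * Phi j (mv s 1 T).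
  rewrite mulr_sumr -sumrB !big_seq; apply: eq_bigr => t; rewrite in_fsetD1 => /andP[tj tS].
  have [_ tT _] := D t tS tj.
  have t3 := mark_range vS tS.
  have t2 : (2 <= t)%N by move: t3; clear; lia.
  have t0 : (0 < t)%N by move: t3; clear; lia.
  have tj1 : t != j.+1 by apply: contraNneq nj => <-.
  have -> : U S' t = U S t by have := uS' t; move: tj tj1; clear; lia.
  have vt : marks 2 (mv t 2 S) by apply: marks_mv => //; move: t3; clear; lia.
  have mvS' : mv t 2 S' = mv j j.+1 (mv t 2 S).
    by rewrite /S' mvC //; move: j2; clear; lia.
  have jt : j \in mv t 2 S by rewrite mem_mv jS [j == t]eq_sym tj orbT.
  have njt : j.+1 \notin mv t 2 S.
    by rewrite mem_mv negb_or negb_and nj orbT andbT; move: j2; clear; lia.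
  have := param_top_edge jbb vt jt njt; rewrite mvS' -mulrBr => ->.
  rewrite param_mv1 //; last by rewrite mem_mv negb_or negb_and jT orbT andbT; move: j2; clear; lia.
  rewrite uTj; have := unmarked_mv j tS n2 t0 isT; rewrite -/q j1.
  have := uT t; rewrite t2.
  case: (ltngtP t j) => [lt|gt|e]; last by rewrite e eqxx in tj.
    by rewrite !addn1 addn0 => e3 [->]; rewrite -e3 exprS mulN1r mulrNN mulrCA.
  rewrite !addn1 addn0 => -[->] e3; have -> : U (mv t 2 S) j = q.-1 by move: e3 q0; clear; lia.
  have -> : (-1) ^+ q = - (-1) ^+ q.-1 :> K by rewrite -{1}(prednK q0) exprS mulN1r.
  by rewrite mulrN mulNr mulrCA.
have -> : (-1) ^+ q.+1 = - ((-1) ^+ q) :> K by rewrite exprS mulN1r.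
have sq : (-1) ^+ q * (-1) ^+ q = 1 :> K by rewrite -signr_odd -expr2 sqrr_sign.
set A := \sum_(s <- _) _ in diff *; set B := \sum_(s <- _) _ in diff *; set C := \sum_(s <- _) _ in diff eT.
have -> : A = B + (-1) ^+ q * C by rewrite -diff addrC subrK.
have -> : C = a.+2%:R * z q - 2%:R * Phi 0 T by rewrite -top eT opprB addrC subrK.
ring.
Qed.

Lemma param_cocycle : marked_cocycle Phi.
Proof.
split; [exact: param_far|exact: param_near|exact: param_top|].
move=> S b1 vS; rewrite corner_param //.
have k1 : (1 < k)%N.
  have := unmarked_total (marksW (isT : 1 <= 3)%N vS).
  have := unmarked_mono S b1; rewrite !unmarkedS unmarked0 !(marks_notin vS) //.
  by clear; lia.
move: S vS; apply: (@marks_ind b m 3 _ isT) => [v1|S s vS sS s3 ns IH].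
  rewrite corner_first // (pr_corner zr k1) -mulrBl -natrB.
    by congr (_%:R * _); rewrite -!addSn bin2D; lia.
  by rewrite -!addSn bin2D; lia.
case: s sS s3 ns => // j jS; rewrite ltnS /= => j3 nj.
have rng := mark_range vS jS.
rewrite -(IH (mv j.+1 j S)).
- have vT : marks 3 (mv j.+1 j S) by apply: marks_mv => //; move: rng j3; clear; lia.
  have := @param_corner_step j (mv j.+1 j S); rewrite /= mvK // => -> //.
  + by move: rng j3; clear; lia.
  + by rewrite mem_mv eqxx.
  + by rewrite mem_mv eqxx orbF; clear; lia.
- by apply: marks_mv => //; move: rng j3; clear; lia.
by have := msum_mv jS nj; clear; lia.
Qed.

End ParamCocycle.

(** The cocycle equations evaluated at leftmost marks, starting at 1, 2 or 3 according to how many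
    of the first letters are to stay unmarked. *)
Lemma normalized_rel (X : nat -> {fset nat} -> K) : marked_cocycle X ->
  (forall j S, (0 < j < b)%N -> marks 1 S -> j \in S -> j.+1 \notin S -> X j S = 0) ->
  param_rel (cocycle_param X).
Proof.
move=> Xc Xe; set z := cocycle_param X.
have vf d : (0 < d)%N -> (d + m <= b.+1)%N -> marks d (first d) by move=> _; apply: marks_first.
have v1 : marks 1 (first 1) by apply: vf => //; move: mb; clear; lia.
have v2 : marks 2 (first 2) by apply: vf => //; move: mb; clear; lia.
have Xz i : (0 < i)%N -> X (m + i)%N (first 1) = z i.
  by rewrite /z /cocycle_param; case: i.
have nf i : (m < i)%N -> i \notin first 1 by rewrite mem_first; clear; lia.
split.
- move=> i j i0 ij; rewrite -!Xz //; last by move: ij; clear; lia.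
  have := mc_far Xc (i := (m + i)%N) (j := (m + j)%N) (S := first 1).
  rewrite /fuse_marks !(negPf (nf _ _)); try by move: i0 ij; clear; lia.
  move=> h; symmetry; apply: h; rewrite ?nf //; move: i0 ij; clear; lia.
- move=> i i0 ik; rewrite -!Xz //.
  have := mc_near Xc (i := (m + i)%N) (S := first 1).
  have /negPf ni : (m + i)%N \notin first 1 by apply: nf; move: i0; clear; lia.
  rewrite addnS !ni.
  by apply; rewrite ?nf //; move: i0 ik; clear; lia.
- move=> j /andP[j1 jk]; have jb : (1 < m + j < b)%N by move: j1 jk; clear; lia.
  have n2 i : (m.+1 < i)%N -> i \notin first 2 by rewrite mem_first; clear; lia.
  have nj : (m + j)%N \notin first 2 by apply: n2; move: j1; clear; lia.
  have nj1 : (m + j).+1 \notin first 2 by apply: n2; move: j1; clear; lia.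
  have := mc_top Xc jb v2 nj1; rewrite /fuse_marks (negPf nj).
  rewrite /fuse_top -[X 0%N (first 2)]/(z 0%N) => <-.
  have jb' : (0 < m + j < b)%N by move: jb; clear; lia.
  have uj : U (first 2) (m + j) = j by rewrite unmarked_first //; move: j1; clear; lia.
  rewrite (normalized_pair Xc Xe) //; last exact: marksW v2.
  rewrite uj -/z.
  have -> : \sum_(s <- first 2) (-1) ^+ U (first 2) s * X (m + j)%N (mv s 1 (first 2)) =
      \sum_(s <- first 2) - z j.
    rewrite !big_seq; apply: eq_bigr => s sS.
    have srng : (1 < s < 2 + m)%N by rewrite -mem_first.
    have -> : U (first 2) s = 1%N by rewrite unmarked_first //; move: srng; clear; lia.
    rewrite expr1 mulN1r; congr (- _).
    have nm i : (m.+1 < i)%N -> i \notin mv s 1 (first 2).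
      by move=> mi; rewrite mem_mv negb_or negb_and (n2 _ mi) orbT andbT; move: mi; clear; lia.
    rewrite (normalized_pair Xc Xe) ?(mark1_mv v2) ?nm //; try by move: j1; clear; lia.
    congr (cocycle_param X _); have := unmarked_mv1 v2 sS (j := (m + j)%N).
    by rewrite uj; move: srng j1; clear; lia.
  by rewrite (sum_const_marks _ v2) -addSn natrD; ring.
move=> k1; have v3 : marks 3 (first 3) by apply: vf => //; move: k1; clear; lia.
have b1 : (1 < b)%N by move: k1; clear; lia.
have := mc_corner Xc b1 v3.
have X0 S : marks 2 S -> X 0%N S = param_marks z 0 S by apply: normalized_top.
have X1 S : marks 1 S -> 2%N \notin S -> X 1%N S = param_marks z 1 S.
  by move=> vS nS; apply: normalized_value => //; rewrite b1.
have -> : \sum_(s <- first 3) (-1) ^+ U (first 3) s * X 0%N (mv s 2 (first 3)) =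
    \sum_(s <- first 3) (-1) ^+ U (first 3) s * param_marks z 0 (mv s 2 (first 3)).
  rewrite !big_seq; apply: eq_bigr => s sS; rewrite X0 //.
  by apply: (marks_mv (marksW _ v3)) => //; rewrite ?mem_first //; move: b1; clear; lia.
have -> : \sum_(s <- first 3) (-1) ^+ U (first 3) s * X 1%N (mv s 1 (first 3)) =
    \sum_(s <- first 3) (-1) ^+ U (first 3) s * param_marks z 1 (mv s 1 (first 3)).
  rewrite !big_seq; apply: eq_bigr => s sS; rewrite X1 //.
    by apply: (marks_mv (marksW _ v3)) => //; rewrite ?mem_first //; move: b1; clear; lia.
  by rewrite mem_mv negb_or negb_and mem_first /= orbT.
rewrite X0 ?(marksW _ v3) // X1 ?(marksW _ v3) ?mem_first // corner_first // corner_param //.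
move/eqP; rewrite subr_eq => /eqP->; rewrite -mulrDl -natrD; congr (_%:R * _).
by rewrite -!addSn bin2D; lia.
Qed.

(** The parameters of the coboundary of the constant potential t; the m marks add m to the
    coefficient a+1 of [fuse_top]. *)
Definition param_unit (t : K) i : K := if i == 0%N then (a + m).+1%:R * t else 2%:R * t.

Lemma param_unit_gz t q : (0 < q)%N -> gz (param_unit t) q = t + (-1) ^+ q * t.
Proof.
case: q => // q _; elim: q => [|q IH]; first by rewrite gz1 expr1; ring.
by rewrite gzS // IH /param_unit /= !exprS; ring.
Qed.

Lemma fuse_const t j S : marks 1 S -> (0 < j < b)%N ->
  fuse_marks j (fun _ => t) S = param_marks (param_unit t) j S.
Proof.
move=> vS /andP[j0 jb]; rewrite /fuse_marks; case: ifPn => jS.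
  by rewrite param_edge // subrr.
rewrite param_pair // /param_unit; case: j j0 jb jS => // j _ _ jS.
by rewrite unmarkedS jS addn1.
Qed.

Lemma fuse_top_const t S : marks 2 S ->
  fuse_top (fun _ => t) S = param_marks (param_unit t) 0 S.
Proof.
move=> vS; rewrite /fuse_top /param_marks /= /param_unit /=.
have -> : \sum_(s <- S) gz (param_unit t) (U S s) =
    \sum_(s <- S) t + \sum_(s <- S) (-1) ^+ U S s * t.
  rewrite -big_split /= !big_seq; apply: eq_bigr => s sS.
  by rewrite param_unit_gz // (unmarked_pos vS) //; have := mark_range vS sS; clear; lia.
by rewrite (sum_const_marks _ vS) -addSn natrD; ring.
Qed.

(** Normal forms vanish along mark moves, so a potential producing one is constant along moves;
    every set of marks is connected to the leftmost one. *)
Lemma param_coboundary z y :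
  (forall j S, (0 < j < b)%N -> marks 1 S -> j.+1 \notin S -> param_marks z j S = fuse_marks j y S) ->
  (forall S, marks 2 S -> param_marks z 0 S = fuse_top y S) ->
  exists t, forall i, (i < k)%N -> z i = param_unit t i.
Proof.
move=> zj z0; exists (y (first 1)).
have const S : marks 1 S -> y S = y (first 1).
  move: S; apply: (@marks_ind b m 1 _ isT) => // S s vS sS s1 ns IH.
  case: s sS s1 ns => // j jS; rewrite ltnS /= => j0 nj.
  have rng := mark_range vS jS.
  have vT : marks 1 (mv j.+1 j S) by apply: marks_mv => //; move: rng j0; clear; lia.
  have jT : j \in mv j.+1 j S by rewrite mem_mv eqxx.
  have jb : (0 < j < b)%N by move: rng j0; clear; lia.
  have := zj j (mv j.+1 j S) jb vT; rewrite mem_mv eqxx orbF.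
  have -> : j.+1 == j = false by clear; lia.
  move=> /(_ isT); rewrite /fuse_marks jT param_edge // mvK // => /esym/eqP.
  rewrite subr_eq0 => /eqP <-; apply: IH => //.
  by have := msum_mv jS nj; clear; lia.
have v1 : marks 1 (first 1) by apply: marks_first; move: mb; clear; lia.
have v2 : marks 2 (first 2) by apply: marks_first; move: mb; clear; lia.
case=> [|i] ik.
  have := z0 _ v2; rewrite /param_marks /= first_gz subr0 => ->.
  rewrite /fuse_top /param_unit /= const ?(marksW _ v2) //.
  have -> : \sum_(s <- first 2) (-1) ^+ U (first 2) s * y (mv s 1 (first 2)) =
      \sum_(s <- first 2) - y (first 1).
    rewrite !big_seq; apply: eq_bigr => s sS; rewrite const ?(mark1_mv v2) //.
    have -> : U (first 2) s = 1%N.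
      by move: sS; rewrite mem_first unmarked_first //; clear; lia.
    by rewrite expr1 mulN1r.
  by rewrite (sum_const_marks _ v2) -addSn natrD; ring.
have nm j : (m < j)%N -> j \notin first 1 by rewrite mem_first; clear; lia.
have := zj (m + i.+1)%N (first 1); rewrite param_pair ?nm //; try by clear; lia.
rewrite /fuse_marks (negPf (nm _ _)); last by clear; lia.
rewrite unmarked_first // /param_unit /= => h.
have -> : i.+1 = (m + i.+1 - minn m (m + i.+1 - 0))%N by clear; lia.
by apply: h => //; move: ik; clear; lia.
Qed.

End MarkedComplex.

(** * Weight cocycles in mark coordinates *)

Section SortedLists.
Implicit Types (S : {fset nat}) (l : seq nat).

Definition mark_list S : seq nat := sort leq S.

Lemma mem_mark_list S x : (x \in mark_list S) = (x \in S).
Proof. by rewrite mem_sort. Qed.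

Lemma mark_list_uniq S : uniq (mark_list S). Proof. by rewrite sort_uniq fset_uniq. Qed.

Lemma size_mark_list S : size (mark_list S) = #|` S|. Proof. by rewrite size_sort. Qed.

Lemma mark_list_sorted S : sorted ltn (mark_list S).
Proof. by rewrite ltn_sorted_uniq_leq mark_list_uniq sort_sorted //; exact: leq_total. Qed.

Lemma mark_list_eq S l : sorted ltn l -> l =i S -> mark_list S = l.
Proof.
move=> sl lS; apply: (irr_sorted_eq ltn_trans ltnn) => //; first exact: mark_list_sorted.
by move=> x; rewrite mem_mark_list lS.
Qed.

Lemma mark_list_cut S i : i \in S -> exists l1 l2, [/\ mark_list S = l1 ++ i :: l2,
  index i (mark_list S) = size l1, all (ltn^~ i) l1 & all (ltn i) l2].
Proof.
rewrite -mem_mark_list => iS; have := mark_list_sorted S; have := mark_list_uniq S.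
case/splitPr: iS => l1 l2; rewrite cat_uniq => /and3P[_ /= /norP[il1 _] _] sl.
exists l1, l2; split=> //; first by rewrite index_cat (negPf il1) /= eqxx addn0.
  by move: sl; rewrite (sorted_pairwise ltn_trans) pairwise_cat allrel_consr => /andP[/andP[]].
by move: sl; rewrite (sorted_pairwise ltn_trans) pairwise_cat /= => /and3P[_ _ /andP[]].
Qed.

Lemma set_nth_cut l1 l2 i j : set_nth 0%N (l1 ++ i :: l2) (size l1) j = l1 ++ j :: l2.
Proof. by elim: l1 => //= x l1 ->. Qed.

Lemma mark_list_mv S i j l1 l2 : mark_list S = l1 ++ i :: l2 -> all (ltn^~ j) l1 -> all (ltn j) l2 ->
  mark_list (mv i j S) = l1 ++ j :: l2.
Proof.
move=> e l1j l2j; have sl := mark_list_sorted S; apply: mark_list_eq.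
  move: sl; rewrite e !(sorted_pairwise ltn_trans) !pairwise_cat /= !allrel_consr.
  by case/and3P=> /andP[_ ->] -> /andP[_ ->]; rewrite l1j l2j.
move=> x; rewrite mem_mv -mem_mark_list; have := mark_list_uniq S; rewrite e cat_uniq /=.
case/and4P=> _ /norP[il1 _] il2 _; rewrite !mem_cat !inE.
have [->|xi] := eqVneq x i; first by rewrite (negPf il1) (negPf il2) orbF.
by rewrite /= orbCA.
Qed.

Lemma mark_list_mv_front S s y l1 l2 : mark_list S = l1 ++ s :: l2 -> {in S, forall x, y < x}%N ->
  mark_list (mv s y S) = y :: l1 ++ l2.
Proof.
move=> e yS; have sl := mark_list_sorted S; apply: mark_list_eq.
  move: (sl); rewrite e !(sorted_pairwise ltn_trans) /= !pairwise_cat /= !allrel_consr.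
  case/and3P=> /andP[_ ->] -> /andP[_ ->]; rewrite ?andbT /=.
  apply/allP=> x xl; apply: yS; rewrite -mem_mark_list e mem_cat inE.
  by move: xl; rewrite mem_cat => /orP[]->; rewrite ?orbT.
move=> x; rewrite mem_mv -mem_mark_list; have := mark_list_uniq S; rewrite e cat_uniq /=.
case/and4P=> _ /norP[il1 _] il2 _; rewrite !inE !mem_cat !inE.
by have [->|xi] := eqVneq x s; rewrite ?(negPf il1) ?(negPf il2) /= ?orbF.
Qed.

(** The letters 1, ..., s are the marks below s, the unmarked letters and s itself. This trades the
    position in the column, which governs the sign, for an unmarked count. *)
Lemma size_below S s l1 l2 : (forall x, x \in S -> 0 < x)%N ->
  mark_list S = l1 ++ s :: l2 -> all (ltn^~ s) l1 -> all (ltn s) l2 ->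
  (size l1 + unmarked S s).+1 = s.
Proof.
move=> S0 e l1s l2s.
have sS : s \in S by rewrite -mem_mark_list e mem_cat mem_head orbT.
have cnt : (\sum_(1 <= l < s.+1) (l \in S) = (size l1).+1)%N.
  rewrite -big_mkcond /= sum1_count -size_filter.
  have -> : (size l1).+1 = size (rcons l1 s) by rewrite size_rcons.
  apply/perm_size/uniq_perm; rewrite ?filter_uniq ?iota_uniq //.
    by have := mark_list_uniq S; rewrite e -cat_rcons cat_uniq => /andP[].
  move=> x; rewrite mem_filter mem_index_iota mem_rcons inE ltnS.
  rewrite -mem_mark_list e mem_cat inE; apply/idP/idP.
    case/andP=> /or3P[->|->|xl2]; rewrite ?orbT // => /andP[_].
    by have /= sx := allP l2s x xl2; rewrite leqNgt sx.
  case/predU1P => [->|xl1]; first by rewrite eqxx orbT /= leqnn andbT S0.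
  by rewrite xl1 /= (ltnW (allP l1s x xl1)) andbT S0 // -mem_mark_list e mem_cat xl1.
have := congr1 (addn (unmarked S s)) cnt; rewrite /unmarked -big_split /=.
rewrite (eq_bigr (fun _ => 1%N)) => [|i _]; last by case: (i \in S).
by rewrite sum_nat_const_nat; clear; lia.
Qed.

End SortedLists.

Section HatCoord.
Variables (K : fieldType) (n r a m : nat).
Hypotheses (a1 : (1 < a)%N) (rE : r = (a + m)%N).
Local Notation word := {ffun 'I_r -> 'I_n}.
Local Notation tens := 'cV[K]_#|{ffun 'I_r -> 'I_n}|.
Local Notation act B v := (schur_mx B *m v).
Local Notation hook := (a :: nseq m 1%N).
Local Notation inN v := ((v : tens) \in weyl_space K n r hook).
Local Notation coord := (@tab_coord K n r a m).
Implicit Types (w : word) (v : tens) (S : {fset nat}).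

Definition supported w v := forall u, entry v u != 0 -> orbit_of w u.

Definition legal w S := (#|` S| == m) && all (fun x => (0 < x) && (0 < mult w x))%N S.

Lemma legalP w S : reflect (#|` S| = m /\ forall x, x \in S -> (0 < x)%N && (0 < mult w x)%N)
  (legal w S).
Proof.
apply: (iffP andP) => -[/eqP h1 h2]; split=> //; first exact/allP.
by apply/allP.
Qed.

(* The sign (-1)^(sum of S) turns the signs of reordering a column into the       *)
(* counts of unmarked letters.                                                 *)
Definition mark_coord w v S : K := (-1) ^+ msum S * coord w v (mark_list S).

Lemma coordB w v v' l : inN v -> inN v' -> coord w (v - v') l = coord w v l - coord w v' l.
Proof.
by move=> vN vN'; rewrite /tab_coord; case: pickP => [t _|]; rewrite ?entryB ?subr0.
Qed.

Lemma coordZ w c v l : coord w (c *: v) l = c * coord w v l.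
Proof. by rewrite /tab_coord; case: pickP => [t _|]; rewrite ?entryZ ?mulr0. Qed.

Lemma mark_coordB w v v' S : inN v -> inN v' -> mark_coord w (v - v') S = mark_coord w v S - mark_coord w v' S.
Proof. by move=> vN vN'; rewrite /mark_coord coordB // mulrBr. Qed.

Lemma mark_coordZ w c v S : mark_coord w (c *: v) S = c * mark_coord w v S.
Proof. by rewrite /mark_coord coordZ mulrCA. Qed.

Lemma supportedB w v v' : supported w v -> supported w v' -> supported w (v - v').
Proof.
move=> vw vw' u; rewrite entryB; have [e|/vw//] := eqVneq (entry v u) 0.
by rewrite e sub0r oppr_eq0 => /vw'.
Qed.

Lemma supportedZ w c v : supported w v -> supported w (c *: v).
Proof. by move=> vw u; rewrite entryZ mulf_eq0 negb_or => /andP[_ /vw]. Qed.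

Lemma act_weight (w : word) v : supported w v <-> act (gen w (bas K w)) v = v.
Proof.
have E u : entry (act (gen w (bas K w)) v) u = if orbit_of w u then entry v u else 0.
  rewrite gen_actE //; case: ifPn => [/existsP[s /eqP us]|nu].
    rewrite (bigD1 u) /=; last by apply/existsP; exists s; rewrite us eqxx.
    rewrite big1 ?addr0 // => t /andP[/existsP[s' /andP[/eqP <- /eqP e]]].
    by rewrite e eqxx.
  rewrite big1 // => t /existsP[s' /andP[_ /eqP e]]; case/existsP: nu.
  by exists s'; rewrite e.
split=> [vw|e u]; last by rewrite -e E; case: ifP; rewrite ?eqxx.
by apply: entryP => u; rewrite E; case: ifPn => // nu; symmetry; apply/eqP; apply: contraNT nu => /vw.
Qed.

Lemma mark_coord_inj w v : inN v -> supported w v -> (0 < mult w 0)%N ->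
  (forall S, legal w S -> mark_coord w v S = 0) -> v = 0.
Proof.
move=> vN vw w0 v0; apply: (tab_coord_inj a1 rE vN vw w0) => l ls l0 sl lw.
have lE : mark_list [fset x in l] = l by apply: mark_list_eq => // x; rewrite inE.
have /v0/eqP : legal w [fset x in l].
  apply/legalP; split; first by rewrite -size_mark_list lE.
  move=> x; rewrite inE /= => xl; rewrite lw // andbT lt0n.
  by apply: contraNneq l0 => <-.
by rewrite /mark_coord lE mulf_eq0 signr_eq0 /= => /eqP.
Qed.

Lemma legal_list w S : legal w S ->
  [/\ 0%N \notin mark_list S, size (mark_list S) = m & {in mark_list S, forall x, (0 < mult w x)%N}].
Proof.
case/legalP=> c h; split; rewrite ?size_mark_list //; first by rewrite mem_mark_list; apply/negP=> /h.
by move=> x; rewrite mem_mark_list => /h/andP[].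
Qed.

Lemma mark_coord_basis w S0 : letter w 0 = 0%N -> legal w S0 ->
  exists v, [/\ inN v, supported w v & forall S, legal w S -> mark_coord w v S = (S == S0)%:R].
Proof.
move=> w0 wS0; have [l0 sl lw] := legal_list wS0.
have [v [vN vw vE]] := @tab_coord_basis K n r a m a1 rE w _ w0 (mark_list_sorted S0) l0 sl lw.
exists ((-1) ^+ msum S0 *: v); split; [exact: rpredZ|exact: supportedZ|].
move=> S wS; have [l0' sl' _] := legal_list wS.
rewrite mark_coordZ /mark_coord vE ?mark_list_sorted //; have [->|ne] := eqVneq S S0.
  by rewrite eqxx mulr1 -expr2 sqrr_sign.
have /negPf-> : mark_list S != mark_list S0; last by rewrite !mulr0.
by apply: contra_neq ne => e; apply/fsetP=> x; rewrite -!mem_mark_list e.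
Qed.

(** There are finitely many legal sets, all consisting of letters below n, and the dual vectors are
    added one after the other. *)
Lemma mark_coord_exists w (Y : {fset nat} -> K) : letter w 0 = 0%N ->
  exists v, [/\ inN v, supported w v & forall S, legal w S -> mark_coord w v S = Y S].
Proof.
move=> w0; have gen (L : seq {fset nat}) : uniq L -> all (legal w) L -> exists v,
    [/\ inN v, supported w v & forall S, legal w S -> mark_coord w v S = if S \in L then Y S else 0].
  elim: L => [|S0 L IH] /= => [_ _|/andP[nS uL] /andP[wS0 wL]].
    exists 0; split=> [||S _]; first exact: mem0v.
      by move=> u; rewrite entry0 eqxx.
    by rewrite /mark_coord /tab_coord; case: pickP => [t _|_]; rewrite ?entry0 mulr0.
  have [v [vN vw vE]] := IH uL wL; have [v0 [vN0 vw0 vE0]] := mark_coord_basis w0 wS0.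
  have vN' : inN (- Y S0 *: v0) by apply: rpredZ.
  exists (v - (- Y S0 *: v0)); split; first exact: rpredB.
    by apply: supportedB => //; apply: supportedZ.
  move=> S wS; rewrite mark_coordB // mark_coordZ vE // vE0 // inE; case: eqVneq => [->|_] /=.
    by rewrite (negPf nS) mulr1 sub0r opprK.
  by rewrite mulr0 subr0.
pose L := [seq S <- fpowerset [fset x in iota 0 n] | legal w S].
have [||v [vN vw vE]] := gen L; rewrite ?filter_uniq ?fset_uniq ?filter_all //.
exists v; split=> // S wS; rewrite vE // mem_filter wS /= fpowersetE ifT //.
apply/fsubsetP=> x /((legalP _ _ wS).2)/andP[_]; rewrite inE mem_iota /= add0n.
by rewrite /mult => /card_gt0P[k]; rewrite inE => /eqP <-.
Qed.

Lemma supported_theta w w' v : (forall k l, w k = w l -> w' k = w' l) ->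
  supported w' (act (gen w (bas K w')) v).
Proof.
move=> ww' t; rewrite gen_actE //; apply: contraNT => nt; rewrite big1 // => u.
by case/existsP=> s /andP[_ /eqP e]; case/existsP: nt; exists s; rewrite e.
Qed.

End HatCoord.
Section HatTheta.
Variables (K : fieldType) (n r a m : nat).
Hypotheses (a1 : (1 < a)%N) (rE : r = (a + m)%N).
Local Notation word := {ffun 'I_r -> 'I_n}.
Local Notation tens := 'cV[K]_#|{ffun 'I_r -> 'I_n}|.
Local Notation act B v := (schur_mx B *m v).
Local Notation hook := (a :: nseq m 1%N).
Local Notation inN v := ((v : tens) \in weyl_space K n r hook).
Local Notation coord := (@tab_coord K n r a m).
Local Notation legal := (@legal n r m).
Local Notation mark_coord := (@mark_coord K n r a m).

Lemma weyl_act la (B : schur K n r) (v : tens) :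
  v \in weyl_space K n r la -> act B v \in weyl_space K n r la.
Proof.
move=> vN; have := (@weyl_submod K n r la).2 B v 0 vN (mem0v _).
by rewrite addr0.
Qed.

Lemma coord_front w v l1 l2 y : inN v -> (size l1 + size l2).+1 = m ->
  coord w v (l1 ++ y :: l2) = (-1) ^+ size l1 * coord w v (y :: l1 ++ l2).
Proof.
move=> vN; elim/last_ind: l1 l2 => [|l1 x IH] l2 sm; first by rewrite mul1r.
rewrite size_rcons in sm *; rewrite !cat_rcons.
have -> := @tab_coord_swap K n r a m a1 rE w v l1 l2 x y vN; last by rewrite -sm addSn.
rewrite IH /=; last by rewrite -sm /= addnS.
by rewrite exprS mulN1r mulNr.
Qed.

Variables (w w' : word) (x : nat) (y : 'I_n).
Hypotheses (xy : x != y) (w'E : forall k, w' k = (if w k == y then x else w k) :> nat).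
Hypothesis w'0 : letter w' 0 = 0%N.
Variable v : tens.
Hypotheses (vN : inN v) (vw : supported w v).
Local Notation beta := (mult w y).
Local Notation mu := (mult w' x).
Local Notation theta := (gen w (bas K w')).

Lemma mult_y : mult w' y = 0%N.
Proof.
apply/eqP; rewrite cards_eq0; apply/eqP/setP=> k; rewrite !inE w'E.
by case: ifP => [_|/negbT //]; rewrite (negPf xy).
Qed.

Lemma mult_other c : c != x -> c != y -> mult w' c = mult w c.
Proof.
move=> cx cy; apply: eq_card => k; rewrite !inE w'E; case: ifP => // /eqP->.
by rewrite ![_ == c]eq_sym (negPf cx) (negPf cy).
Qed.

Section At.
Variable S : {fset nat}.
Hypothesis wS : legal w' S.

Let y_notin : (y : nat) \notin S.
Proof. by apply/negP=> /((legalP _ _ _ wS).2); rewrite mult_y andbF. Qed.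

Lemma theta_reads : exists2 t, orbit_of w' t & col_reads a m t (mark_list S).
Proof.
have [l0 sl lw] := legal_list wS.
exact: (reads_exists a1 rE w'0 sl (mark_list_uniq S) l0 lw).
Qed.

Lemma coord_theta_at t : orbit_of w' t -> col_reads a m t (mark_list S) ->
  coord w' (act theta v) (mark_list S) = entry (act theta v) t.
Proof. by move=> tw' tl; apply: (tab_coordE a1 rE) => //; apply: weyl_act. Qed.

Lemma mark_coord_theta_free : x != 0%N -> x \notin S ->
  mark_coord w' (act theta v) S = 'C(mu, beta)%:R * mark_coord w v S.
Proof.
move=> x0 xS; have [t tw' tl] := theta_reads; have [l0 sl lw] := legal_list wS.
rewrite /mark_coord (coord_theta_at tw' tl).
rewrite (coord_theta_free a1 rE xy w'E vN vw tw' tl sl) ?mem_mark_list //.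
by rewrite mulrnAr mulr_natl.
Qed.

(** No mark lies between x and y, so replacing one by the other keeps the leg sorted and the only
    sign is the change in the sum of the marks. *)
Lemma mark_coord_theta_col : x != 0%N -> x \in S -> (x < y)%N ->
  (forall s, s \in S -> ~~ (x < s <= y)%N) -> (0 < beta)%N ->
  mark_coord w' (act theta v) S = 'C(mu.-1, beta)%:R * mark_coord w v S +
    (-1) ^+ (y - x) * 'C(mu.-1, beta.-1)%:R * mark_coord w v (mv x y S).
Proof.
move=> x0 xS xly gap b0; have [t tw' tl] := theta_reads; have [l0 sl lw] := legal_list wS.
have [l1 [l2 [e ix l1x l2x]]] := mark_list_cut xS.
have im : (index x (mark_list S) < m)%N by rewrite -sl index_mem mem_mark_list.
have nx : nth 0%N (mark_list S) (index x (mark_list S)) = x by rewrite nth_index ?mem_mark_list.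
rewrite /mark_coord (coord_theta_at tw' tl).
rewrite (coord_theta_col a1 rE xy w'E vN vw tw' tl sl l0 (mark_list_uniq S) im nx b0).
have memS z : z \in l1 ++ x :: l2 -> z \in S by rewrite -e mem_mark_list.
have -> : set_nth 0%N (mark_list S) (index x (mark_list S)) y = mark_list (mv x y S).
  rewrite ix {1}e set_nth_cut -(@mark_list_mv S x y l1 l2 e) //.
    by apply/allP=> z zl /=; apply: ltn_trans xly; have := allP l1x z zl.
  apply/allP=> z zl /=; rewrite ltnNge; apply/negP => zy.
  have := gap z; rewrite memS ?mem_cat ?inE ?zl ?orbT // zy andbT => /(_ isT).
  by have /= -> := allP l2x z zl.
have ms : msum (mv x y S) = (msum S + (y - x))%N.
  by have := msum_mv xS y_notin; move: xly; clear; lia.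
rewrite ms exprD -![coord _ _ _ *+ _]mulr_natl.
have sgn : (-1) ^+ (y - x) * (-1) ^+ (y - x) = 1 :> K by rewrite -expr2 sqrr_sign.
rewrite [X in _ = _ + X]mulrACA [X in _ = _ + X * _]mulrCA sgn mulr1.
by rewrite mulrDr; congr (_ + _); exact: mulrCA.
Qed.

Lemma mark_coord_theta_top : x = 0%N -> (forall s, s \in S -> (y < s)%N) -> (0 < beta)%N ->
  (0 < mult w 0)%N ->
  mark_coord w' (act theta v) S = 'C(mu, beta)%:R * mark_coord w v S -
    'C(mu.-1, beta.-1)%:R *
      \sum_(s <- S) (-1) ^+ (unmarked S s + y.+1) * mark_coord w v (mv s y S).
Proof.
move=> x0 yS b0 wpos; have [t tw' tl] := theta_reads; have [l0 sl lw] := legal_list wS.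
rewrite {1}/mark_coord (coord_theta_at tw' tl).
rewrite (coord_theta_top a1 rE xy w'E vN vw tw' tl sl l0 x0 b0 wpos).
rewrite mulrBr !mulrnAr !mulr_natl; congr (_ - _ *+ _); rewrite mulr_sumr.
have -> : \sum_(s <- S) (-1) ^+ (unmarked S s + y.+1) * mark_coord w v (mv s y S) =
    \sum_(s <- mark_list S) (-1) ^+ (unmarked S s + y.+1) * mark_coord w v (mv s y S).
  by apply: perm_big; rewrite perm_sym; apply/permPl/perm_sort.
rewrite (big_nth 0%N) sl big_mkord; apply: eq_bigr => i _.
set s := nth 0%N (mark_list S) i; have sS : s \in S by rewrite -mem_mark_list mem_nth ?sl.
have [l1 [l2 [e ix l1s l2s]]] := mark_list_cut sS.
have {ix} ix : i = size l1 :> nat by rewrite -ix index_uniq ?mark_list_uniq ?sl.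
rewrite {1}e ix set_nth_cut coord_front //; last first.
  by rewrite -sl e size_cat /= addnS.
rewrite /mark_coord (mark_list_mv_front e) // !mulrA; congr (_ * _).
(* Moving y to the front costs one sign per mark below s; modulo 2 this combines with the change y-s
   of the sum of the marks into the count of unmarked letters plus y+1. *)
have S0 z : z \in S -> (0 < z)%N by move/((legalP _ _ _ wS).2)/andP => [].
have := size_below S0 e l1s l2s; have := msum_mv sS y_notin; have := yS s sS.
move=> ys ms us; rewrite -!exprD -[LHS]signr_odd -[RHS]signr_odd; congr (_ ^+ (nat_of_bool _)).
by move: ys ms us; clear; rewrite !oddD /=; lia.
Qed.

End At.
End HatTheta.

Section MergeHats.
Variables (K : fieldType) (n r A m : nat).
Hypotheses (A1 : (1 < A)%N) (rE : r = (A + m)%N).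
Local Notation word := {ffun 'I_r -> 'I_n}.
Local Notation tens := 'cV[K]_#|{ffun 'I_r -> 'I_n}|.
Local Notation act B v := (schur_mx B *m v).
Local Notation hook := (A :: nseq m 1%N).
Local Notation inN v := ((v : tens) \in weyl_space K n r hook).
Local Notation legal := (@legal n r m).
Local Notation mark_coord := (@mark_coord K n r A m).

Variables (w w' : word) (x y : nat).
Hypotheses (xy : x != y) (yn : (y < n)%N).
Hypothesis w'E : forall k, w' k = (if w k == y :> nat then x else w k) :> nat.
Hypothesis w'0 : letter w' 0 = 0%N.

Let Y : 'I_n := Ordinal yn.
Let w'E' k : w' k = (if w k == Y then x else w k) :> nat.
Proof. by rewrite w'E -val_eqE. Qed.

Lemma merge_mult c : mult w' c =
  if c == x then (mult w x + mult w y)%N else if c == y then 0%N else mult w c.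
Proof.
case: eqP => [->|/eqP cx]; first exact: (@mult_x _ _ w w' x Y xy w'E').
case: eqP => [->|/eqP cy]; first exact: (@mult_y _ _ w w' x Y xy w'E').
exact: (@mult_other _ _ w w' x Y w'E').
Qed.

Lemma legal_merge S : (0 < x)%N ==> (0 < mult w x)%N -> legal w' S = legal w S && (y \notin S).
Proof.
move=> xw; apply/legalP/andP => [[c h]|[/legalP[c h] yS]].
  split; last by apply/negP=> /h; rewrite merge_mult eq_sym (negPf xy) eqxx andbF.
  apply/legalP; split=> // z /[dup] zS /h; rewrite merge_mult.
  case: eqP => [->|_] /andP[z0]; first by rewrite z0 in xw *; move: xw => /= ->.
  by case: ifP => // _ ->; rewrite z0.
split=> // z zS; rewrite merge_mult; have /andP[z0 zw] := h z zS; rewrite z0 /=.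
case: eqP => [e|_]; first by rewrite -e; move: zw; clear; lia.
by rewrite ifN //; apply: contraNneq yS => <-.
Qed.

Variable v : tens.
Hypotheses (vN : inN v) (vw : supported w v).
Local Notation theta := (gen w (bas K w')).

Lemma merge_marks i S : x = i -> y = i.+1 -> (0 < i)%N -> mult w i = 1%N -> mult w y = 1%N ->
  legal w' S -> mark_coord w' (act theta v) S = fuse_marks i (mark_coord w v) S.
Proof.
move=> xi yi i0 wi wy wS; have x0 : x != 0%N by rewrite xi -lt0n.
rewrite /fuse_marks; case: ifPn => iS; last first.
  rewrite -xi in iS.
  rewrite (@mark_coord_theta_free K n r A m A1 rE w w' x Y xy w'E' w'0 v vN vw S wS x0 iS).
  by rewrite merge_mult eqxx xi wi wy.
rewrite -xi in iS; have xly : (x < Y)%N by rewrite /= xi yi.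
have gap s : s \in S -> ~~ (x < s <= Y)%N.
  move=> sS; apply/negP => xs; have e : s = y by move: xs; rewrite /= xi yi; clear; lia.
  by move: sS => /((legalP _ _ _ wS).2); rewrite e merge_mult eq_sym (negPf xy) eqxx andbF.
have b0 : (0 < mult w Y)%N by rewrite wy.
rewrite (@mark_coord_theta_col K n r A m A1 rE w w' x Y xy w'E' w'0 v vN vw S wS x0 iS xly gap b0).
have -> : mult w' x = 2%N by rewrite merge_mult eqxx xi wi wy.
have -> : (Y - x)%N = 1%N by rewrite /= yi xi subSnn.
by rewrite -yi -xi /= wy expr1 mul1r mulr1 mulN1r.
Qed.

Lemma merge_top a S : x = 0%N -> y = 1%N -> mult w 0 = a -> (0 < a)%N -> mult w 1 = 1%N ->
  legal w' S -> mark_coord w' (act theta v) S = fuse_top a (mark_coord w v) S.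
Proof.
move=> x0 y1 wa a0 w1 wS.
have yS s : s \in S -> (Y < s)%N.
  move=> sS; have /andP[s0 sw] := (legalP _ _ _ wS).2 s sS; rewrite /= y1.
  have ne : s != 1%N.
    by rewrite -y1; apply: contraTneq sw => ->; rewrite merge_mult eq_sym (negPf xy) eqxx.
  by move: s0 ne; clear; lia.
have b0 : (0 < mult w Y)%N by rewrite /= y1 w1.
have wpos : (0 < mult w 0)%N by rewrite wa.
rewrite (@mark_coord_theta_top K n r A m A1 rE w w' x Y xy w'E' w'0 v vN vw S wS x0 yS b0 wpos).
rewrite /= merge_mult eqxx x0 wa y1 w1 addn1 bin1 bin0 mul1r /fuse_top.
congr (_ - _); apply: eq_bigr => s _; by rewrite exprD sqrrN expr1n mulr1.
Qed.

Lemma merge_free S N B : x != 0%N -> x \notin S -> (mult w x + mult w y = N)%N ->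
  mult w y = B -> legal w' S -> mark_coord w' (act theta v) S = 'C(N, B)%:R * mark_coord w v S.
Proof.
move=> x0 xS <- <- wS.
rewrite (@mark_coord_theta_free K n r A m A1 rE w w' x Y xy w'E' w'0 v vN vw S wS x0 xS).
by rewrite merge_mult eqxx.
Qed.

Lemma merge_col S N B : x != 0%N -> x \in S -> (x < y)%N ->
  (forall s, s \in S -> ~~ (x < s <= y)%N) ->
  (mult w x + mult w y = N.+1)%N -> mult w y = B.+1 -> legal w' S ->
  mark_coord w' (act theta v) S = 'C(N, B.+1)%:R * mark_coord w v S +
    (-1) ^+ (y - x) * 'C(N, B)%:R * mark_coord w v (mv x y S).
Proof.
move=> x0 xS xly gap eN eB wS; have b0 : (0 < mult w Y)%N by rewrite /= eB.
rewrite (@mark_coord_theta_col K n r A m A1 rE w w' x Y xy w'E' w'0 v vN vw S wS x0 xS xly gap b0).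
by rewrite merge_mult eqxx eN /= eB.
Qed.

Lemma merge_zero S N B : x = 0%N -> (forall s, s \in S -> (y < s)%N) -> (0 < mult w 0)%N ->
  (mult w 0 + mult w y = N.+1)%N -> mult w y = B.+1 -> legal w' S ->
  mark_coord w' (act theta v) S = 'C(N.+1, B.+1)%:R * mark_coord w v S -
    'C(N, B)%:R * \sum_(s <- S) (-1) ^+ (unmarked S s + y.+1) * mark_coord w v (mv s y S).
Proof.
move=> x0 yS wpos eN eB wS; have b0 : (0 < mult w Y)%N by rewrite /= eB.
rewrite (@mark_coord_theta_top K n r A m A1 rE w w' x Y xy w'E' w'0 v vN vw S wS x0 yS b0 wpos).
by rewrite merge_mult eqxx x0 eN /= eB.
Qed.

End MergeHats.

(** * The weights of the hook and of its fusions in mark coordinates *)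

Section HookLink.
Variables (K : fieldType) (n a b m : nat).
Hypotheses (a0 : (0 < a)%N) (mb : (m < b)%N) (bn : (b <= n)%N).
Local Notation r := (a + b)%N.
Local Notation A := (a + (b - m))%N.
Local Notation word := {ffun 'I_r -> 'I_n.+1}.
Local Notation tens := 'cV[K]_#|{ffun 'I_r -> 'I_n.+1}|.
Local Notation act B v := (schur_mx B *m v).
Local Notation la := (A :: nseq m 1%N).
Local Notation inN v := ((v : tens) \in weyl_space K n.+1 r la).
Local Notation legal := (@legal n.+1 r m).
Local Notation mark_coord := (@mark_coord K n.+1 r A m).
Local Notation marks := (marks b m).

Lemma A1_subproof : (1 < A)%N. Proof. by move: a0 mb; clear; lia. Qed.
Lemma rE_subproof : r = (A + m)%N. Proof. by move: mb; clear; lia. Qed.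
Let A1 := A1_subproof.
Let rE := rE_subproof.

(** A word constant on rows; the letters 0, ..., n accommodate the rows 0, ..., b since b <= n. *)
Definition colored (c : nat -> nat) : word := [ffun k : 'I_r => inord (c (k.+1 - a)%N)].
Definition hword : word := colored id.
Definition hword1 j : word := colored (fuse j).
Definition hword2 i j : word := colored (fuse i \o fuse j).

Lemma coloredE (c : nat -> nat) k : (forall l, (l <= b)%N -> (c l <= b)%N) ->
  colored c k = c (k.+1 - a)%N :> nat.
Proof.
move=> cb; rewrite ffunE inordK // ltnS (leq_trans _ bn) // cb //.
by have := ltn_ord k; clear; lia.
Qed.

Lemma fuse_le j l : (l <= b)%N -> (fuse j l <= b)%N.
Proof. by rewrite fuseE; apply: leq_trans; rewrite leq_subr. Qed.

Lemma hwordE k : hword k = (k.+1 - a)%N :> nat. Proof. exact: coloredE. Qed.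
Lemma hword1E j k : hword1 j k = fuse j (k.+1 - a)%N :> nat.
Proof. by apply: coloredE => l; apply: fuse_le. Qed.
Lemma hword2E i j k : hword2 i j k = fuse i (fuse j (k.+1 - a)%N) :> nat.
Proof. by apply: coloredE => l lb; rewrite /= !fuse_le. Qed.

Lemma letter0 (w : word) : (forall k : 'I_r, k = 0%N :> nat -> w k = 0%N :> nat) -> letter w 0 = 0%N.
Proof.
move=> w0; have r0 : (0 < r)%N by move: a0; clear; lia.
by rewrite -[letter w 0]/(letter w (Ordinal r0)) letterE w0.
Qed.

Lemma hword_0 : letter hword 0 = 0%N.
Proof. by apply: letter0 => k k0; rewrite hwordE k0; move: a0; clear; lia. Qed.
Lemma hword1_0 j : letter (hword1 j) 0 = 0%N.
Proof. by apply: letter0 => k k0; rewrite hword1E k0 fuseE; move: a0; clear; lia. Qed.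
Lemma hword2_0 i j : letter (hword2 i j) 0 = 0%N.
Proof. by apply: letter0 => k k0; rewrite hword2E k0 !fuseE; move: a0; clear; lia. Qed.

Lemma mult_hword0 : mult hword 0 = a.
Proof.
have -> : mult hword 0 = #|[set k : 'I_r | (k < a)%N]|.
  by apply: eq_card => k; rewrite !inE hwordE; apply/eqP/idP; clear; lia.
have ar : (a <= r)%N by rewrite leq_addr.
have -> : [set k : 'I_r | (k < a)%N] = [set widen_ord ar i | i in 'I_a].
  apply/setP=> k; rewrite inE; apply/idP/imsetP => [ka|[i _ ->]]; last first.
    by rewrite /= ltn_ord.
  by exists (Ordinal ka) => //; apply: val_inj.
by rewrite card_imset ?card_ord // => i j /(congr1 val) /= e; apply: val_inj.
Qed.

Lemma mult_hword c : (0 < c <= b)%N -> mult hword c = 1%N.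
Proof.
move=> /andP[c0 cb]; have cr : (a + c.-1 < r)%N by move: c0 cb; clear; lia.
rewrite -[RHS](cards1 (Ordinal cr)); apply: eq_card => k; rewrite !inE hwordE -val_eqE /=.
by apply/eqP/eqP; move: c0 a0; clear; lia.
Qed.

Lemma mult_hword_out c : (b < c)%N -> mult hword c = 0%N.
Proof.
move=> cb; apply/eqP; rewrite cards_eq0; apply/eqP/setP=> k; rewrite !inE hwordE.
by apply/negbTE/negP => /eqP; have := ltn_ord k; move: cb; clear; lia.
Qed.

Lemma merge_hword1 j k : hword1 j k = (if hword k == j.+1 :> nat then j else hword k) :> nat.
Proof. by rewrite hword1E hwordE. Qed.
Lemma merge_hword2r i j k : hword2 i j k = (if hword1 j k == i.+1 :> nat then i else hword1 j k) :> nat.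
Proof. by rewrite hword2E hword1E. Qed.
Lemma merge_hword2l i j k : (i.+1 < j)%N ->
  hword2 i j k = (if hword1 i k == j.+1 :> nat then j else hword1 i k) :> nat.
Proof.
by move=> ij; rewrite hword2E hword1E !fuseE; case: eqP; case: eqP; case: eqP; move: ij; clear; lia.
Qed.
(** After the first fusion the letter i+1 is gone, so for neighbouring pairs the second step merges
    i+2 directly into i. *)
Lemma merge_hword2n i k :
  hword2 i i.+1 k = (if hword1 i k == i.+2 :> nat then i else hword1 i k) :> nat.
Proof. by rewrite hword2E hword1E !fuseE; case: eqP; case: eqP; case: eqP; clear; lia. Qed.

Let neqS i : i != i.+1. Proof. by clear; lia. Qed.
Let lt_n j : (j < b)%N -> (j.+1 < n.+1)%N. Proof. by move: bn; clear; lia. Qed.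

Lemma mult_hword1 j c : (j < b)%N -> mult (hword1 j) c =
  if c == j then (mult hword j).+1 else if c == j.+1 then 0%N else mult hword c.
Proof.
move=> jb; rewrite (merge_mult (neqS j) (lt_n jb) (merge_hword1 j)).
by rewrite (mult_hword (c := j.+1)) ?addn1 //.
Qed.

Lemma legal_hword S : legal hword S = marks 1 S.
Proof.
apply/legalP/marksP => -[c h]; split=> // z /h.
  case/andP=> z0 zw; rewrite z0 /= leqNgt; apply: contraTN zw => bz.
  by rewrite mult_hword_out.
by move=> zb; rewrite mult_hword // andbT; case/andP: zb.
Qed.

Lemma legal_hword1 j S : (j < b)%N -> legal (hword1 j) S = marks 1 S && (j.+1 \notin S).
Proof.
move=> jb; rewrite (legal_merge _ (neqS j) (lt_n jb) (merge_hword1 j)) ?legal_hword //.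
by apply/implyP=> j0; rewrite mult_hword // j0 ltnW.
Qed.

Lemma legal_hword2 i j S : (i < j < b)%N ->
  legal (hword2 i j) S = [&& marks 1 S, j.+1 \notin S & i.+1 \notin S].
Proof.
case/andP=> ij jb; have ib := ltn_trans ij jb.
rewrite (legal_merge _ (neqS i) (lt_n ib) (merge_hword2r i j)) ?legal_hword1 // ?andbA //.
apply/implyP=> i0; rewrite mult_hword1 // [i == j]ltn_eqF // ifN; last by move: ij; clear; lia.
by rewrite mult_hword // i0 ltnW.
Qed.

Lemma marks_skip d S : (0 < d)%N -> marks d.+1 S = marks d S && (d \notin S).
Proof.
move=> d0; apply/marksP/andP => [[c h]|[/marksP[c h] dS]].
  split; last by apply/negP=> /h; rewrite ltnn.
  by apply/marksP; split=> // z /h /andP[/ltnW-> ->].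
split=> // z /[dup] zS /h /andP[dz ->]; rewrite andbT ltn_neqAle dz andbT.
by apply: contraNneq dS => ->.
Qed.

Section Coordinates.
Variable v : tens.
Hypotheses (vN : inN v).

Lemma mark_coord_theta j S : supported hword v -> (0 < j < b)%N -> marks 1 S -> j.+1 \notin S ->
  mark_coord (hword1 j) (act (gen hword (bas K (hword1 j))) v) S = fuse_marks j (mark_coord hword v) S.
Proof.
move=> vw /andP[j0 jb] vS nj.
apply: (merge_marks A1 rE (neqS j) (lt_n jb) (merge_hword1 j) (hword1_0 j) vN vw) => //.
- by rewrite mult_hword // j0 ltnW.
- by rewrite mult_hword.
by rewrite legal_hword1 // vS.
Qed.

Lemma mark_coord_theta0 S : supported hword v -> marks 2 S ->
  mark_coord (hword1 0) (act (gen hword (bas K (hword1 0))) v) S = fuse_top a (mark_coord hword v) S.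
Proof.
move=> vw; rewrite marks_skip // => /andP[vS n1]; have b0 : (0 < b)%N by move: mb; clear; lia.
apply: (merge_top A1 rE (neqS 0) (lt_n b0) (merge_hword1 0) (hword1_0 0) vN vw) => //.
- exact: mult_hword0.
- by rewrite mult_hword.
by rewrite legal_hword1 // vS.
Qed.

Lemma mark_coord_far_l i j S : supported (hword1 i) v -> (i.+1 < j < b)%N -> marks 1 S ->
  i.+1 \notin S -> j.+1 \notin S ->
  mark_coord (hword2 i j) (act (gen (hword1 i) (bas K (hword2 i j))) v) S = fuse_marks j (mark_coord (hword1 i) v) S.
Proof.
move=> vw /andP[ij jb] vS ni nj; have ib : (i < b)%N by move: ij jb; clear; lia.
apply: (merge_marks A1 rE (neqS j) (lt_n jb) (fun k => merge_hword2l k ij) (hword2_0 i j) vN vw) => //.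
- by move: ij; clear; lia.
- rewrite mult_hword1 // !ifN; try by move: ij; clear; lia.
  by rewrite mult_hword; move: ij jb; clear; lia.
- rewrite mult_hword1 // !ifN; try by move: ij; clear; lia.
  by rewrite mult_hword; move: ij jb; clear; lia.
by rewrite legal_hword2 ?vS ?nj ?ni // (ltnW ij).
Qed.

Lemma mark_coord_far_r i j S : supported (hword1 j) v -> (0 < i)%N -> (i.+1 < j < b)%N -> marks 1 S ->
  i.+1 \notin S -> j.+1 \notin S ->
  mark_coord (hword2 i j) (act (gen (hword1 j) (bas K (hword2 i j))) v) S = fuse_marks i (mark_coord (hword1 j) v) S.
Proof.
move=> vw i0 /andP[ij jb] vS ni nj; have ib : (i < b)%N by move: ij jb; clear; lia.
apply: (merge_marks A1 rE (neqS i) (lt_n ib) (merge_hword2r i j) (hword2_0 i j) vN vw) => //.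
- rewrite mult_hword1 // !ifN; try by move: ij; clear; lia.
  by rewrite mult_hword; move: i0 ib; clear; lia.
- rewrite mult_hword1 // !ifN; try by move: ij; clear; lia.
  by rewrite mult_hword; move: ib; clear; lia.
by rewrite legal_hword2 ?vS ?nj ?ni // (ltnW ij).
Qed.

Lemma mark_coord_far_top j S : supported (hword1 j) v -> (1 < j < b)%N -> marks 2 S -> j.+1 \notin S ->
  mark_coord (hword2 0 j) (act (gen (hword1 j) (bas K (hword2 0 j))) v) S = fuse_top a (mark_coord (hword1 j) v) S.
Proof.
move=> vw /andP[j1 jb]; rewrite marks_skip // => /andP[vS n1] nj.
have b0 : (0 < b)%N by move: mb; clear; lia.
apply: (merge_top A1 rE (neqS 0) (lt_n b0) (merge_hword2r 0 j) (hword2_0 0 j) vN vw) => //.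
- rewrite mult_hword1 // !ifN ?mult_hword0 //; by move: j1; clear; lia.
- rewrite mult_hword1 // !ifN; try by move: j1; clear; lia.
  by rewrite mult_hword.
by rewrite legal_hword2 ?vS ?nj ?n1 // (ltnW j1).
Qed.

(** Here i occurs twice and i+2 once: the coefficients are C(3,1) without a mark, C(2,1) and C(2,0)
    with one, and the sign is (-1)^2. *)
Lemma mark_coord_near_l i S : supported (hword1 i) v -> (0 < i)%N -> (i.+1 < b)%N -> marks 1 S ->
  i.+1 \notin S -> i.+2 \notin S ->
  mark_coord (hword2 i i.+1) (act (gen (hword1 i) (bas K (hword2 i i.+1))) v) S =
  if i \in S then 2%:R * mark_coord (hword1 i) v S + mark_coord (hword1 i) v (mv i i.+2 S)
  else 3%:R * mark_coord (hword1 i) v S.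
Proof.
move=> vw i0 ib vS n1 n2; have ib' := ltnW ib.
have ii : i != i.+2 by clear; lia.
have lgl : legal (hword2 i i.+1) S by rewrite legal_hword2 ?vS ?n1 ?n2 // ltnSn.
have i'0 : i != 0%N by move: i0; clear; lia.
have mi : mult (hword1 i) i = 2%N by rewrite mult_hword1 // eqxx mult_hword // i0 ltnW.
have m2 : mult (hword1 i) i.+2 = 1%N.
  rewrite mult_hword1 // !ifN; try by clear; lia.
  by rewrite mult_hword.
case: ifPn => iS.
  rewrite (merge_col A1 rE ii (lt_n ib) (merge_hword2n i) (hword2_0 i i.+1) vN vw
    (N := 2) (B := 0)) ?mi ?m2 //.
  - have -> : (i.+2 - i = 2)%N by clear; lia.
    by rewrite sqrrN expr1n !mul1r.
  - move=> s sS; apply/negP => is2; have [] : s = i.+1 \/ s = i.+2 by move: is2; clear; lia.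
      by move=> e; move: n1; rewrite -e sS.
    by move=> e; move: n2; rewrite -e sS.
by rewrite (merge_free A1 rE ii (lt_n ib) (merge_hword2n i) (hword2_0 i i.+1) vN vw
    (N := 3) (B := 1)) ?mi ?m2.
Qed.

(** Here i occurs once and i+1 twice: the coefficients are C(3,2) without a mark, C(2,2) and -C(2,1)
    with one. *)
Lemma mark_coord_near_r i S : supported (hword1 i.+1) v -> (0 < i)%N -> (i.+1 < b)%N -> marks 1 S ->
  i.+1 \notin S -> i.+2 \notin S ->
  mark_coord (hword2 i i.+1) (act (gen (hword1 i.+1) (bas K (hword2 i i.+1))) v) S =
  if i \in S then mark_coord (hword1 i.+1) v S - 2%:R * mark_coord (hword1 i.+1) v (mv i i.+1 S)
  else 3%:R * mark_coord (hword1 i.+1) v S.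
Proof.
move=> vw i0 ib vS n1 n2; have ib' := ltnW ib.
have lgl : legal (hword2 i i.+1) S by rewrite legal_hword2 ?vS ?n1 ?n2 // ltnSn.
have i'0 : i != 0%N by move: i0; clear; lia.
have mi : mult (hword1 i.+1) i = 1%N.
  rewrite mult_hword1 // !ifN; try by clear; lia.
  by rewrite mult_hword // i0 ltnW.
have m2 : mult (hword1 i.+1) i.+1 = 2%N by rewrite mult_hword1 // eqxx mult_hword.
case: ifPn => iS.
  rewrite (merge_col A1 rE (neqS i) (lt_n ib') (merge_hword2r i i.+1) (hword2_0 i i.+1) vN vw
    (N := 2) (B := 1)) ?mi ?m2 //.
  - by rewrite subSnn expr1 mul1r mulN1r mulNr.
  - move=> s sS; apply/negP => is2; have e : s = i.+1 by move: is2; clear; lia.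
    by move: n1; rewrite -e sS.
by rewrite (merge_free A1 rE (neqS i) (lt_n ib') (merge_hword2r i i.+1) (hword2_0 i i.+1) vN vw
    (N := 3) (B := 2)) ?mi ?m2.
Qed.

(** The letter 2 merges into a+1 letters 0; the exponent y+1 = 3 turns the minus sign of the Garnir
    sum into a plus. *)
Lemma mark_coord_corner_l S : supported (hword1 0) v -> (1 < b)%N -> marks 3 S ->
  mark_coord (hword2 0 1) (act (gen (hword1 0) (bas K (hword2 0 1))) v) S =
  a.+2%:R * mark_coord (hword1 0) v S + \sum_(s <- S) (-1) ^+ unmarked S s * mark_coord (hword1 0) v (mv s 2 S).
Proof.
move=> vw b1 vS3; have := vS3; rewrite (marks_skip _ (isT : 0 < 2)%N) (marks_skip _ (isT : 0 < 1)%N) => /andP[/andP[vS n1] n2].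
have b0 := ltnW b1.
have lgl : legal (hword2 0 1) S by rewrite legal_hword2 ?vS ?n1 ?n2.
have m0 : mult (hword1 0) 0 = a.+1 by rewrite mult_hword1 // mult_hword0.
have m2 : mult (hword1 0) 2 = 1%N by rewrite mult_hword1 //= (mult_hword (c := 2)).
rewrite (merge_zero A1 rE (isT : 0 != 2)%N (lt_n b1) (merge_hword2n 0) (hword2_0 0 1) vN vw
    (N := a.+1) (B := 0)) ?m0 ?m2 ?addn1 //.
- rewrite bin1 bin0 mul1r -sumrN; congr (_ + _); apply: eq_bigr => s _.
  by rewrite addn3 !exprS !mulN1r opprK mulNr opprK.
- by move=> s /(mark_range vS3) /andP[].
Qed.

(** Two letters 1 merge into a letters 0, hence C(a+2,2), and C(a+1,1) for the choices containing
    the corner. *)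
Lemma mark_coord_corner_r S : supported (hword1 1) v -> (1 < b)%N -> marks 3 S ->
  mark_coord (hword2 0 1) (act (gen (hword1 1) (bas K (hword2 0 1))) v) S =
  'C(a.+2, 2)%:R * mark_coord (hword1 1) v S -
    a.+1%:R * \sum_(s <- S) (-1) ^+ unmarked S s * mark_coord (hword1 1) v (mv s 1 S).
Proof.
move=> vw b1 vS3; have := vS3; rewrite (marks_skip _ (isT : 0 < 2)%N) (marks_skip _ (isT : 0 < 1)%N) => /andP[/andP[vS n1] n2].
have b0 := ltnW b1.
have lgl : legal (hword2 0 1) S by rewrite legal_hword2 ?vS ?n1 ?n2.
have m0 : mult (hword1 1) 0 = a by rewrite mult_hword1 // mult_hword0.
have m2 : mult (hword1 1) 1 = 2%N by rewrite mult_hword1 //= mult_hword.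
rewrite (merge_zero A1 rE (neqS 0) (lt_n b0) (merge_hword2r 0 1) (hword2_0 0 1) vN vw
    (N := a.+1) (B := 1)) ?m0 ?m2 ?addn2 //.
- rewrite bin1; congr (_ - _ * _); apply: eq_bigr => s _.
  by rewrite exprD sqrrN expr1n mulr1.
- by move=> s /(mark_range vS3); clear; lia.
Qed.

End Coordinates.
End HookLink.

Section ParamMarks.
Variables (K : fieldType) (a b m : nat).
Implicit Types (z : nat -> K) (S : {fset nat}).
Local Notation k := (b - m)%N.

Definition fuse_at j (Y : {fset nat} -> K) S := if j == 0%N then fuse_top a Y S else fuse_marks j Y S.

(** The sets indexing coordinates in weight [hword1 j], where the letter j+1 has disappeared. *)
Definition slot j S := marks b m 1 S && (j.+1 \notin S).

Lemma slot0 S : slot 0 S = marks b m 2 S.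
Proof. by rewrite (marks_skip _ _ _ (isT : 0 < 1)%N). Qed.

Lemma fuse_at_ext j Y Y' S : (j < b)%N -> slot j S ->
  (forall T, marks b m 1 T -> Y T = Y' T) -> fuse_at j Y S = fuse_at j Y' S.
Proof.
move=> jb /[dup] jS /andP[vS nS] YY; rewrite /fuse_at; case: eqP => [j0|/eqP j0].
  rewrite j0 slot0 in jS; rewrite /fuse_top YY //; congr (_ - _).
  by rewrite !big_seq; apply: eq_bigr => s sS; rewrite YY // (mark1_mv jS).
rewrite /fuse_marks; case: ifP => // jS'; rewrite ?YY //.
by apply: marks_mv => //; move: jb; clear; lia.
Qed.

Lemma fuse_at_const t j S : (j < b)%N -> slot j S ->
  fuse_at j (fun _ => t) S = param_marks (param_unit a m t) j S.
Proof.
move=> jb /[dup] jS /andP[vS nS]; rewrite /fuse_at; case: eqP => [j0|/eqP j0].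
  by rewrite j0 slot0 in jS *; rewrite (fuse_top_const _ _ jS).
by rewrite (fuse_const a t vS) // lt0n j0.
Qed.

Lemma fuse_at_shift t j Y S : (j < b)%N -> slot j S ->
  fuse_at j (fun T => Y T + t) S = fuse_at j Y S + param_marks (param_unit a m t) j S.
Proof.
move=> jb jS; rewrite -fuse_at_const // /fuse_at; case: ifP => _; last first.
  by rewrite /fuse_marks; case: ifP => _; ring.
rewrite /fuse_top mulrDr addrACA -opprD -big_split /=; congr (_ - _).
by apply: eq_bigr => s _; rewrite mulrDr.
Qed.

Lemma gz_lin c z z' q : gz (fun i => c * z i + z' i) q = c * gz z q + gz z' q.
Proof.
rewrite /gz mulrN mulr_sumr -opprD -big_split /=; congr (- _).
by apply: eq_bigr => i _; rewrite mulrDr mulrCA.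
Qed.

Lemma param_marks_lin c z z' j S :
  param_marks (fun i => c * z i + z' i) j S = c * param_marks z j S + param_marks z' j S.
Proof.
rewrite /param_marks; case: ifP => _; last by case: ifP => _; rewrite ?mulr0 ?addr0.
rewrite mulrBr addrACA -opprD mulr_sumr -big_split /=; congr (_ - _).
by apply: eq_bigr => s _; rewrite gz_lin.
Qed.

Lemma param_marksZ c z j S : param_marks (fun i => c * z i) j S = c * param_marks z j S.
Proof.
rewrite /param_marks; case: ifP => _; last by case: ifP => _; rewrite ?mulr0.
rewrite mulrBr mulr_sumr; congr (_ - _); apply: eq_bigr => s _.
by rewrite /gz mulrN mulr_sumr; congr (- _); apply: eq_bigr => i _; rewrite mulrCA.
Qed.

Lemma fuse_marks_ext i (Y Y' : {fset nat} -> K) S : Y S = Y' S ->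
  (i \in S -> Y (mv i i.+1 S) = Y' (mv i i.+1 S)) -> fuse_marks i Y S = fuse_marks i Y' S.
Proof. by rewrite /fuse_marks; case: ifP => [_ -> ->|_ ->]. Qed.

Lemma slot_mv j i l S : slot j S -> i \in S -> l \notin S -> (0 < l <= b)%N -> l != j.+1 ->
  slot j (mv i l S).
Proof.
move=> /andP[vS nS] iS lS lb lj; rewrite /slot marks_mv // mem_mv negb_or eq_sym lj.
by rewrite negb_and nS orbT.
Qed.

Lemma marked_cocycle_ext (X X' : nat -> {fset nat} -> K) :
  (forall j S, (j < b)%N -> slot j S -> X' j S = X j S) ->
  marked_cocycle a b m X -> marked_cocycle a b m X'.
Proof.
move=> XX [far near top corner]; split.
- move=> i j S i0 ij vS ni nj.
  have jb : (j < b)%N by case/andP: ij.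
  have ib : (i < b)%N by move: ij; clear; lia.
  have sj : slot j S by apply/andP.
  have si : slot i S by apply/andP.
  rewrite (@fuse_marks_ext i (X' j) (X j)); first last.
  - by move=> iS; apply: XX jb _; apply: slot_mv => //; move: ij; clear; lia.
  - exact: XX.
  rewrite (@fuse_marks_ext j (X' i) (X i)); first exact: far.
    exact: XX.
  by move=> jS; apply: XX ib _; apply: slot_mv => //; move: ij; clear; lia.
- move=> i S i0 ib vS n1 n2.
  have ib' : (i < b)%N := ltnW ib.
  have s1 : slot i S by apply/andP.
  have s2 : slot i.+1 S by apply/andP.
  have := near i S i0 ib vS n1 n2; rewrite (XX i S ib' s1) (XX i.+1 S ib s2).
  case: ifP => // iS; rewrite (XX i _ ib') ?(XX i.+1 _ ib) //.
    by apply: slot_mv => //; move: ib; clear; lia.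
  by apply: slot_mv => //; move: ib; clear; lia.
- move=> j S jb vS nj; have /andP[j1 jb'] := jb.
  have b0 : (0 < b)%N by move: jb'; clear; lia.
  have s0 : slot 0 S by rewrite slot0.
  have sj : slot j S by rewrite /slot nj (marksW _ vS).
  have /andP[_ n1] := s0.
  have -> : fuse_top a (X' j) S = fuse_top a (X j) S.
    rewrite /fuse_top XX //; congr (_ - _); rewrite !big_seq; apply: eq_bigr => s sS.
    by congr (_ * _); apply: XX jb' _; apply: slot_mv => //; move: j1; clear; lia.
  rewrite (@fuse_marks_ext j (X' 0%N) (X 0%N)); first exact: top.
    exact: XX.
  by move=> jS; apply: XX b0 _; apply: slot_mv => //; move: jb; clear; lia.
move=> S b1 vS; have b0 := ltnW b1.
have n1 : 1%N \notin S by apply: marks_notin vS _.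
have n2 : 2%N \notin S by apply: marks_notin vS _.
have s0 : slot 0 S by rewrite /slot n1 (marksW _ vS).
have s1 : slot 1 S by rewrite /slot n2 (marksW _ vS).
have := corner S b1 vS; rewrite (XX 0%N S b0 s0) (XX 1%N S b1 s1).
have e1 s : s \in S -> X' 0%N (mv s 2 S) = X 0%N (mv s 2 S).
  by move=> sS; apply: XX b0 _; apply: slot_mv => //; rewrite ltnW.
have e2 s : s \in S -> X' 1%N (mv s 1 S) = X 1%N (mv s 1 S).
  by move=> sS; apply: XX b1 _; apply: slot_mv.
have -> : \sum_(s <- S) (-1) ^+ unmarked S s * X' 0%N (mv s 2 S) =
    \sum_(s <- S) (-1) ^+ unmarked S s * X 0%N (mv s 2 S).
  by rewrite !big_seq; apply: eq_bigr => s /e1->.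
have -> // : \sum_(s <- S) (-1) ^+ unmarked S s * X' 1%N (mv s 1 S) =
    \sum_(s <- S) (-1) ^+ unmarked S s * X 1%N (mv s 1 S).
by rewrite !big_seq; apply: eq_bigr => s /e2->.
Qed.

Lemma param_marks_ext z z' j S : (forall i, (i < k)%N -> z i = z' i) -> (m < b)%N ->
  (j < b)%N -> slot j S -> param_marks z j S = param_marks z' j S.
Proof.
move=> zz mb jb /[dup] jS /andP[vS nS]; rewrite /param_marks; case: eqP => [j0|_]; last first.
  by case: ifP => // _; rewrite zz //; apply: unmarked_lt nS.
rewrite zz; last by move: mb; clear; lia.
congr (_ - _); rewrite !big_seq; apply: eq_bigr => s sS; rewrite /gz; congr (- _).
have us : (unmarked S s <= k)%N.
  have /andP[_ sb] := mark_range vS sS.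
  by have := unmarked_mono S sb; have := unmarked_total vS; clear; lia.
by rewrite !big_nat; apply: eq_bigr => i /andP[_ iu]; rewrite zz //; apply: leq_trans us.
Qed.

End ParamMarks.

(** * The extension group in terms of parameters *)

Section HookExt.
Variables (K : fieldType) (n a b m : nat).
Hypotheses (a0 : (0 < a)%N) (mb : (m < b)%N) (bn : (b <= n)%N).
Local Notation r := (a + b)%N.
Local Notation A := (a + (b - m))%N.
Local Notation k := (b - m)%N.
Local Notation word := {ffun 'I_r -> 'I_n.+1}.
Local Notation tens := 'cV[K]_#|{ffun 'I_r -> 'I_n.+1}|.
Local Notation act B v := (schur_mx B *m v).
Local Notation la := (A :: nseq m 1%N).
Local Notation inN v := ((v : tens) \in weyl_space K n.+1 r la).
Local Notation legal := (@legal n.+1 r m).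
Local Notation mark_coord := (@mark_coord K n.+1 r A m).
Local Notation marks := (marks b m).
Local Notation slot := (slot b m).
Local Notation hword := (hword n a b).
Local Notation hword1 := (hword1 n a b).
Local Notation hword2 := (hword2 n a b).
Local Notation theta j := (gen hword (bas K (hword1 j))).
Local Notation fuse_at := (@fuse_at K a).
Local Notation wcocycle := (@weight_cocycle K n.+1 a b la hword1 hword2).
Local Notation wcoboundary := (@weight_coboundary K n.+1 a b la hword hword1).
Implicit Types (w : word) (v : tens).
Let A1 := A1_subproof a0 mb.
Let rE := rE_subproof a mb.

Let wE (i : 'I_r) : hword i = row_color a i :> nat. Proof. exact: hwordE. Qed.
Let w1E j (i : 'I_r) (_ : (j < b)%N) : hword1 j i = fuse j (row_color a i) :> nat.
Proof. exact: hword1E. Qed.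
Let w2E i j (l : 'I_r) (_ : (i < j < b)%N) : hword2 i j l = fuse i (fuse j (row_color a l)) :> nat.
Proof. exact: hword2E. Qed.

Definition member_of (w : word) (v : tens) := inN v /\ supported w v.

Lemma member_ofB w v v' : member_of w v -> member_of w v' -> member_of w (v - v').
Proof. by move=> [? ?] [? ?]; split; [exact: rpredB|exact: supportedB]. Qed.

Lemma member_ofZ w c v : member_of w v -> member_of w (c *: v).
Proof. by move=> [? ?]; split; [exact: rpredZ|exact: supportedZ]. Qed.

Lemma member_act w w' v : (forall k l, w k = w l -> w' k = w' l) -> member_of w v ->
  member_of w' (act (gen w (bas K w')) v).
Proof. by move=> ww' [vN _]; split; [exact: weyl_act|exact: supported_theta]. Qed.

Lemma member_theta j v : (j < b)%N -> member_of hword v -> member_of (hword1 j) (act (theta j) v).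
Proof. by move=> jb; apply: member_act => i l; apply: (w_w1 wE w1E jb). Qed.

Lemma mult_first (w : word) : letter w 0 = 0%N -> (0 < mult w 0)%N.
Proof.
have r0 : (0 < r)%N by move: a0; clear; lia.
rewrite -[letter w 0]/(letter w (Ordinal r0)) letterE => e.
by apply/card_gt0P; exists (Ordinal r0); rewrite inE e.
Qed.

Lemma mark_coord_eq w v v' : member_of w v -> member_of w v' -> letter w 0 = 0%N ->
  (forall S, legal w S -> mark_coord w v S = mark_coord w v' S) -> v = v'.
Proof.
move=> vm vm' w0 e; apply/eqP; rewrite -subr_eq0; apply/eqP.
have [dN dw] := member_ofB vm vm'.
apply: (mark_coord_inj A1 rE dN dw (mult_first w0)) => S wS.
by rewrite mark_coordB ?e ?subrr //; [case: vm|case: vm'].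
Qed.

Lemma legal_slot j S : (j < b)%N -> legal (hword1 j) S = slot j S.
Proof. exact: legal_hword1. Qed.

Lemma mark_coord_theta_at j v S : (j < b)%N -> member_of hword v -> slot j S ->
  mark_coord (hword1 j) (act (theta j) v) S = fuse_at j (mark_coord hword v) S.
Proof.
move=> jb [vN vw] /[dup] jS /andP[vS nS]; rewrite /fuse_at; case: eqP => [j0|/eqP j0].
  by rewrite j0 slot0 in jS *; apply: mark_coord_theta0.
by apply: mark_coord_theta => //; rewrite lt0n j0.
Qed.

Lemma wcocycleP x : wcocycle x -> forall j, (j < b)%N -> member_of (hword1 j) (x j).
Proof. by move=> [x1 _] j /x1[? /act_weight]. Qed.

Lemma cocycle_marks x : wcocycle x -> marked_cocycle a b m (fun j => mark_coord (hword1 j) (x j)).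
Proof.
move=> /[dup] /wcocycleP xm [_ x2]; split.
- move=> i j S i0 ij vS ni nj; have [iN iw] := xm i ltac:(move: ij; clear; lia).
  have [jN jw] := xm j ltac:(move: ij; clear; lia).
  rewrite -(mark_coord_far_r a0 mb bn jN jw) // -(mark_coord_far_l a0 mb bn iN iw) // x2 //.
  by move: ij; clear; lia.
- move=> i S i0 ib vS n1 n2; have [iN iw] := xm i (ltnW ib).
  have [jN jw] := xm _ ib.
  rewrite -(mark_coord_near_r a0 mb bn jN jw) // -(mark_coord_near_l a0 mb bn iN iw) // x2 //.
  by rewrite ltnSn.
- move=> j S jb vS nj; have [iN iw] := xm 0%N ltac:(move: jb; clear; lia).
  have [jN jw] := xm j ltac:(move: jb; clear; lia).
  have := vS; rewrite -slot0 => /andP[v1 n1].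
  rewrite -(mark_coord_far_top a0 mb bn jN jw) // -(mark_coord_far_l a0 mb bn iN iw) // x2 //.
  by move: jb; clear; lia.
move=> S b1 vS; have [iN iw] := xm 0%N (ltnW b1); have [jN jw] := xm 1%N b1.
by rewrite -(mark_coord_corner_r a0 mb bn jN jw) // -(mark_coord_corner_l a0 mb bn iN iw) // x2.
Qed.

Lemma marks_cocycle x : (forall j, (j < b)%N -> member_of (hword1 j) (x j)) ->
  marked_cocycle a b m (fun j => mark_coord (hword1 j) (x j)) -> wcocycle x.
Proof.
move=> xm [far near top corner]; split=> [j jb|i j ij].
  by have [xN /act_weight xw] := xm j jb.
have jb : (j < b)%N by case/andP: ij. have ib : (i < b)%N by move: ij; clear; lia.
apply: (@mark_coord_eq (hword2 i j)).
- by apply: (member_act _ (xm i ib)); apply: (w1_w2l a0 w1E w2E ij).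
- by apply: (member_act _ (xm j jb)); apply: (w1_w2r w1E w2E ij).
- exact: hword2_0.
move=> S; rewrite legal_hword2 // => /and3P[vS nj ni].
have [iN iw] := xm i ib; have [jN jw] := xm j jb.
have [ij1|ij1] := ltnP i.+1 j.
  rewrite (mark_coord_far_l a0 mb bn iN iw) ?ij1 //; case: i {ij} ib ij1 ni iN iw => [|i] ib ij1 ni iN iw.
    have v2 : marks 2 S by rewrite -slot0; apply/andP.
    by rewrite (mark_coord_far_top a0 mb bn jN jw) ?ij1 // top ?ij1.
  by rewrite (mark_coord_far_r a0 mb bn jN jw) ?ij1 // (far i.+1) ?ij1.
have ej : j = i.+1 by move: ij ij1; clear; lia.
subst j; case: i {ij ij1} ib jb ni nj iN iw jN jw => [|i] ib jb ni nj iN iw jN jw.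
  have v3 : marks 3 S by rewrite (marks_skip _ _ _ (isT : 0 < 2)%N) -slot0 nj andbT; apply/andP.
  by rewrite (mark_coord_corner_l a0 mb bn iN iw) // (mark_coord_corner_r a0 mb bn jN jw) // corner.
by rewrite (mark_coord_near_l a0 mb bn iN iw) // (mark_coord_near_r a0 mb bn jN jw) // near.
Qed.

Lemma realize (X : nat -> {fset nat} -> K) : exists x : nat -> tens, forall j, (j < b)%N ->
  member_of (hword1 j) (x j) /\ forall S, slot j S -> mark_coord (hword1 j) (x j) S = X j S.
Proof.
have /fin_all_exists[x xP] : forall j : 'I_b, exists v : tens,
    member_of (hword1 j) v /\ forall S, slot j S -> mark_coord (hword1 j) v S = X j S.
  move=> j; have [v [vN vw vX]] := mark_coord_exists A1 rE (X j) (hword1_0 a0 bn j).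
  by exists v; split=> // S jS; rewrite vX // legal_slot.
exists (fun j => if insub j is Some i then x i else 0) => j jb.
by rewrite insubT; apply: xP.
Qed.

Lemma realize_weight (Y : {fset nat} -> K) : exists v : tens,
  member_of hword v /\ forall S, marks 1 S -> mark_coord hword v S = Y S.
Proof.
have [v [vN vw vY]] := mark_coord_exists A1 rE Y (hword_0 a0 bn).
by exists v; split=> // S vS; rewrite vY // legal_hword.
Qed.

Lemma coboundary_of_hats x v : (forall j, (j < b)%N -> member_of (hword1 j) (x j)) ->
  member_of hword v ->
  (forall j S, (j < b)%N -> slot j S -> mark_coord (hword1 j) (x j) S = fuse_at j (mark_coord hword v) S) ->
  wcoboundary x.
Proof.
move=> xm vm xv; exists v; first by case: (vm) => vN /act_weight.
move=> j jb; apply: (@mark_coord_eq (hword1 j)); [exact: xm|exact: member_theta|exact: hword1_0|].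
by move=> S; rewrite legal_slot // => jS; rewrite xv // mark_coord_theta_at.
Qed.

(** The potential of the mark coordinates is realized by a weight vector [v]; subtracting the
    coboundary of [v] makes the cocycle vanish along mark moves, where it equals its normal form. *)
Lemma cocycle_reduce x : wcocycle x -> exists z v, [/\ param_rel a b m z, member_of hword v &
  forall j S, (j < b)%N -> slot j S ->
    mark_coord (hword1 j) (x j) S = fuse_at j (mark_coord hword v) S + param_marks z j S].
Proof.
move=> xc; have xm := wcocycleP xc; have [y yE] := potential mb (cocycle_marks xc).
have [v [vm vy]] := realize_weight y.
pose x' j := x j - act (theta j) v.
have x'm j : (j < b)%N -> member_of (hword1 j) (x' j).
  by move=> jb; apply: member_ofB; [exact: xm|exact: member_theta].
have x'c : wcocycle x'.
  case: xc => x1 x2; split=> [j jb|i j ij]; first by have [? /act_weight] := x'm j jb.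
  have e := etrans (esym (act_mul _ _ v)) (etrans (congr1 (fun B : schur K n.+1 r => act B v)
    (theta_comm K a0 wE w1E w2E ij)) (act_mul _ _ v)).
  by rewrite /x' !mulmxBr x2 //; congr (_ - _).
have x'E j S : (j < b)%N -> slot j S ->
    mark_coord (hword1 j) (x' j) S = mark_coord (hword1 j) (x j) S - fuse_at j (mark_coord hword v) S.
  move=> jb jS; rewrite mark_coordB ?mark_coord_theta_at //; first by case: (xm j jb).
  by case: (member_theta jb vm).
have edge j S : (0 < j < b)%N -> marks 1 S -> j \in S -> j.+1 \notin S ->
    mark_coord (hword1 j) (x' j) S = 0.
  move=> jb vS jS nS; have /andP[j0 jb'] := jb; rewrite x'E ?/slot ?vS // yE //.
  rewrite (fuse_at_ext a (m := m) jb' (Y' := y)) ?/slot ?vS // /fuse_at gtn_eqF // /fuse_marks jS.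
  exact: subrr.
have Xc := cocycle_marks x'c.
exists (cocycle_param m (fun j => mark_coord (hword1 j) (x' j))), v; split=> //.
  exact: normalized_rel.
move=> j S jb jS; apply/eqP; rewrite addrC -subr_eq -x'E //; apply/eqP.
have /andP[vS nS] := jS; have [j0|j0] := posnP j.
  by subst j; rewrite -(normalized_top Xc edge) // -slot0.
by rewrite -(normalized_value Xc edge) // j0.
Qed.

Lemma coboundary_param x z : (forall j, (j < b)%N -> member_of (hword1 j) (x j)) ->
  (forall j S, (j < b)%N -> slot j S -> mark_coord (hword1 j) (x j) S = param_marks z j S) ->
  wcoboundary x -> exists t, forall i, (i < k)%N -> z i = param_unit a m t i.
Proof.
move=> xm xz [v [vN vw'] xv]; have vm : member_of hword v by split=> //; apply/act_weight.
have E j S : (j < b)%N -> slot j S -> param_marks z j S = fuse_at j (mark_coord hword v) S.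
  by move=> jb jS; rewrite -xz // xv // mark_coord_theta_at.
apply: (param_coboundary (y := mark_coord hword v) mb) => [j S /andP[j0 jb] vS nS|S vS].
  by rewrite E ?/slot ?vS // /fuse_at gtn_eqF.
by rewrite E ?slot0 //; move: mb; clear; lia.
Qed.

Local Notation Ext1_hook d := (Ext_dim (schur_scalar n.+1 r) 1
  (weyl K n.+1 r (a :: nseq b 1%N)) (weyl K n.+1 r la) d).

Lemma Ext1_hook0 :
  (forall z : nat -> K, param_rel a b m z ->
     exists t, forall i, (i < k)%N -> z i = param_unit a m t i) -> Ext1_hook 0.
Proof.
move=> zero; apply: (Ext1_dim_weights a0 wE w1E w2E (z := fun _ _ => 0)) => [[]//|x xc].
have [z [v [zr vm xE]]] := cocycle_reduce xc; have [t zt] := zero z zr.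
(* Shifting the potential by the constant t absorbs the remaining part [param_unit]. *)
have [u [um uE]] := realize_weight (fun T => mark_coord hword v T + t).
exists 0; split=> [|c _]; last by apply/rowP=> -[].
apply: weight_coboundary_ext (coboundary_of_hats (wcocycleP xc) um _).
  by move=> j _; rewrite big_ord0 subr0.
move=> j S jb jS; rewrite xE // (param_marks_ext zt) //.
by rewrite (fuse_at_ext a jb jS uE) (fuse_at_shift _ _ _ jb jS).
Qed.

Lemma Ext1_hook1 (z0 : nat -> K) : marked_cocycle a b m (param_marks z0) ->
  (forall z : nat -> K, param_rel a b m z ->
     exists c t, forall i, (i < k)%N -> z i = c * z0 i + param_unit a m t i) ->
  (forall c t, (forall i, (i < k)%N -> c * z0 i = param_unit a m t i) -> c = 0) ->
  Ext1_hook 1.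
Proof.
move=> z0c span indep; have [x0 x0P] := realize (param_marks z0).
have x0m j : (j < b)%N -> member_of (hword1 j) (x0 j) by case/x0P.
have x0c : wcocycle x0.
  apply: marks_cocycle => //; apply: marked_cocycle_ext z0c => j S jb jS.
  by case: (x0P j jb) => _ ->.
apply: (Ext1_dim_weights a0 wE w1E w2E (z := fun _ => x0)) => // x xc.
have xm := wcocycleP xc.
have [z [v [zr vm xE]]] := cocycle_reduce xc; have [c [t zE]] := span z zr.
have [u [um uE]] := realize_weight (fun T => mark_coord hword v T + t).
have xB : wcoboundary (fun j => x j - c *: x0 j).
  apply: (coboundary_of_hats _ um) => [j jb|j S jb jS].
    by apply: member_ofB; [exact: xm|apply: member_ofZ; exact: x0m].
  have [_ x0E] := x0P j jb; have [xN _] := xm j jb; have [x0N _] := x0m j jb.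
  rewrite mark_coordB ?rpredZ // mark_coordZ x0E // xE // (param_marks_ext zE) // param_marks_lin.
  rewrite (fuse_at_ext a jb jS uE) (fuse_at_shift _ _ _ jb jS).
  by rewrite -addrA [_ * _ + _]addrC addrK.
exists (const_mx c); split=> [|c' c'B].
  by apply: weight_coboundary_ext xB => j _; rewrite big_ord1 mxE.
have dB : wcoboundary (fun j => (c' 0 0 - c) *: x0 j).
  apply: weight_coboundary_ext (weight_coboundaryB xB c'B) => j _.
  by rewrite big_ord1 opprB addrC addrA subrK -scalerBl.
have [|j S jb jS|s sE] := @coboundary_param _ (fun i => (c' 0 0 - c) * z0 i) _ _ dB.
- by move=> j jb; apply: member_ofZ; apply: x0m.
- by have [_ x0E] := x0P j jb; rewrite mark_coordZ x0E // param_marksZ.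
apply/rowP=> i; rewrite ord1 mxE; apply/eqP; rewrite eq_sym -subr_eq0.
by rewrite (indep _ _ sE).
Qed.
End HookExt.

(** * The exceptional cases *)

Section Numbers.
Local Open Scope nat_scope.

(** The gcd conditions sorted by characteristic. For p = 2 and k >= 2 the common condition is the
    parity of e+k; k = 2 with e divisible by 4 is the only further case there. *)
Definition exceptional p e k :=
  [|| (k == 1) && (p %| e), [&& 1 < k, p == 2 & odd (e + k)], [&& k == 2, p == 2 & 4 %| e],
      [&& k == 2, p != 2 & p %| e], [&& k == 3, p == 3 & ~~ (3 %| e)]
    | [&& k == 4, p == 3 & 3 %| e]].

Lemma gcd2E x : gcdn 2 x = if odd x then 1 else 2.
Proof.
case: ifP => ox; first by apply/eqP; rewrite -/(coprime 2 x) coprime2n.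
by apply/gcdn_idPl; rewrite dvdn2 ox.
Qed.

Lemma gcd3E x : gcdn 3 x = if 3 %| x then 3 else 1.
Proof.
case: ifP => ox; first exact/gcdn_idPl.
by apply/eqP; rewrite -/(coprime 3 x) prime_coprime ?ox.
Qed.

Lemma exceptionalE p e k : prime p -> 0 < k ->
  [|| (k == 1) && (p %| e), (k == 2) && (p %| (2 * e) %/ gcdn 2 e ^ 2),
      (k == 3) && (p %| 6 %/ (gcdn 2 (e + 1) * gcdn 3 e)),
      (k == 4) && (p %| (2 * gcdn 3 e) %/ gcdn 2 e)
    | [&& 5 <= k, p == 2 & odd (e + k)]] = exceptional p e k.
Proof.
move=> pp k0; have p1 := prime_gt1 pp.
have d1 : (p %| 1) = false by rewrite dvdn1; move: p1; clear; lia.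
have d2 : (p %| 2) = (p == 2) by rewrite dvdn_prime2.
have d3 : (p %| 3) = (p == 3) by rewrite dvdn_prime2.
have d6 : (p %| 6) = (p == 2) || (p == 3) by rewrite (@Euclid_dvdM 2 3) // d2 d3.
case: k k0 => [//|[|[|[|[|k]]]]] _; rewrite /exceptional /= ?andbF ?orbF //.
- rewrite addn2 /= negbK gcd2E; case: ifPn => oe.
    rewrite divn1 Euclid_dvdM // d2 andbT.
    by case: (p == 2).
  have [h eh] : exists h, e = h * 2 by apply/dvdnP; rewrite dvdn2.
  rewrite eh (_ : 2 * (h * 2) = h * 2 ^ 2) ?mulnK //; last by clear; lia.
  rewrite andbF /= (_ : (4 %| h * 2) = (2 %| h)); last by rewrite (@dvdn_pmul2r 2 2).
  case: eqP => [->|/eqP p2] /=; first by rewrite orbF.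
  by rewrite Euclid_dvdM // d2 (negPf p2) orbF.
- have q1 : 6 %/ (1 * 1) = 6 by []. have q2 : 6 %/ (2 * 1) = 3 by [].
  have q3 : 6 %/ (1 * 3) = 2 by []. have q6 : 6 %/ (2 * 3) = 1 by [].
  rewrite gcd2E gcd3E !oddD; case: (odd e); case: (3 %| e); rewrite [odd 1]/= [odd 3]/= ?addbT ?addbF;
  by rewrite /= ?q1 ?q2 ?q3 ?q6 ?d1 ?d2 ?d3 ?d6 ?andbT ?andbF ?orbF.
- have q1 : (2 * 1) %/ 1 = 2 by []. have q2 : (2 * 1) %/ 2 = 1 by [].
  have q3 : (2 * 3) %/ 1 = 6 by []. have q6 : (2 * 3) %/ 2 = 3 by [].
  rewrite gcd2E gcd3E !oddD; case: (odd e); case: (3 %| e); rewrite [odd 4]/= ?addbT ?addbF;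
  by rewrite /= ?q1 ?q2 ?q3 ?q6 ?d1 ?d2 ?d3 ?d6 ?andbT ?andbF ?orbF.
Qed.

End Numbers.
Section Arithmetic.
Variables (K : fieldType) (p a b m : nat).
Hypotheses (pK : p \in [pchar K]) (mb : (m < b)%N).
Local Notation k := (b - m)%N.
Local Notation s := (a + m)%N.
Implicit Types (z : nat -> K).

Let p_pr : prime p := pcharf_prime pK.

Lemma natr0 n : (n%:R == 0 :> K) = (p %| n)%N.
Proof. by rewrite (dvdn_pcharf pK). Qed.

Lemma two_bin : 2%:R * ('C(s.+2, 2))%:R = s.+2%:R * s.+1%:R :> K.
Proof. by rewrite -!natrM -(mul_bin_diag s.+2 1) bin1. Qed.

Lemma char2_parity n : p = 2%N -> n%:R = (odd n)%:R :> K.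
Proof.
move=> p2; rewrite -{1}(odd_double_half n) natrD -muln2 natrM.
by have /eqP-> : 2%:R == 0 :> K; rewrite ?mulr0 ?addr0 // natr0 p2.
Qed.

Lemma rel_chain z : param_rel a b m z -> 3%:R != 0 :> K ->
  forall i, (0 < i < k)%N -> z i = z 1%N.
Proof.
move=> zr t0; elim=> // -[//|i] IH /= ik.
by apply: (mulfI t0); rewrite -(pr_near zr) // IH //= ltnW.
Qed.

Lemma unit_of_two z t : z 0%N = s.+1%:R * t -> (forall i, (0 < i < k)%N -> z i = 2%:R * t) ->
  exists t, forall i, (i < k)%N -> z i = param_unit a m t i.
Proof.
move=> z0 zi; exists t => i ik; rewrite /param_unit; case: eqP => [->//|/eqP i0].
by rewrite zi // lt0n i0.
Qed.

(** With s = a+m the coboundaries are the multiples of (s+1, 2, ..., 2). For odd p and k >= 2 one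
    needs all z_i with i >= 1 equal and 2 z_0 = (s+1) z_1; for p = 2 and s even one needs z_i = 0
    for i >= 1. *)
Lemma generic_unit z : param_rel a b m z -> ~~ exceptional p (a + b) k ->
  exists t, forall i, (i < k)%N -> z i = param_unit a m t i.
Proof.
move=> zr ne; have e_sk : (a + b = s + k)%N by move: mb; clear; lia.
have k0 : (0 < k)%N by move: mb; clear; lia.
have [k1|k1] := leqP k 1.
  have ke : k = 1%N by move: k0 k1; clear; lia.
  have e0 : s.+1%:R != 0 :> K.
    by rewrite natr0; move: ne; rewrite /exceptional e_sk ke addn1 eqxx /= orbF.
  apply: (@unit_of_two _ (z 0%N / s.+1%:R)); first by rewrite mulrCA divff ?mulr1.
  by move=> i; rewrite ke; case: i.
have [p2|p2] := eqVneq p 2%N.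
  have so : ~~ odd s.
    have ev : odd (s + k + k) = odd s by rewrite oddD (oddD s) -addbA addbb addbF.
    by apply: contra ne => so; rewrite /exceptional k1 p2 e_sk ev so !orbT.
  have two0 : 2%:R = 0 :> K by apply/eqP; rewrite natr0 p2.
  have s1 : s.+1%:R = 1 :> K by rewrite (char2_parity _ p2) /= so.
  have s2 : s.+2%:R = 0 :> K by rewrite (char2_parity _ p2) /= negbK (negPf so).
  apply: (@unit_of_two _ (z 0%N)); first by rewrite s1 mul1r.
  rewrite two0 mul0r.
  have [k2|k2] := leqP k 2.
    have ke : k = 2%N by move: k1 k2; clear; lia.
    have C1 : ('C(s.+2, 2))%:R = 1 :> K.
      rewrite (char2_parity _ p2); move: ne; rewrite /exceptional ke p2 e_sk ke /= orbF addn2.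
      rewrite !negb_or => /andP[_].
      have [h ->] : exists h, s = (2 * h)%N by exists s./2; move: so; clear; lia.
      have := mul_bin_diag (2 * h).+2 1; rewrite bin1 /= => e e4.
      have -> : 'C((2 * h).+2, 2) = (h.+1 * (2 * h).+1)%N.
        by apply/eqP; rewrite -(@eqn_pmul2l 2) // -e mulnA (mulnS 2 h).
      have oh : odd h = false by move: e4; clear; lia.
      by rewrite oddM /= mul2n odd_double andbT oh.
    move=> i; rewrite ke => i12; have -> : i = 1%N by move: i12; clear; lia.
    by have := pr_corner zr k1; rewrite s2 C1 mul0r mul1r.
  (* The top relation kills z_2 because s+1 = 1 and 2 = 0; the near relations, 3 being invertible,
     propagate this to all i >= 1. *)
  have three : 3%:R != 0 :> K by rewrite natr0 p2.
  have z2 : z 2 = 0.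
    by have := pr_top zr (j := 2); rewrite k2 two0 mul0r s1 mul1r => ->.
  by move=> i ik; rewrite (rel_chain zr three ik) -(rel_chain zr three (i := 2)) // k2.
have two : 2%:R != 0 :> K by rewrite natr0 dvdn_prime2.
suff [zc z0] : (forall i, (0 < i < k)%N -> z i = z 1%N) /\ 2%:R * z 0%N = s.+1%:R * z 1%N.
  apply: (@unit_of_two _ (z 1%N / 2%:R)) => [|i ik].
    by apply: (mulfI two); rewrite z0 mulrCA [2%:R * (_ / _)]mulrCA divff ?mulr1.
  by rewrite zc // mulrCA divff ?mulr1.
have [k2|k2] := leqP k 2.
  have ke : k = 2%N by move: k1 k2; clear; lia.
  split=> [i|]; first by rewrite ke => i12; have -> : i = 1%N by move: i12; clear; lia.
  have e0 : s.+2%:R != 0 :> K.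
    rewrite natr0; move: ne.
    by rewrite /exceptional e_sk ke p2 (negPf p2) /= ?andbF addn2 ?orbF.
  apply: (mulfI e0); rewrite mulrCA (pr_corner zr k1) mulrA two_bin -mulrA.
  by [].
suff zc : forall i, (0 < i < k)%N -> z i = z 1%N.
  by split=> //; rewrite (pr_top zr (j := 2)) ?zc ?k2.
have [p3|p3] := eqVneq p 3%N; last first.
  by apply: rel_chain => //; rewrite natr0 dvdn_prime2.
have three0 : 3%:R = 0 :> K by apply/eqP; rewrite natr0 p3.
have far i j : (0 < i)%N -> (i.+1 < j < k)%N -> z i = z j.
  by move=> i0 ij; apply: (mulfI two); apply: (pr_far zr).
(* For k = 3 no far relation exists, but s is divisible by 3, and the corner and top relations give
   z_1 = 2 z_0 = z_2. *)
have [k3|k3] := leqP k 3.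
  have ke : k = 3%N by move: k2 k3; clear; lia.
  have s0 : s%:R = 0 :> K.
    move: ne; rewrite /exceptional e_sk ke p3 /= ?andbF ?orbF negbK => e3.
    by apply/eqP; rewrite natr0 p3 -(dvdn_addl _ (dvdnn 3)).
  have two1 : 2%:R * 2%:R = 1 :> K by rewrite -natrM (_ : (2 * 2 = 3 + 1)%N) // natrD three0 add0r.
  have s1E : s.+1%:R = 1 :> K by rewrite -addn1 natrD s0 add0r.
  have s2E : s.+2%:R = 2%:R :> K by rewrite -addn2 natrD s0 add0r.
  have C1 : ('C(s.+2, 2))%:R = 1 :> K.
    by apply: (mulfI two); rewrite two_bin s2E s1E.
  have := pr_corner zr k1; rewrite C1 mul1r s2E => z1.
  have := pr_top zr (j := 2); rewrite k2 z1 s1E mul1r => /(_ isT) z2.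
  move=> i; rewrite ke => i12; have [] : i = 1%N \/ i = 2%N by move: i12; clear; lia.
    by move=> ->.
  by move=> ->; rewrite -z2.
have z3 : z 3 = z 1%N by rewrite -(far 1%N 3).
suff z2 : z 2 = z 1%N.
  move=> i ik; have [i3|i3] := leqP 3 i; first by rewrite -(far 1%N i) //; move: i3 ik; clear; lia.
  by case: i ik i3 => [//|[|[|i]]].
(* For k >= 5 the far relations link 2 with 4 and 4 with 1. For k = 4 the index 2 is isolated, and
   the top relations compare z_2 with z_3 as s+1 is invertible. *)
have [k4|k4] := leqP k 4; last by rewrite (far 2 4) // -(far 1%N 4) // k4 // ltnW.
have ke : k = 4%N by move: k3 k4; clear; lia.
have s1 : s.+1%:R != 0 :> K.
  rewrite natr0 p3; move: ne; rewrite /exceptional e_sk ke p3 /=.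
  by rewrite (_ : (s + 4 = s.+1 + 3)%N) ?(dvdn_addl _ (dvdnn 3)) //; clear; lia.
apply: (mulfI s1); rewrite -z3 -!(pr_top zr) // ke.
Qed.

(** The representative (0, 1, 0, 1): it separates z_1 from z_2 while respecting the far relation
    between 1 and 3. *)
Definition parity_class i : K := (odd i)%:R.

Lemma gz_parity : [/\ gz parity_class 1 = 0, gz parity_class 2 = 1, gz parity_class 3 = 1
  & gz parity_class 4 = 2%:R].
Proof.
have g2 : gz parity_class 2 = 1 by rewrite gz2.
have g3 : gz parity_class 3 = 1 by rewrite gzS // g2 /parity_class mulr0 subr0.
split=> //; first exact: gz1.
by rewrite gzS // g3 /parity_class /= !exprS expr0; ring.
Qed.

(** The only relation is the corner one, and it is void. Both parameters are free while the
    coboundaries form the line of (-1, 2), which does not contain (0, 1). *)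
Lemma parity_class_two : k = 2%N -> s.+2%:R = 0 :> K -> ('C(s.+2, 2))%:R = 0 :> K ->
  [/\ marked_cocycle a b m (param_marks parity_class),
      forall z, param_rel a b m z ->
        exists c t, forall i, (i < k)%N -> z i = c * parity_class i + param_unit a m t i
    & forall c t, (forall i, (i < k)%N -> c * parity_class i = param_unit a m t i) -> c = 0].
Proof.
move=> ke s2 C0; have s1 : s.+1%:R = -1 :> K by apply/eqP; rewrite -addr_eq0 natr1 s2.
split.
- apply: param_cocycle => //; first split.
  + by move=> i j; rewrite ke; clear; lia.
  + by move=> i; rewrite ke; clear; lia.
  + by move=> j; rewrite ke; clear; lia.
  + by rewrite C0 s2 !mul0r.
  by move=> be q; rewrite ke; clear; lia.
- move=> z zr; exists (z 1%N + 2%:R * z 0%N), (- z 0%N) => i.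
  rewrite ke /param_unit s1 /parity_class; case: i => [|[|//]] _ /=; ring.
move=> c t; rewrite ke => e; have := e 0%N isT; have := e 1%N isT.
rewrite /parity_class /param_unit /= s1 mulr0 mulr1 mulN1r => -> /esym/eqP.
by rewrite oppr_eq0 => /eqP->; rewrite mulr0.
Qed.

(** Since 3 = 0 the near relations are void, and z_1 - z_2 is an invariant vanishing on
    coboundaries; t = 2 z_2 is forced by 2 t = z_2, as 4 = 1. *)
Lemma parity_class_three : p = 3%N -> (2 < k < 5)%N -> ('C(s.+2, 2))%:R = 0 :> K ->
  (k = 4%N -> s.+1%:R = 0 :> K) ->
  [/\ marked_cocycle a b m (param_marks parity_class),
      forall z, param_rel a b m z ->
        exists c t, forall i, (i < k)%N -> z i = c * parity_class i + param_unit a m t i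
    & forall c t, (forall i, (i < k)%N -> c * parity_class i = param_unit a m t i) -> c = 0].
Proof.
move=> p3 /andP[k2 k5] C0 s4; have three0 : 3%:R = 0 :> K by apply/eqP; rewrite natr0 p3.
have two : 2%:R = -1 :> K by apply/eqP; rewrite -addr_eq0 natr1 three0.
have [g1 g2 g3 g4] := gz_parity.
split.
- apply: param_cocycle => //; first split.
  + move=> i j i0 ij; have [-> ->] : i = 1%N /\ j = 3%N by move: i0 ij k5; clear; lia.
    by [].
  + by move=> i _ _; rewrite three0 !mul0r.
  + move=> j j12; rewrite /parity_class mulr0.
    have [->|[-> k4]] : j = 2%N \/ j = 3%N /\ k = 4%N by move: j12 k5; clear; lia.
      by rewrite mulr0.
    by rewrite s4 // mul0r.
  + by rewrite C0 mul0r /parity_class mulr0.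
  move=> be q bek qk; have [be23 q4] : (be = 2%N \/ be = 3%N) /\
    [\/ q = 1%N, q = 2%N, q = 3%N | q = 4%N].
    split; first by move: bek k5; clear; lia.
    case: q qk => [|[|[|[|[|q]]]]] //; rewrite ?ltnS ?leqn0; try by constructor.
    by move: k5; clear; lia.
  by case: be23 => ->; case: q4 => ->; rewrite ?(g1, g2, g3, g4) /parity_class /= !exprS expr0 two;
    split=> // _; first [ring | by rewrite ?(mulN1r, mulrN1, mulr1, opprK) -[1 + 1]/(2%:R) two].
- move=> z zr; exists (z 1%N - z 2), (2%:R * z 2) => i ik.
  have top := pr_top zr (j := 2); rewrite k2 in top.
  have z0 : z 0%N = s.+1%:R * (2%:R * z 2).
    rewrite mulrCA -top // mulrA -natrM (_ : (2 * 2 = 3 + 1)%N) // natrD three0 add0r.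
    by rewrite mul1r.
  rewrite /param_unit /parity_class; case: i ik => [_|[_|[_|[k4|i]]]] /=.
  + by rewrite mulr0 add0r.
  + by rewrite two; ring.
  + by rewrite two; ring.
  + have <- : z 1%N = z 3.
      have two0 : 2%:R != 0 :> K by rewrite natr0 p3.
      by apply: (mulfI two0); rewrite (pr_far zr (j := 3)) ?k4.
    by rewrite two; ring.
  by move: k5; clear; lia.
move=> c t e; have := e 2 k2; have := e 1%N (ltnW k2).
by rewrite /parity_class /param_unit /= mulr0 mulr1 => -> <-.
Qed.

Lemma exceptional_class : exceptional p (a + b) k -> exists z0 : nat -> K,
  [/\ marked_cocycle a b m (param_marks z0),
      forall z, param_rel a b m z ->
        exists c t, forall i, (i < k)%N -> z i = c * z0 i + param_unit a m t i
    & forall c t, (forall i, (i < k)%N -> c * z0 i = param_unit a m t i) -> c = 0].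
Proof.
have e_sk : (a + b = s + k)%N by move: mb; clear; lia.
rewrite /exceptional e_sk => /or4P[].
(* For k = 1 only z_0 exists, and the coboundaries vanish because p divides s+1 = a+b. *)
- case/andP=> /eqP ke pe; exists (fun _ => 1); split.
  + by apply: param_cocycle => //; [split|]; rewrite ke => *; exfalso; lia.
  + move=> z zr; exists (z 0%N), 0 => i; rewrite ke ltnS leqn0 => /eqP->.
    by rewrite /param_unit eqxx mulr0 addr0 mulr1.
  + move=> c t /(_ 0%N); rewrite ke mulr1 => ->//; rewrite /param_unit eqxx.
    by have /eqP-> : s.+1%:R == 0 :> K; rewrite ?mul0r // natr0 -addn1 -ke.
- case/and3P=> k1 /eqP p2 so.
  have {}so : odd s by move: so; rewrite oddD (oddD s) -addbA addbb addbF.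
  have two0 : 2%:R = 0 :> K by apply/eqP; rewrite natr0 p2.
  have three1 : 3%:R = 1 :> K by rewrite (char2_parity _ p2).
  have s1 : s.+1%:R = 0 :> K by rewrite (char2_parity _ p2) /= so.
  have s2 : s.+2%:R = 1 :> K by rewrite (char2_parity _ p2) /= negbK so.
  have sgn q : (-1) ^+ q = 1 :> K.
    suff -> : -1 = 1 :> K by rewrite expr1n.
    by apply/eqP; rewrite -subr_eq0 -opprD -[1 + 1]/(2%:R) two0 oppr0.
  have unit0 (t : K) i : param_unit a m t i = 0.
    by rewrite /param_unit s1 two0 !mul0r; case: eqP.
  (* All coboundaries vanish here. The near relations make the z_i with i >= 1 equal, and the corner
     relation with s+2 = 1 forces z_0. *)
  exists (fun i => if i == 0%N then ('C(s.+2, 2))%:R else 1); split.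
  + apply: param_cocycle => //; first split.
    * by move=> i j i0 ij; rewrite two0 !mul0r.
    * by move=> i i0 ij; rewrite gtn_eqF.
    * by move=> j /andP[j1 _]; rewrite two0 s1 !mul0r.
    * by rewrite s2 mul1r mulr1.
    move=> be q /andP[be1 _] _; rewrite two0 !mul0r sgn.
    have /negPf-> : be != 0%N by move: be1; clear; lia.
    (* With be >= 2 neither value is the special one at 0, and both compatibility conditions read 0
       = 1 + 1. *)
    have /negPf-> : be.-1 != 0%N by move: be1; clear; lia.
    by rewrite mulr1 -[1 + 1]/(2%:R) two0.
  + move=> z zr; exists (z 1%N), 0 => i ik; rewrite unit0 addr0; case: eqP => [->|/eqP i0].
      by have := pr_corner zr k1; rewrite s2 mul1r mulrC.
    by rewrite mulr1 (rel_chain zr) ?lt0n ?i0 // three1 oner_eq0.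
  + by move=> c t /(_ 1%N k1); rewrite unit0 mulr1.
- case/and3P=> /eqP ke /eqP p2 e4; rewrite ke in e4; exists parity_class.
  have [h sh] : exists h, s = (4 * h).+2 by exists (s %/ 4)%N; move: e4; clear; lia.
  have so : odd s = false by rewrite sh; clear; lia.
  apply: parity_class_two => //; first by rewrite (char2_parity _ p2) /= so.
  have -> : 'C(s.+2, 2) = (2 * h.+1 * s.+1)%N.
    apply/eqP; rewrite -(@eqn_pmul2l 2) // -(mul_bin_diag s.+2 1) bin1 /= !mulnA.
    by rewrite sh; apply/eqP; congr (_ * _)%N; clear; lia.
  by rewrite !natrM; have /eqP-> : 2%:R == 0 :> K; rewrite ?mul0r // natr0 p2.
case/or3P=> /and3P[/eqP ke]; last first.
- move=> /eqP p3 e3; rewrite ke in e3; exists parity_class.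
  have s1 : s.+1%:R = 0 :> K.
    apply/eqP; rewrite natr0 p3; move: e3.
    by rewrite (_ : (s + 4 = s.+1 + 3)%N) ?(dvdn_addl _ (dvdnn 3)) //; clear; lia.
  apply: parity_class_three => //; first by rewrite ke.
  have two : 2%:R != 0 :> K by rewrite natr0 p3.
  by apply: (mulfI two); rewrite two_bin s1 !mulr0.
- move=> /eqP p3 e3; rewrite ke in e3; exists parity_class.
  apply: parity_class_three => //; [by rewrite ke| |by rewrite ke].
  have two : 2%:R != 0 :> K by rewrite natr0 p3.
  apply: (mulfI two); rewrite two_bin -natrM mulr0; apply/eqP; rewrite natr0 p3.
  by move: e3; rewrite (dvdn_addl _ (dvdnn 3)) Euclid_dvdM //; clear; lia.
move=> p2 pe; rewrite ke in pe; exists parity_class.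
have s2 : s.+2%:R = 0 :> K by apply/eqP; rewrite natr0 -addn2.
have two : 2%:R != 0 :> K by rewrite natr0 dvdn_prime2.
by apply: parity_class_two => //; apply: (mulfI two); rewrite two_bin s2 mul0r mulr0.
Qed.

End Arithmetic.

End HookWeyl.

Theorem corollary4p8 (K : fieldType) (p n a b k : nat)
    (infK : forall s : seq K, exists x : K, x \notin s)
    (charK : p \in [pchar K]%R)
    (a_ge1 : 1 <= a) (k_bounds : 1 <= k <= b) (n_ge : b + 1 <= n) :
  let Ext1_dim :=
    Ext_dim (schur_scalar n (a + b)) 1
      (weyl K n (a + b) (a :: nseq b 1))
      (weyl K n (a + b) (a + k :: nseq (b - k) 1)) in
  let one_dim_case :=
    [|| (k == 1) && (p %| a + b),
        (k == 2) && (p %| (2 * (a + b)) %/ gcdn 2 (a + b) ^ 2),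
        (k == 3) && (p %| 6 %/ (gcdn 2 (a + b + 1) * gcdn 3 (a + b))),
        (k == 4) && (p %| (2 * gcdn 3 (a + b)) %/ gcdn 2 (a + b))
      | [&& 5 <= k, p == 2 & odd (a + b + k)]] in
  (one_dim_case -> Ext1_dim 1) /\ (~~ one_dim_case -> Ext1_dim 0).
Proof.
case/andP: k_bounds => k0 kb; have k_eq : k = b - (b - k) by rewrite subKn.
(* The development counts the m = b-k marks of the target hook, and recovers k as b-m. *)
have mb : b - k < b by rewrite ltn_subrL k0 (leq_trans k0 kb).
case: n n_ge => [|n'] n_ge; first by rewrite addn1 in n_ge.
have bn : b <= n' by rewrite addn1 in n_ge.
move=> Ext1_dim one_dim_case.
have -> : one_dim_case = HookWeyl.exceptional p (a + b) (b - (b - k)).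
  by rewrite -k_eq -HookWeyl.exceptionalE // (GRing.Theory.pcharf_prime charK).
have a_k : a + k = a + (b - (b - k)) by rewrite -k_eq.
rewrite /Ext1_dim a_k; split=> [exc|not_exc].
  have [z0 [z0_cocycle z0_span z0_indep]] := HookWeyl.exceptional_class charK mb exc.
  exact: (HookWeyl.Ext1_hook1 a_ge1 mb bn z0_cocycle z0_span z0_indep).
apply: (HookWeyl.Ext1_hook0 a_ge1 mb bn) => z z_rel.
exact: (HookWeyl.generic_unit charK mb z_rel not_exc).
Qed.
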